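(* Given $N$ and $n$, if there exists a $y^{\star}_+>0$ such that $\lambda_3(y^{\star}_+,N,n)>0$, then there exist $y^{\star}_0\in(0,y^{\star}_+)$ and $y^{\star}_1\in(y^{\star}_+,+\infty)$ such that $$\lambda_3(y^{\star}_0,N,n)=\lambda_3(y^{\star}_1,N,n)=0.$$ In particular, the existence of $y^{\star}_0$ indicates a transition from supercritical pitchfork bifurcation to subcritical pitchfork bifurcation (of the reduced three-cluster dynamics) at $\epsilon=\epsilon(y^{\star}_0,N,n)$ and $u=u(y^{\star}_0,N,n)$. This implies a cascade in the network with three clusters. If there does not exist such a $y^{\star}_+$, then there is no such transition and thus no cascade.
   Context: **Network and dynamics.** Let $\epsilon>0$. A network of $N$ agents consists of three clusters: cluster 1 (high response) has $n$ agents with threshold $1/2-\epsilon$, cluster 2 (low response) has $n$ agents with threshold $1/2+\epsilon$, and cluster 3 (neutral response) has $N-2n$ agents with threshold $1/2$. All edges are undirected and there are no self-loops; each cluster is all-to-all connected, every agent of cluster 3 is connected to every agent of clusters 1 and 2, and there are no connections between clusters 1 and 2. The state $x_i\in\mathbb R$ of agent $i$, with threshold $\mu_i$, adjacency entries $a_{ij}\in\{0,1\}$ and degree $d_i=\sum_j a_{ij}$, evolves by $$\dot x_i=-d_ix_i+\sum_{j=1}^N a_{ij}\,u\tanh(x_j)+d_i(1-2\mu_i),$$ where $u>0$ is the social sensitivity. With $y_k$ the average state of cluster $k$, the reduced three-cluster dynamics are $$\dot y_1=-(N-n-1)y_1+(n-1)u\tanh(y_1)+(N-2n)u\tanh(y_3)+2(N-n-1)\epsilon,$$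 $$\dot y_2=-(N-n-1)y_2+(n-1)u\tanh(y_2)+(N-2n)u\tanh(y_3)-2(N-n-1)\epsilon,$$ $$\dot y_3=-(N-1)y_3+(N-2n-1)u\tanh(y_3)+nu\tanh(y_1)+nu\tanh(y_2),$$ with bifurcation parameter $u$. The point $(y^\star,-y^\star,0)$ is an equilibrium when $$-(N-n-1)y^{\star}+(n-1)u\tanh(y^{\star})+2(N-n-1)\epsilon=0.$$ **Reduction near the equilibrium.** Primes denote derivatives. Put $$a=\tfrac{n-1}{N-2n}\tfrac16\tanh'''(y^{\star}),\quad b=\tfrac{n-1}{N-2n}\tfrac12\tanh''(y^{\star}),\quad c=c(y^\star,u)=\tfrac{n-1}{N-2n}\tanh'(y^{\star})-\tfrac{N-n-1}{(N-2n)u},$$ $$\lambda_1(y^{\star},u,N,n)=-(N-1)-\Big(1+\tfrac{n+1}{n-1}(N-2n)\Big)u-\tfrac{n(N-n-1)}{n-1}\tfrac{2}{c},$$ $$\lambda_3(y^{\star},u,N,n)=\tfrac13\Big(1+\tfrac{n+1}{n-1}(N-2n)\Big)u+\tfrac{n(N-n-1)}{n-1}\Big(\tfrac{2}{3c}-\tfrac{4b^2}{c^5}+\tfrac{2a}{c^4}\Big).$$ For a perturbed point $(y^\star+\Delta y_1,-y^\star+\Delta y_2,\Delta y_3)$, the equilibrium conditions reduce to the single condition $$\tfrac{\mathrm d}{\mathrm dt}(\Delta y_3)=\lambda_1\Delta y_3+\lambda_3(\Delta y_3)^3+o((\Delta y_3)^3)=0.$$ When $\lambda_1$ crosses zero from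 negative to positive, the pitchfork bifurcation is supercritical if $\lambda_3<0$ and subcritical if $\lambda_3>0$. The transition from supercritical to subcritical pitchfork occurs when, at $\lambda_1=0$, $\lambda_3$ crosses zero from negative to positive. **Functions of $y^\star$ (obtained from $\lambda_1=0$ and the equilibrium equation).** Put $$c_2=\Big(n+1+\tfrac{n-1}{N-2n}\Big)\tanh'(y^{\star}),\quad c_1=\tfrac{(N-2n-1)(N-n-1)}{N-2n}+\tfrac{(N-1)(n-1)}{N-2n}\tanh'(y^{\star}),\quad c_0=-\tfrac{(N-n-1)(N-1)}{N-2n},$$ $$u(y^{\star},N,n)=\frac{-c_1+\sqrt{c_1^2-4c_2c_0}}{2c_2}=\frac{-2c_0}{\sqrt{c_1^2-4c_2c_0}+c_1},$$ $$\epsilon(y^{\star},N,n)=\tfrac12y^{\star}-\tfrac{n-1}{2(N-n-1)}\,u(y^{\star},N,n)\tanh(y^{\star}),$$ $$\lambda_3(y^{\star},N,n)=-\tfrac13(N-1)+\tfrac{n(N-n-1)}{n-1}\cdot\frac{2a\,c-4b^2}{c^5},$$ where in the last formula $c=c(y^\star,u(y^\star,N,n))$; it is the value of $\lambda_3(y^\star,u,N,n)$ when $u=u(y^\star,N,n)$, i.e. when $\lambda_1=0$. **Cascade.** Through a feedback law, $u$ slowly increases after an innovation is introduced and crosses the bifurcation value. Let $\bar y=(ny_1+ny_2+(N-2n)y_3)/N$. In the supercritical case the trajectory slowly follows the positive branch of the pitchfork as $u$ is increased just above its critical value; this slow increase in $\bar y$ is called a contained response. In the subcritical case the trajectory jumps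 up to the positive branch as $u$ is increased just above its critical value; this jump is called a cascade.
   Formalization: The existence of y_1* is asserted only for N > 2n+1; for N = 2n+1, λ_3(y*,N,n) tends to +∞ as y* → ∞, so no y_1* exists beyond a large y_+*. All other conclusions are stated for N = 2n+1 too. *)

(* Defs.v *)
(* Stdlib real numbers with Coquelicot. *)
From Stdlib Require Import Reals Bool Arith.
From Coquelicot Require Import Coquelicot.
Open Scope R_scope.

Coercion INR : nat >-> R.

(** * The network *)

Inductive cluster := High | Low | Neutral.

(* Agents are numbered from 0; the first n form cluster 1, the next n form
   cluster 2, and the remaining N - 2n form cluster 3. *)
Definition cluster_of (n i : nat) : cluster :=
  if (i <? n)%nat then High else if (i <? 2 * n)%nat then Low else Neutral.

Definition threshold (n : nat) (eps : R) (i : nat) : R :=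
  match cluster_of n i with
  | High => 1 / 2 - eps
  | Low => 1 / 2 + eps
  | Neutral => 1 / 2
  end.

Definition clusters_linked (k l : cluster) : bool :=
  match k, l with
  | High, Low | Low, High => false
  | _, _ => true
  end.

Definition adjacency (n i j : nat) : R :=
  if negb (i =? j)%nat && clusters_linked (cluster_of n i) (cluster_of n j)
  then 1 else 0.

Definition degree (N n i : nat) : R :=
  sum_n_m (fun j => adjacency n i j) 0 (N - 1).

Definition network_field (N n : nat) (eps u : R) (x : nat -> R) (i : nat) : R :=
  - degree N n i * x i
  + sum_n_m (fun j => adjacency n i j * (u * tanh (x j))) 0 (N - 1)
  + degree N n i * (1 - 2 * threshold n eps i).

(* [x i t] is the state of agent [i] at time [t]; only agents [i < N] and times
   [t >= 0] matter. *)
Definition network_trajectory (N n : nat) (eps u : R) (x : nat -> R -> R) : Prop :=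
  forall i : nat, (i < N)%nat ->
    filterlim (x i) (at_right 0) (locally (x i 0)) /\
    forall t : R, 0 < t ->
      is_derive (x i) t (network_field N n eps u (fun j => x j t) i).

Definition cluster_average (N n : nat) (x : nat -> R) (k : cluster) : R :=
  match k with
  | High => sum_n_m x 0 (n - 1) / n
  | Low => sum_n_m x n (2 * n - 1) / n
  | Neutral => sum_n_m x (2 * n) (N - 1) / (N - 2 * n)
  end.

(* The mean of the cluster averages weighted by cluster size, usually written
   ybar. *)
Definition mean_state (N n : nat) (x : nat -> R) : R :=
  (n * cluster_average N n x High + n * cluster_average N n x Low
   + (N - 2 * n) * cluster_average N n x Neutral) / N.

(* The network state whose clusters are synchronized at (y, -y, 0). *)
Definition cluster_state (n : nat) (y : R) (i : nat) : R :=
  match cluster_of n i with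
  | High => y
  | Low => - y
  | Neutral => 0
  end.

(** * The reduced three-cluster dynamics *)

Definition reduced_field (N n : nat) (eps u : R) (y : R * R * R) : R * R * R :=
  let '(y1, y2, y3) := y in
  ( - (N - n - 1) * y1 + (n - 1) * u * tanh y1
      + (N - 2 * n) * u * tanh y3 + 2 * (N - n - 1) * eps,
    - (N - n - 1) * y2 + (n - 1) * u * tanh y2
      + (N - 2 * n) * u * tanh y3 - 2 * (N - n - 1) * eps,
    - (N - 1) * y3 + (N - 2 * n - 1) * u * tanh y3
      + n * u * tanh y1 + n * u * tanh y2 ).

Definition equilibrium (N n : nat) (eps u y : R) : Prop :=
  reduced_field N n eps u (y, - y, 0) = (0, 0, 0).

Definition coef_a (N n : nat) (y : R) : R :=
  (n - 1) / (N - 2 * n) * (1 / 6) * Derive_n tanh 3 y.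

Definition coef_b (N n : nat) (y : R) : R :=
  (n - 1) / (N - 2 * n) * (1 / 2) * Derive_n tanh 2 y.

Definition coef_c (N n : nat) (y u : R) : R :=
  (n - 1) / (N - 2 * n) * Derive tanh y - (N - n - 1) / ((N - 2 * n) * u).

(* [lambda1] and [lambda3] are the linear and cubic coefficients of the scalar
   equation for the third coordinate obtained by solving the first two
   equilibrium equations near (y, -y, 0).  If c = 0 then [/ c] is 0 in Rocq and
   [lambda1] is negative for u > 0, so c is nonzero wherever lambda1 = 0. *)
Definition lambda1 (N n : nat) (y u : R) : R :=
  - (N - 1) - (1 + (n + 1) / (n - 1) * (N - 2 * n)) * u
  - n * (N - n - 1) / (n - 1) * (2 / coef_c N n y u).

Definition lambda3 (N n : nat) (y u : R) : R :=
  let a := coef_a N n y in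
  let b := coef_b N n y in
  let c := coef_c N n y u in
  1 / 3 * (1 + (n + 1) / (n - 1) * (N - 2 * n)) * u
  + n * (N - n - 1) / (n - 1) * (2 / (3 * c) - 4 * b ^ 2 / c ^ 5 + 2 * a / c ^ 4).

(** * Bifurcation values as functions of the equilibrium *)

Definition coef_c2 (N n : nat) (y : R) : R :=
  (n + 1 + (n - 1) / (N - 2 * n)) * Derive tanh y.

Definition coef_c1 (N n : nat) (y : R) : R :=
  (N - 2 * n - 1) * (N - n - 1) / (N - 2 * n)
  + (N - 1) * (n - 1) / (N - 2 * n) * Derive tanh y.

Definition coef_c0 (N n : nat) : R :=
  - ((N - n - 1) * (N - 1) / (N - 2 * n)).

Definition u_of (N n : nat) (y : R) : R :=
  let c2 := coef_c2 N n y in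
  let c1 := coef_c1 N n y in
  let c0 := coef_c0 N n in
  (- c1 + sqrt (c1 ^ 2 - 4 * c2 * c0)) / (2 * c2).

Definition eps_of (N n : nat) (y : R) : R :=
  1 / 2 * y - (n - 1) / (2 * (N - n - 1)) * u_of N n y * tanh y.

Definition lambda3_of (N n : nat) (y : R) : R :=
  let a := coef_a N n y in
  let b := coef_b N n y in
  let c := coef_c N n y (u_of N n y) in
  - (1 / 3) * (N - 1)
  + n * (N - n - 1) / (n - 1) * ((2 * a * c - 4 * b ^ 2) / c ^ 5).

(** * Pitchfork bifurcations, transition and cascade *)

(* As u varies near u0 with eps fixed, the equilibrium (y, -y, 0) moves with u
   along [Y]. *)
Definition equilibrium_branch (N n : nat) (eps u0 y0 : R) (Y : R -> R) : Prop :=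
  Y u0 = y0 /\ continuous Y u0 /\
  locally u0 (fun u => equilibrium N n eps u (Y u)).

(* lambda1, followed along the equilibrium branch, crosses zero from negative to
   positive as the bifurcation parameter u increases through u0. *)
Definition pitchfork (N n : nat) (eps u0 y0 : R) : Prop :=
  0 < eps /\ 0 < u0 /\ lambda1 N n y0 u0 = 0 /\
  exists Y : R -> R, equilibrium_branch N n eps u0 y0 Y /\
    at_left u0 (fun u => lambda1 N n (Y u) u < 0) /\
    at_right u0 (fun u => 0 < lambda1 N n (Y u) u).

Definition supercritical_pitchfork (N n : nat) (eps u y : R) : Prop :=
  pitchfork N n eps u y /\ lambda3 N n y u < 0.

Definition subcritical_pitchfork (N n : nat) (eps u y : R) : Prop :=
  pitchfork N n eps u y /\ 0 < lambda3 N n y u.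

(* The pitchfork points (lambda1 = 0) form a curve parametrized by the
   equilibrium y; along it lambda3 crosses zero from negative to positive at y0,
   where the parameters are (eps0, u0). *)
Definition pitchfork_transition (N n : nat) (eps0 u0 y0 : R) : Prop :=
  pitchfork N n eps0 u0 y0 /\ lambda3 N n y0 u0 = 0 /\
  exists E U : R -> R,
    E y0 = eps0 /\ U y0 = u0 /\ continuous E y0 /\ continuous U y0 /\
    at_left y0 (fun y => supercritical_pitchfork N n (E y) (U y) y) /\
    at_right y0 (fun y => subcritical_pitchfork N n (E y) (U y) y).

(* The slow increase of u is read quasi-statically: for each fixed u just above
   the critical value u0, a trajectory of the N-agent network issued from the
   tracked equilibrium, with some agents pushed up (however little) and none
   pushed down, ends up with a mean state at least rho, where rho > 0 does not
   depend on u.  The mean state of the tracked equilibrium is 0. *)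
Definition jumps_up (N n : nat) (eps u0 y0 : R) : Prop :=
  exists (Y : R -> R) (rho : R),
    equilibrium_branch N n eps u0 y0 Y /\ 0 < rho /\
    at_right u0 (fun u =>
      forall x : nat -> R -> R,
        network_trajectory N n eps u x ->
        (forall i : nat, (i < N)%nat -> cluster_state n (Y u) i <= x i 0) ->
        (exists i : nat, (i < N)%nat /\ cluster_state n (Y u) i < x i 0) ->
        Rbar_locally p_infty (fun t => rho <= mean_state N n (fun i => x i t))).

Definition cascade (N n : nat) (eps u : R) : Prop :=
  exists y : R, subcritical_pitchfork N n eps u y /\ jumps_up N n eps u y.

(* Main.v *)
(* With k = n - 1, M = N - 2n, D = N - n - 1 and s = tanh' y, the share
   w = 1 - k u s / D parametrizes the critical curve lambda1 = 0: u, s and hence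
   lambda3 become rational in w, and w increases with y.  So lambda3 has isolated
   zeros, and y0 is the end of the initial interval where lambda3 <= 0.

   Along the equilibrium branch, lambda1 increases through zero exactly when eps_of
   is increasing.  If that failed somewhere on (0, y0], a polynomial inequality in w
   would make lambda3 positive at some smaller state, against the choice of y0;
   hence eps_of > 0 on (0, y0] as well.

   For the cascade, the network is cooperative.  When lambda3 > 0 there is a curve of
   strict subequilibria leaving the equilibrium upwards, of length independent of u
   just above the critical value.  A trajectory that starts above the equilibrium
   is strictly above it at once, and a barrier climbing slowly along the curve
   drags it up to the far end. *)

Require Import Defs.
From Stdlib Require Import Reals Lra Lia Psatz Bool Arith List Classical.
From Coquelicot Require Import Coquelicot.
Open Scope R_scope.

(** * tanh and its Taylor expansion *)

(** Once w = 1 - k u s / D is fixed, the quadratic [crit_poly] = 0 becomes linear in u; this is why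
    the critical curve is rational in w. On it - c = 2 (1 - beta w) / kappa, which is where the
    constants [w_beta] and [w_kappa] come from.

    The obstacle is that failure of the crossing condition at w need not be contradicted by
    [cubic_sign] at w itself: for beta < 1 and w = 1 the latter is - 8 (1 - beta)^3. Positivity is
    then found at the smaller value w = 2/3. The inequalities also require kappa >= 1, which means M
    <= k^2; for M >= k^2 + 1 the crossing condition cannot fail at all, and this is where the
    integrality of k and M matters.

    For M = 1 one has beta = 1, and lambda3 stays positive for all large y; the second zero y1 is
    therefore claimed only for N > 2n + 1. *)

Lemma cosh_pos (x : R) : 0 < cosh x.
Proof. unfold cosh. assert (h := exp_pos x). assert (h' := exp_pos (- x)). lra. Qed.

Lemma is_derive_tanh (x : R) : is_derive tanh x (1 - tanh x ^ 2).
Proof.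
  assert (h := cosh_pos x).
  apply is_derive_ext with (fun x => sinh x / cosh x); [reflexivity|].
  unfold sinh, cosh in *. auto_derive; [lra|].
  unfold tanh, sinh, cosh. field. lra.
Qed.

Lemma Derive_tanh (x : R) : Derive tanh x = 1 - tanh x ^ 2.
Proof. apply is_derive_unique, is_derive_tanh. Qed.

Lemma ex_derive_tanh (x : R) : ex_derive tanh x.
Proof. exists (1 - tanh x ^ 2). apply is_derive_tanh. Qed.

Lemma continuous_tanh (x : R) : continuous tanh x.
Proof. apply (ex_derive_continuous tanh), ex_derive_tanh. Qed.

Lemma is_derive_tanh_comp (p : R -> R) (x : R) (p' : R -> R) :
  (forall t, is_derive p t (p' t)) ->
  is_derive (fun y => p (tanh y)) x ((1 - tanh x ^ 2) * p' (tanh x)).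
Proof. intros H. apply (is_derive_comp p tanh); [apply H | apply is_derive_tanh]. Qed.

Lemma Derive_n_tanh_2 (x : R) : Derive_n tanh 2 x = - 2 * tanh x * (1 - tanh x ^ 2).
Proof.
  change (Derive (Derive tanh) x = - 2 * tanh x * (1 - tanh x ^ 2)).
  rewrite (Derive_ext _ (fun y => 1 - tanh y ^ 2) x Derive_tanh).
  apply is_derive_unique.
  replace (- 2 * tanh x * (1 - tanh x ^ 2)) with ((1 - tanh x ^ 2) * (- 2 * tanh x)) by ring.
  apply (is_derive_tanh_comp (fun t => 1 - t ^ 2) x (fun t => - 2 * t)).
  intros t. auto_derive; [exact I | ring].
Qed.

Lemma Derive_n_tanh_3 (x : R) : Derive_n tanh 3 x = (1 - tanh x ^ 2) * (6 * tanh x ^ 2 - 2).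
Proof.
  change (Derive (Derive_n tanh 2) x = (1 - tanh x ^ 2) * (6 * tanh x ^ 2 - 2)).
  rewrite (Derive_ext _ (fun y => - 2 * tanh y * (1 - tanh y ^ 2)) x Derive_n_tanh_2).
  apply is_derive_unique.
  apply (is_derive_tanh_comp (fun t => - 2 * t * (1 - t ^ 2)) x (fun t => 6 * t ^ 2 - 2)).
  intros t. auto_derive; [exact I | ring].
Qed.

Lemma Derive_n_tanh_4 (x : R) : Derive_n tanh 4 x = (1 - tanh x ^ 2) * (16 * tanh x - 24 * tanh x ^ 3).
Proof.
  change (Derive (Derive_n tanh 3) x = (1 - tanh x ^ 2) * (16 * tanh x - 24 * tanh x ^ 3)).
  rewrite (Derive_ext _ (fun y => (1 - tanh y ^ 2) * (6 * tanh y ^ 2 - 2)) x Derive_n_tanh_3).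
  apply is_derive_unique.
  apply (is_derive_tanh_comp (fun t => (1 - t ^ 2) * (6 * t ^ 2 - 2)) x (fun t => 16 * t - 24 * t ^ 3)).
  intros t. auto_derive; [exact I | ring].
Qed.

Lemma ex_derive_n_tanh (x : R) (j : nat) : (j <= 4)%nat -> ex_derive_n tanh j x.
Proof.
  intros Hj. destruct j as [|[|[|[|[|j]]]]]; [exact I | | | | | lia]; simpl.
  - apply ex_derive_tanh.
  - apply ex_derive_ext with (fun y => 1 - tanh y ^ 2); [intros; symmetry; apply Derive_tanh|].
    eexists. apply (is_derive_tanh_comp (fun t => 1 - t ^ 2) x (fun t => - 2 * t)).
    intros t. auto_derive; [exact I | ring].
  - apply ex_derive_ext with (fun y => - 2 * tanh y * (1 - tanh y ^ 2));
      [intros; symmetry; apply Derive_n_tanh_2|].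
    eexists. apply (is_derive_tanh_comp (fun t => - 2 * t * (1 - t ^ 2)) x (fun t => 6 * t ^ 2 - 2)).
    intros t. auto_derive; [exact I | ring].
  - apply ex_derive_ext with (fun y => (1 - tanh y ^ 2) * (6 * tanh y ^ 2 - 2));
      [intros; symmetry; apply Derive_n_tanh_3|].
    eexists. apply (is_derive_tanh_comp (fun t => (1 - t ^ 2) * (6 * t ^ 2 - 2)) x (fun t => 16 * t - 24 * t ^ 3)).
    intros t. auto_derive; [exact I | ring].
Qed.

Lemma sech2_pos (x : R) : 0 < 1 - tanh x ^ 2.
Proof.
  assert (h := cosh_pos x).
  replace (1 - tanh x ^ 2) with (1 / cosh x ^ 2).
  - apply Rdiv_lt_0_compat; [lra | apply pow_lt; assumption].
  - assert (h1 := cosh_pos x). unfold tanh, sinh, cosh in *.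
    assert (E : exp x * exp (- x) = 1) by (rewrite <- exp_plus, Rplus_opp_r; apply exp_0).
    field_simplify; [| lra | lra]. f_equal. nra.
Qed.

Lemma tanh_lt_1 (x : R) : -1 < tanh x < 1.
Proof. assert (h := sech2_pos x). split; nra. Qed.

Lemma tanh_0 : tanh 0 = 0.
Proof. unfold tanh. rewrite sinh_0. unfold Rdiv. ring. Qed.

Lemma tanh_opp (x : R) : tanh (- x) = - tanh x.
Proof.
  assert (h := cosh_pos x). unfold tanh, sinh, cosh in *. rewrite Ropp_involutive. field. lra.
Qed.

Lemma tanh_incr (x y : R) : x < y -> tanh x < tanh y.
Proof.
  intros H. apply (incr_function tanh m_infty p_infty (fun x => 1 - tanh x ^ 2)); try exact I; try assumption.
  - intros; apply is_derive_tanh.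
  - intros; apply sech2_pos.
Qed.

Lemma tanh_le (x y : R) : x <= y -> tanh x <= tanh y.
Proof. intros [H| ->]; [left; apply tanh_incr|right]; auto. Qed.

Lemma tanh_pos (x : R) : 0 < x -> 0 < tanh x.
Proof. intros H. rewrite <- tanh_0. apply tanh_incr, H. Qed.

Lemma tanh_lipschitz (x y : R) : x <= y -> tanh y - tanh x <= y - x.
Proof.
  intros [H| ->]; [|lra].
  destruct (MVT_gen tanh x y (fun x => 1 - tanh x ^ 2)) as [c [_ E]].
  - intros; apply is_derive_tanh.
  - intros; apply continuity_pt_filterlim, continuous_tanh.
  - rewrite E. assert (h := pow2_ge_0 (tanh c)). nra.
Qed.

Lemma sech2_decr (x y : R) : 0 <= x < y -> 1 - tanh y ^ 2 < 1 - tanh x ^ 2.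
Proof.
  intros H. assert (tanh x < tanh y) by (apply tanh_incr; lra).
  assert (0 <= tanh x) by (rewrite <- tanh_0; apply tanh_le; lra). nra.
Qed.

Lemma tanh_surj (t : R) : 0 <= t < 1 -> exists y, 0 <= y /\ tanh y = t.
Proof.
  intros H. exists (ln ((1 + t) / (1 - t)) / 2).
  assert (Hq : 1 <= (1 + t) / (1 - t)) by (apply -> Rle_div_r; lra).
  set (q := (1 + t) / (1 - t)) in *. split.
  - assert (0 <= ln q) by (rewrite <- ln_1; apply ln_le; lra). lra.
  - set (y := ln q / 2).
    assert (E : exp y * exp y = q).
    { rewrite <- exp_plus. replace (y + y) with (ln q) by (unfold y; field). apply exp_ln; lra. }
    assert (h := exp_pos y).
    unfold tanh, sinh, cosh. rewrite exp_Ropp.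
    replace ((exp y - / exp y) / 2 / ((exp y + / exp y) / 2)) with
      ((exp y * exp y - 1) / (exp y * exp y + 1)) by (field; split; nra).
    rewrite E. unfold q. field. lra.
Qed.

(** The fourth derivative (1 - t^2)(16 t - 24 t^3) is at most 40 in absolute value for |t| < 1, and
    40 / 4! <= 2. [Taylor_Lagrange] expands to the right of [a]; negative h follows by oddness in
    [tanh_taylor]. *)
Lemma tanh_taylor_nonneg (a h : R) : 0 <= h ->
  Rabs (tanh (a + h) - tanh a - ((1 - tanh a ^ 2) * h + Derive_n tanh 2 a * h ^ 2 / 2
    + Derive_n tanh 3 a * h ^ 3 / 6)) <= 2 * h ^ 4.
Proof.
  intros [H| <-].
  2: { rewrite Rplus_0_r. replace (_ - _) with 0 by field. rewrite Rabs_R0. simpl; lra. }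
  destruct (Taylor_Lagrange tanh 3 a (a + h)) as [z [_ E]]; [lra | |].
  { intros t _ j Hj. apply ex_derive_n_tanh. lia. }
  replace (a + h - a) with h in E by ring.
  rewrite E. rewrite Derive_n_tanh_4.
  change (sum_f_R0 _ 3) with
    (h ^ 0 / INR (Factorial.fact 0) * Derive_n tanh 0 a
     + h ^ 1 / INR (Factorial.fact 1) * Derive_n tanh 1 a
     + h ^ 2 / INR (Factorial.fact 2) * Derive_n tanh 2 a
     + h ^ 3 / INR (Factorial.fact 3) * Derive_n tanh 3 a).
  change (Derive_n tanh 0 a) with (tanh a). change (Derive_n tanh 1 a) with (Derive tanh a).
  rewrite Derive_tanh.
  replace (INR (Factorial.fact 0)) with 1 by reflexivity.
  replace (INR (Factorial.fact 1)) with 1 by reflexivity.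
  replace (INR (Factorial.fact 2)) with 2 by (simpl; lra).
  replace (INR (Factorial.fact 3)) with 6 by (simpl; lra).
  replace (INR (Factorial.fact 4)) with 24 by (simpl; lra).
  replace (_ - _) with (h ^ 4 / 24 * ((1 - tanh z ^ 2) * (16 * tanh z - 24 * tanh z ^ 3))) by field.
  assert (Hz := tanh_lt_1 z). set (t := tanh z) in *.
  assert (Hh : 0 < h ^ 4) by (apply pow_lt; assumption).
  assert (-1 < t ^ 3 < 1) by (split; nra).
  assert (0 < 1 - t ^ 2 <= 1) by (split; nra).
  assert (Rabs ((1 - t ^ 2) * (16 * t - 24 * t ^ 3)) <= 1 * 40).
  { rewrite Rabs_mult. apply Rmult_le_compat; try apply Rabs_pos; apply Rabs_le; lra. }
  rewrite Rabs_mult, (Rabs_pos_eq (h ^ 4 / 24)) by lra. nra.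
Qed.

Lemma tanh_taylor (a h : R) :
  Rabs (tanh (a + h) - tanh a - ((1 - tanh a ^ 2) * h + Derive_n tanh 2 a * h ^ 2 / 2
    + Derive_n tanh 3 a * h ^ 3 / 6)) <= 2 * h ^ 4.
Proof.
  destruct (Rle_lt_dec 0 h) as [H|H]; [apply tanh_taylor_nonneg, H|].
  assert (T := tanh_taylor_nonneg (- a) (- h) ltac:(lra)).
  rewrite Derive_n_tanh_2, Derive_n_tanh_3 in *.
  replace (- a + - h) with (- (a + h)) in T by ring.
  rewrite !tanh_opp in T.
  replace (2 * (- h) ^ 4) with (2 * h ^ 4) in T by ring.
  rewrite <- Rabs_Ropp in T. etransitivity; [|exact T].
  right. f_equal. field.
Qed.

(** * Isolated zeros of polynomials and local inverses *)

Fixpoint poly_eval (p : list R) (x : R) : R :=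
  match p with
  | nil => 0
  | c :: q => c + x * poly_eval q x
  end.

Definition polynomial (f : R -> R) : Prop := exists p, forall x, f x = poly_eval p x.

Lemma polynomial_const (c : R) : polynomial (fun _ => c).
Proof. exists (c :: nil). intros x; simpl; ring. Qed.

Lemma polynomial_id : polynomial (fun x => x).
Proof. exists (0 :: 1 :: nil). intros x; simpl; ring. Qed.

Lemma polynomial_plus (f g : R -> R) :
  polynomial f -> polynomial g -> polynomial (fun x => f x + g x).
Proof.
  intros [p Hp] [q Hq].
  assert (H : forall p q, exists r, forall x, poly_eval p x + poly_eval q x = poly_eval r x).
  { clear. induction p as [|c p IH]; intros q.
    - exists q. intros x. simpl. ring.
    - destruct q as [|d q]; [exists (c :: p); intros x; simpl; ring|].
      destruct (IH q) as [r Hr]. exists ((c + d) :: r). intros x. simpl. rewrite <- Hr. ring. }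
  destruct (H p q) as [r Hr]. exists r. intros x. rewrite Hp, Hq. apply Hr.
Qed.

Lemma polynomial_mult (f g : R -> R) :
  polynomial f -> polynomial g -> polynomial (fun x => f x * g x).
Proof.
  intros [p Hp] Hg. revert f Hp. induction p as [|c p IH]; intros f Hp.
  - exists nil. intros x. rewrite Hp. simpl. ring.
  - destruct (IH (poly_eval p) (fun x => eq_refl)) as [r Hr].
    destruct Hg as [q Hq].
    destruct (polynomial_plus (fun x => c * g x) (fun x => poly_eval (0 :: r) x)) as [t Ht].
    + exists (map (Rmult c) q). intros x. rewrite Hq. clear. induction q as [|d q IHq]; simpl; [ring|].
      rewrite <- IHq. ring.
    + exists (0 :: r). reflexivity.
    + exists t. intros x. rewrite <- Ht, Hp. simpl. rewrite <- Hr. ring.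
Qed.

Lemma polynomial_pow (f : R -> R) (m : nat) : polynomial f -> polynomial (fun x => f x ^ m).
Proof.
  intros H. induction m as [|m IH]; simpl; [apply polynomial_const | apply polynomial_mult; assumption].
Qed.

Lemma polynomial_comp_shift (f : R -> R) (a : R) : polynomial f -> polynomial (fun h => f (a + h)).
Proof.
  intros [p Hp]. revert f Hp. induction p as [|c p IH]; intros f Hp.
  - exists nil. intros x. rewrite Hp. reflexivity.
  - destruct (polynomial_plus (fun _ => c) (fun h => (a + h) * poly_eval p (a + h))) as [r Hr].
    + apply polynomial_const.
    + apply polynomial_mult; [apply polynomial_plus; [apply polynomial_const | apply polynomial_id]|].
      apply (IH (poly_eval p)); reflexivity.
    + exists r. intros x. rewrite <- Hr, Hp. reflexivity.
Qed.

Lemma continuous_poly_eval (p : list R) (x : R) : continuous (poly_eval p) x.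
Proof.
  induction p as [|c p IH]; [apply continuous_const|].
  apply (continuous_plus (fun _ => c) (fun x => x * poly_eval p x)); [apply continuous_const|].
  apply (continuous_mult (fun x => x) (poly_eval p)); [apply continuous_id | exact IH].
Qed.

Lemma poly_eval_lowest_term (p : list R) :
  (forall h, poly_eval p h = 0) \/
  exists m c q, c <> 0 /\ forall h, poly_eval p h = h ^ m * poly_eval (c :: q) h.
Proof.
  induction p as [|c p IH]; [left; reflexivity|].
  destruct (Req_dec c 0) as [-> | Hc].
  - destruct IH as [IH | (m & d & q & Hd & IH)].
    + left. intros h. simpl. rewrite IH. ring.
    + right. exists (S m), d, q. split; [assumption|]. intros h.
      change (0 + h * poly_eval p h = h ^ S m * poly_eval (d :: q) h). rewrite IH. simpl. ring.
  - right. exists 0%nat, c, p. split; [assumption|]. intros h. simpl. ring.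
Qed.

(** After shifting to [a], a nonzero polynomial is h^m q(h) with q(0) <> 0, so near [a] its sign is
    that of q(0) on the right and of (-1)^m q(0) on the left. *)
Lemma polynomial_one_sided_sign (f : R -> R) (a z : R) : polynomial f -> f z <> 0 ->
  (at_right a (fun x => 0 < f x) \/ at_right a (fun x => f x < 0)) /\
  (at_left a (fun x => 0 < f x) \/ at_left a (fun x => f x < 0)).
Proof.
  intros Hf Hz. destruct (polynomial_comp_shift f a Hf) as [p Hp].
  destruct (poly_eval_lowest_term p) as [H0 | (m & c & q & Hc & H)].
  { exfalso. apply Hz. replace z with (a + (z - a)) by ring. rewrite Hp. apply H0. }
  assert (Hs : locally 0 (fun h => 0 < c * poly_eval (c :: q) h)).
  { assert (C := continuous_mult (fun _ => c) _ 0 (continuous_const c 0) (continuous_poly_eval (c :: q) 0)).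
    apply (C (fun y => 0 < y)). apply open_gt. simpl. unfold mult; simpl. nra. }
  destruct Hs as [d Hd].
  assert (Hd' : forall h, Rabs h < d -> 0 < c * poly_eval (c :: q) h).
  { intros h Hh. apply Hd. unfold ball; simpl. unfold AbsRing_ball, abs, minus, plus, opp; simpl.
    replace (h + - 0) with h by ring. exact Hh. }
  assert (Ef : forall x, f x = (x - a) ^ m * poly_eval (c :: q) (x - a)).
  { intros x. rewrite <- H, <- Hp. f_equal. ring. }
  assert (Hball : forall x, ball a d x -> Rabs (x - a) < d) by (intros x Hx; exact Hx).
  assert (Hcase : 0 < c \/ c < 0) by lra.
  assert (Hodd : (forall x, x < 0 -> 0 < x ^ m) \/ (forall x, x < 0 -> x ^ m < 0)).
  { clear. induction m as [|m [IH|IH]].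
    - left. intros; simpl; lra.
    - right. intros x Hx. specialize (IH x Hx). simpl. nra.
    - left. intros x Hx. specialize (IH x Hx). simpl. nra. }
  split.
  - destruct Hcase; [left|right]; exists d; intros x Hx Hax; rewrite Ef;
      specialize (Hd' _ (Hball x Hx));
      assert (Hpw : 0 < (x - a) ^ m) by (apply pow_lt; lra); nra.
  - assert (HL : forall x, ball a d x -> x < a ->
      0 < c * poly_eval (c :: q) (x - a) /\ x - a < 0) by (intros x Hx Hxa; split; [apply Hd', Hx | lra]).
    assert (Hsgn : (forall x, ball a d x -> x < a -> 0 < f x) \/ (forall x, ball a d x -> x < a -> f x < 0)).
    { destruct Hodd as [Ho|Ho], Hcase as [Hc'|Hc'];
        [left | right | right | left]; intros x Hx Hxa; rewrite Ef;
        destruct (HL x Hx Hxa) as [h1 h2]; specialize (Ho _ h2); nra. }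
    destruct Hsgn; [left|right]; exists d; assumption.
Qed.

(** V is differentiable at y but only continuous nearby, so it need not be injective: g picks some
    solution of V x = u by the intermediate value theorem. The secant slopes through y are at least
    v / 2, which puts g u on the correct side of y and makes it tend to y. *)
Lemma local_inverse (V : R -> R) (y v : R) : 0 < v -> is_derive V y v ->
  locally y (fun x => continuous V x) ->
  exists g : R -> R, g (V y) = y /\ continuous g (V y) /\
    locally (V y) (fun u => V (g u) = u) /\
    filterlim g (at_right (V y)) (at_right y) /\
    filterlim g (at_left (V y)) (at_left y).
Proof.
  intros Hv HV HC.
  apply is_derive_Reals in HV.
  destruct (HV (v / 2) ltac:(lra)) as [d1 Hd1].
  destruct HC as [d2 Hd2].
  set (eta := Rmin (d1 / 2) (d2 / 2)).
  assert (Heta : 0 < eta) by (unfold eta; apply Rmin_pos; [destruct d1 | destruct d2]; simpl; lra).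
  assert (He1 : eta < d1) by (unfold eta; destruct d1 as [d1 p1]; simpl in *; assert (h := Rmin_l (d1/2) (d2/2)); lra).
  assert (He2 : eta < d2) by (unfold eta; destruct d2 as [d2 p2]; simpl in *; assert (h := Rmin_r (d1/2) (d2/2)); lra).
  assert (Hup : forall x, y < x <= y + eta -> v / 2 * (x - y) <= V x - V y).
  { intros x Hx. specialize (Hd1 (x - y) ltac:(apply Rgt_not_eq; lra)).
    replace (y + (x - y)) with x in Hd1 by ring.
    rewrite (Rabs_pos_eq (x - y)) in Hd1 by lra.
    specialize (Hd1 ltac:(lra)). apply Rabs_def2 in Hd1. destruct Hd1 as [_ Hd1].
    apply Rmult_le_reg_r with (/ (x - y)); [apply Rinv_0_lt_compat; lra|].
    replace (v / 2 * (x - y) * / (x - y)) with (v / 2) by (field; lra).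
    unfold Rdiv in *. lra. }
  assert (Hdn : forall x, y - eta <= x < y -> V x - V y <= v / 2 * (x - y)).
  { intros x Hx. specialize (Hd1 (x - y) ltac:(apply Rlt_not_eq; lra)).
    replace (y + (x - y)) with x in Hd1 by ring.
    rewrite (Rabs_left (x - y)) in Hd1 by lra.
    specialize (Hd1 ltac:(lra)). apply Rabs_def2 in Hd1. destruct Hd1 as [_ Hd1].
    apply Rmult_le_reg_r with (/ (y - x)); [apply Rinv_0_lt_compat; lra|].
    replace (v / 2 * (x - y) * / (y - x)) with (- (v / 2)) by (field; lra).
    replace ((V x - V y) * / (y - x)) with (- ((V x - V y) / (x - y))) by (field; lra).
    lra. }
  assert (Hcont : forall x, y - eta <= x <= y + eta -> continuity_pt V x).
  { intros x Hx. apply continuity_pt_filterlim, Hd2.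
    change (Rabs (x - y) < d2). apply Rabs_def1; lra. }
  set (r := v / 2 * eta).
  assert (Hr : 0 < r) by (unfold r; apply Rmult_lt_0_compat; lra).
  assert (Hx : forall u, {x | Rabs (u - V y) < r -> V x = u /\ y - eta <= x <= y + eta}).
  { intros u. destruct (Rlt_dec (Rabs (u - V y)) r) as [Hu|Hu]; [|exists 0; tauto].
    apply Rabs_def2 in Hu.
    assert (h1 := Hup (y + eta) ltac:(lra)). assert (h2 := Hdn (y - eta) ltac:(lra)).
    destruct (Ranalysis5.IVT_interv (fun x => V x - u) (y - eta) (y + eta)) as [x [Hx1 Hx2]].
    - intros a Ha. apply (continuity_pt_minus V (fun _ => u)); [apply Hcont, Ha|].
      apply continuity_pt_const. intros s t; reflexivity.
    - lra.
    - unfold r in Hu. lra.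
    - unfold r in Hu. lra.
    - exists x. intros _. split; [lra | assumption]. }
  set (g := fun u => proj1_sig (Hx u)).
  assert (Hg : forall u, Rabs (u - V y) < r -> V (g u) = u /\ y - eta <= g u <= y + eta)
    by (intros u; exact (proj2_sig (Hx u))).
  assert (Hgr : forall u, V y < u < V y + r -> y < g u /\ v / 2 * (g u - y) <= u - V y).
  { intros u Hu. destruct (Hg u) as [h1 h2]; [apply Rabs_def1; lra|].
    destruct (Rtotal_order (g u) y) as [h|[h|h]].
    - assert (h3 := Hdn (g u) ltac:(lra)). nra.
    - rewrite h in h1. lra.
    - assert (h3 := Hup (g u) ltac:(lra)). lra. }
  assert (Hgl : forall u, V y - r < u < V y -> g u < y /\ v / 2 * (y - g u) <= V y - u).
  { intros u Hu. destruct (Hg u) as [h1 h2]; [apply Rabs_def1; lra|].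
    destruct (Rtotal_order (g u) y) as [h|[h|h]].
    - assert (h3 := Hdn (g u) ltac:(lra)). lra.
    - rewrite h in h1. lra.
    - assert (h3 := Hup (g u) ltac:(lra)). nra. }
  assert (Hg0 : g (V y) = y).
  { destruct (Hg (V y)) as [h1 h2]; [replace (V y - V y) with 0 by ring; rewrite Rabs_R0; lra|].
    destruct (Rtotal_order (g (V y)) y) as [h|[h|h]]; [|assumption|].
    - assert (h3 := Hdn (g (V y)) ltac:(lra)). nra.
    - assert (h3 := Hup (g (V y)) ltac:(lra)). nra. }
  assert (Hlim : forall eps : posreal, exists d : posreal, d <= r /\ d * 2 / v <= eps).
  { intros eps. assert (h : 0 < Rmin r (eps * v / 2)).
    { apply Rmin_pos; [assumption|]. assert (h := cond_pos eps). nra. }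
    exists (mkposreal _ h). simpl. split; [apply Rmin_l|].
    apply Rle_div_l; [lra|]. assert (h' := Rmin_r r (eps * v / 2)). lra. }
  assert (HR : filterlim g (at_right (V y)) (at_right y)).
  { intros P [eps HP]. destruct (Hlim eps) as [d [Hd Hd']]. exists d. intros u Hu Hlt.
    change (Rabs (u - V y) < d) in Hu. apply Rabs_def2 in Hu.
    destruct (Hgr u) as [h1 h2]; [lra|]. apply HP; [|assumption].
    change (Rabs (g u - y) < eps). rewrite Rabs_pos_eq by lra.
    apply Rle_div_l in Hd'; [|lra]. nra. }
  assert (HL : filterlim g (at_left (V y)) (at_left y)).
  { intros P [eps HP]. destruct (Hlim eps) as [d [Hd Hd']]. exists d. intros u Hu Hlt.
    change (Rabs (u - V y) < d) in Hu. apply Rabs_def2 in Hu.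
    destruct (Hgl u) as [h1 h2]; [lra|]. apply HP; [|assumption].
    change (Rabs (g u - y) < eps). rewrite Rabs_left by lra.
    apply Rle_div_l in Hd'; [|lra]. nra. }
  exists g. repeat split; try assumption.
  - intros P HP. rewrite Hg0 in HP.
    assert (h1 : at_right (V y) (fun u => P (g u))) by (apply HR; apply filter_le_within; exact HP).
    assert (h2 : at_left (V y) (fun u => P (g u))) by (apply HL; apply filter_le_within; exact HP).
    change (locally (V y) (fun u => P (g u))).
    refine (filter_imp _ _ _ (filter_and (F := locally (V y)) _ _ h1 h2)).
    intros u [H1 H2].
    destruct (Rtotal_order u (V y)) as [h|[h|h]]; [apply H2, h | | apply H1, h].
    rewrite h, Hg0. exact (locally_singleton _ _ HP).
  - exists (mkposreal r Hr). intros u Hu. apply Hg, Hu.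
Qed.

(** * Polynomial inequalities on the critical curve *)

(** The end beta = 1/2 of the interpolation in [bracket_poly]. At w = 1 the expression equals - 1/2,
    so the range of w has to stop short of 1. *)
Lemma bracket_poly_half (w : R) : 0 <= w <= 18/25 ->
  0 < (1 - w) * (8 - 10 * w^2 + 4 * w^3)
      - 8 * w * (1 - w/2)^3 * (w * (1 - w^2/2) + 2 * (1 - w)^2).
Proof.
  intros H.
  set (Q := w * (1 - w^2/2) + 2 * (1 - w)^2).
  assert (0 < Q) by (unfold Q; nra).
  (* 27/16 is the maximum of the left side, attained at w = 1/2; hence the square in the
     factorization. *)
  assert (8 * w * (1 - w/2)^3 <= 27/16).
  { assert (0 <= (w - 1/2)^2 * (w^2 - 5 * w + 27/4)) by (apply Rmult_le_pos; [apply pow2_ge_0 | nra]).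
    replace (8 * w * (1 - w / 2) ^ 3) with (27/16 - (w - 1/2)^2 * (w^2 - 5 * w + 27/4)) by field. lra. }
  apply Rlt_le_trans with ((1 - w) * (8 - 10 * w^2 + 4 * w^3) - 27/16 * Q); [|nra].
  (* The margin is thin at the endpoint 18/25, so the polynomial is expanded there. *)
  unfold Q. pose (t := 18/25 - w). assert (0 <= t <= 18/25) by (unfold t; lra).
  replace w with (18/25 - t) by (unfold t; ring). clearbody t. clear - H2.
  assert (0 <= t * t <= 1) by nra. assert (0 <= t * (1 - t * t)) by nra.
  assert (0 <= t * t * (1 - t * t)) by nra. nra.
Qed.

(** The end beta = 1: a factor (1 - w)^2 splits off, so positivity persists up to w = 1. *)
Lemma bracket_poly_one (w : R) : 0 < w < 1 ->
  0 < (1 - w) * (8 - 16 * w^2 + 8 * w^3)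
      - 8 * w * (1 - w)^3 * (w * (1 - w^2) + 2 * (1 - w)^2).
Proof.
  intros H.
  replace (_ - _) with (8 * (1-w)^2 * ((1 + w*(1 - w)) - w * (1-w)^2 * (w * (1+w) + 2 * (1-w)))) by ring.
  apply Rmult_lt_0_compat; [nra|].
  assert (0 < w * (1-w) <= 1/4).
  { assert (h := pow2_ge_0 (w - 1/2)). split; [apply Rmult_lt_0_compat|]; lra. }
  assert (w*(1+w)+2*(1-w) <= 2) by nra.
  assert (0<w*(1-w)^2 <= 1/4).
  { replace (w*(1-w)^2) with ((w*(1-w))*(1-w)) by ring. split; nra. }
  assert (w * (1-w)^2 * (w * (1+w) + 2 * (1-w)) <= 1/4*2) by (apply Rmult_le_compat; nra).
  lra.
Qed.

(** Here b is beta, d is 1 - w with w > 18/25, and 1 - 2b/3 is 1 - beta w' at w' = 2/3. The last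
    product is the factor of sigma in the failed crossing condition at w; multiplying by it reduces
    positivity at w' = 2/3 to this inequality. *)
Lemma two_thirds_poly (b d : R) : 1/2 <= b <= 5/6 -> 0 < d <= 7/25 ->
  24 * d * (1 - 2*b/3) < (20 - 32 * (1 - 2*b/3)^3) * ((1 - b*(1-d)) * (1 - b * (1-d)^2)).
Proof.
  intros Hb Hd.
  set (x := 1 - 2*b/3).
  assert (Hx : b = 3/2*(1-x)) by (unfold x; lra).
  set (c := 20 - 32 * x^3).
  assert (4/9 <= x <= 2/3) by (unfold x; lra).
  assert (x^3 <= 8/27) by (assert (x*x <= 4/9) by nra; nra).
  assert (Hc : 0 < c) by (unfold c; lra).
  assert (E : 1 - b*(1-d) = (1-b)+b*d) by ring.
  (* The left out factor is 2 - d >= 2 - 7/25 = 43/25; both factors of the product become affine in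
     d. *)
  assert (E2 : (1-b) + 43/25*b*d <= 1 - b*(1-d)^2).
  { assert (h : 0 <= b * d * (7/25 - d)) by (apply Rmult_le_pos; [apply Rmult_le_pos|]; lra). lra. }
  rewrite E.
  assert (H3: ((1-b)+b*d) * ((1-b) + 43/25*b*d) <= ((1 - b) + b * d) * (1 - b * (1 - d) ^ 2))
    by (apply Rmult_le_compat_l; nra).
  apply Rlt_le_trans with (c * (((1-b)+b*d) * ((1-b) + 43/25*b*d))).
  2: { apply Rmult_le_compat_l; lra. }
  clear E E2 H3.
  (* complete the square, 1311/1000 being close to sqrt (43/25) *)
  replace (((1-b)+b*d) * ((1-b) + 43/25*b*d)) with
    (((1-b) - 1311/1000*b*d)^2 + (68/25+2622/1000) * ((1-b)*b*d) + (43/25-1311*1311/1000000)*(b*d)^2) by field.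
  assert (0 <= (43/25-1311*1311/1000000)*(b*d)^2) by (apply Rmult_le_pos; [lra | apply pow2_ge_0]).
  set (e := _ * (b*d)^2) in *.
  (* For b >= 11/20 the cross term alone exceeds 24 x d. Near b = 1/2 it does not, but there the
     square is bounded below by (24/100)^2. *)
  destruct (Rle_lt_dec (11/20) b).
  - assert (24*x < c * (5342/1000*((1-b)*b))).
    { subst c. rewrite Hx. assert (4/9<=x<=19/30) by lra. clear - H2.
      set (t := x - 4/9). assert (Ht : 0 <= t <= 17/90) by (unfold t; lra).
      replace x with (4/9 + t) by (unfold t; ring). clearbody t. clear x H2.
      assert (h1 : 171/10 - 285/10 * t <= 20 - 32 * (4/9+t)^3) by nra.
      assert (h2 : 185/1000 + 3/4 * t <= (1 - (4/9+t)) * (3 * (4/9+t) - 1)) by nra.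
      apply Rlt_le_trans with ((171/10 - 285/10 * t) * (5342/1000 * 3/4 * (185/1000 + 3/4 * t))); [nra|].
      apply Rmult_le_compat; lra. }
    assert (24*x*d < c * (5342/1000*((1-b)*b))*d) by (apply Rmult_lt_compat_r; lra).
    assert (0 <= c * (((1-b) - 1311/1000*b*d)^2 + e)).
    { apply Rmult_le_pos; [lra|]. assert (h:= pow2_ge_0 ((1-b) - 1311/1000*b*d)). lra. }
    nra.
  - assert (Hc1 : 104/10 < c).
    { unfold c. assert (x*x <= 4/9) by nra. nra. }
    assert (Hq : 24/100 <= (1-b) - 1311/1000*b*d) by nra.
    assert (Hb2 : 247/1000 <= (1-b)*b) by nra.
    assert (Hx2 : x <= 2/3) by lra.
    assert (576/10000 <= ((1-b) - 1311/1000*b*d)^2) by nra.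
    assert (247/1000*d <= (1-b)*b*d) by (apply Rmult_le_compat_r; lra).
    assert (104/10*(576/10000+(5342/1000)*(247/1000*d))
      <= c * (((1 - b) - 1311 / 1000 * b * d) ^ 2
              + (68 / 25 + 2622 / 1000) * ((1 - b) * b * d) + e)).
    { apply Rmult_le_compat; nra. }
    nra.
Qed.

(* Has the sign of lambda3 at the critical point with share [w] and [tanh' y = s];
   see [lambda3_of_sign]. *)
Definition cubic_sign (kappa beta w s : R) : R :=
  kappa^2 * (1 - w) * (12 * (1 - s) - w * (8 - 6 * s)) - 8 * w^2 * (1 - beta * w)^3.

Lemma bracket_poly (beta w : R) : 1/2 <= beta <= 1 -> 0 < w < 1 ->
  beta = 1 \/ w <= 18/25 ->
  0 < (1 - w) * (8 - 4 * w^2 * (1 + 3 * beta) + 8 * beta * w^3)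
      - 8 * w * (1 - beta * w)^3 * (w * (1 - beta * w^2) + 2 * (1 - w)^2).
Proof.
  intros Hb Hw H.
  assert (P1 := bracket_poly_one w Hw).
  destruct H as [->|H].
  { replace (8 - 4 * w^2 * (1 + 3 * 1) + 8 * 1 * w^3) with (8 - 16 * w^2 + 8 * w^3) by ring.
    rewrite !Rmult_1_l. exact P1. }
  assert (P2 := bracket_poly_half w (conj (Rlt_le _ _ (proj1 Hw)) H)).
  (* The expression is concave in [beta]: it exceeds the chord between 1/2 and 1 by
     a multiple of the second divided difference [psi] of the subtracted product. *)
  set (X := 1 - w/2). set (Y := 1 - beta * w). set (Z := 1 - w).
  set (psi := w^4 * (X^2 + X*Y + Y^2) + w^2 * (X + Y + Z) * (w * (1 - w^2) + 2 * (1 - w)^2)).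
  assert (0 < X) by (unfold X; lra).
  assert (0 < Y) by (unfold Y; nra).
  assert (0 < Z) by (unfold Z; lra).
  assert (0 <= psi).
  { unfold psi. apply Rplus_le_le_0_compat; apply Rmult_le_pos; nra. }
  assert (E : (1 - w) * (8 - 4 * w^2 * (1 + 3 * beta) + 8 * beta * w^3)
      - 8 * w * (1 - beta * w)^3 * (w * (1 - beta * w^2) + 2 * (1 - w)^2)
    = 2 * (1 - beta) * ((1 - w) * (8 - 10 * w^2 + 4 * w^3)
      - 8 * w * (1 - w/2)^3 * (w * (1 - w^2/2) + 2 * (1 - w)^2))
    + (2 * beta - 1) * ((1 - w) * (8 - 16 * w^2 + 8 * w^3)
      - 8 * w * (1 - w)^3 * (w * (1 - w^2) + 2 * (1 - w)^2))
    + (beta - 1/2) * (1 - beta) * (8 * w * psi)) by (unfold psi, X, Y, Z; field).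
  apply Rlt_le_trans with (2 := Req_le _ _ (eq_sym E)). clear E.
  fold X Z in P1, P2 |- *.
  set (A := _ - _) in P1 |- *. set (B := _ - _) in P2 |- *.
  change (0 < B) in P2. change (0 < A) in P1.
  assert (0 <= (beta - 1/2) * (1 - beta) * (8 * w * psi)).
  { repeat apply Rmult_le_pos; lra. }
  destruct (Rle_lt_dec beta (3/4)); nra.
Qed.

(** The failed crossing condition says s <= 2 (1 - w)^2 / P, and [cubic_sign] decreases in s. At
    this bound and kappa = 1, positivity is exactly [bracket_poly]. *)
Lemma cubic_sign_pos_of_no_crossing (kappa beta w s : R) :
  1 <= kappa -> 1/2 <= beta <= 1 -> 0 < w < 1 -> 0 < s ->
  beta = 1 \/ w <= 18/25 ->
  w * s * (1 - beta * w^2) <= 2 * (1 - s) * (1 - w)^2 ->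
  0 < cubic_sign kappa beta w s.
Proof.
  intros Hk Hb Hw Hs H Hf.
  assert (Pp := bracket_poly beta w Hb Hw H).
  set (P := w * (1 - beta * w^2) + 2 * (1 - w)^2) in *.
  set (f := 8 - 4 * w^2 * (1 + 3 * beta) + 8 * beta * w^3) in *.
  assert (Hbw : 0 < 1 - beta * w) by nra.
  assert (0 < 1 - beta * w^2) by nra.
  assert (0 < P).
  { unfold P. assert (0 < w * (1 - beta * w^2)) by (apply Rmult_lt_0_compat; lra).
    assert (h := pow2_ge_0 (1 - w)). lra. }
  set (B := 12 * (1 - s) - w * (8 - 6 * s)).
  assert (HsP : s * P <= 2 * (1 - w)^2) by (unfold P; nra).
  assert (HB : w * f <= B * P).
  { assert (h : 0 <= (12 - 6 * w) * (2 * (1 - w)^2 - s * P)) by (apply Rmult_le_pos; lra).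
    unfold B. replace ((12 * (1 - s) - w * (8 - 6 * s)) * P) with
      ((12 - 8 * w) * P - (12 - 6 * w) * (s * P)) by ring.
    assert (E : w * f = (12 - 8 * w) * P - (12 - 6 * w) * (2 * (1 - w)^2)) by (unfold f, P; ring).
    rewrite E. lra. }
  assert (Hy : 0 < 8 * w * (1 - beta * w)^3 * P).
  { repeat apply Rmult_lt_0_compat; try lra. }
  assert (Hf1 : 0 < w * f).
  { apply Rmult_lt_0_compat; [lra|]. nra. }
  assert (Hk2 : 1 <= kappa^2) by nra.
  apply Rmult_lt_reg_r with P; [assumption|]. rewrite Rmult_0_l.
  unfold cubic_sign. fold B.
  replace ((kappa^2 * (1 - w) * B - 8 * w^2 * (1 - beta * w)^3) * P) with
    (kappa^2 * ((1 - w) * (B * P)) - w * (8 * w * (1 - beta * w)^3 * P)) by ring.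
  assert (h1 : (1 - w) * (w * f) <= (1 - w) * (B * P)) by (apply Rmult_le_compat_l; lra).
  assert (h2 : 0 < (1-w) * (w * f)) by (apply Rmult_lt_0_compat; lra).
  assert (h3 : w * (8 * w * (1 - beta * w)^3 * P) < w * ((1 - w) * f)) by (apply Rmult_lt_compat_l; lra).
  nra.
Qed.

(* Past w = 18/25 positivity may be lost again; it is then found at w = 2/3 instead. *)
Lemma cubic_sign_pos_two_thirds (kappa beta sigma w : R) :
  1 <= kappa -> 1/2 <= beta <= 5/6 -> 18/25 < w < 1 -> 0 < sigma ->
  sigma * ((1 - beta * w) * (1 - beta * w^2)) <= 2 * (1 - w) ->
  let s := sigma * (1 - 2/3) * (1 - beta * (2/3)) / (2/3) in
  s < 1 /\ 0 < cubic_sign kappa beta (2/3) s.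
Proof.
  intros Hk Hb Hw Hs Hf s.
  assert (T := two_thirds_poly beta (1 - w) Hb (ltac:(lra))).
  replace (1 - (1 - w)) with w in T by ring.
  set (x := 1 - 2 * beta / 3) in *.
  assert (4/9 <= x <= 2/3) by (unfold x; lra).
  assert (Es : s = sigma * x / 2) by (unfold s, x; field).
  set (Q := (1 - beta * w) * (1 - beta * w^2)) in *.
  assert (0 < Q) by (unfold Q; apply Rmult_lt_0_compat; nra).
  assert (Hx3 : 0 < x^3) by (apply pow_lt; lra).
  assert (Hm : 12 * (sigma * x) < 20 - 32 * x^3).
  { apply Rmult_lt_reg_r with Q; [assumption|].
    assert (12 * x * (sigma * Q) <= 12 * x * (2 * (1 - w))) by (apply Rmult_le_compat_l; lra).
    nra. }
  split; [rewrite Es; nra|].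
  unfold cubic_sign. rewrite Es.
  replace (1 - beta * (2/3)) with x by (unfold x; field).
  assert (1 <= kappa^2) by nra.
  set (r := sigma * x) in *.
  replace (_ - _) with ((kappa^2 * (20 - 12 * r) - 32 * x^3) / 9) by field.
  nra.
Qed.

(** The product on the right is sigma (1 - beta) beta at k = 1. A failed crossing condition forces
    this quantity below 1/2, which excludes k = 1 with M >= 2. *)
Lemma sigma_beta_bound (M : R) : 2 <= M ->
  1/2 <= (M - 1) * (M + 1) / (1 * (M + 2 * 1 + 1)) * (((1 + 2) * M + 1) / (2 * (1 + 1) * M)).
Proof.
  intros HM.
  replace (_ * _) with ((M^2-1)*(3*M+1)/(4*M*(M+3))) by (field; lra).
  apply -> Rle_div_r; [|nra].
  replace M with (2 + (M - 2)) by ring. set (t := M - 2).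
  assert (0 <= t) by (unfold t; lra). clearbody t.
  assert (0 <= t * t) by nra. assert (0 <= t * t * t) by nra. nra.
Qed.

(* The disjunctions keep what is needed of [k] and [M] being integers; the last
   hypothesis says that the crossing speed is not positive at [w]. *)
Lemma cubic_sign_pos_before_no_crossing (k M w s : R) :
  k = 1 \/ 2 <= k -> M = 1 \/ 2 <= M -> M <= k^2 \/ k^2 + 1 <= M ->
  let beta := ((k + 2) * M + k) / (2 * (k + 1) * M) in
  let sigma := 2 * (k + 1) * M * (M + k) / (k^2 * (M + 2 * k + 1)) in
  let kappa := k * (M + 2 * k + 1) / ((k + 1) * (M + k)) in
  let S := fun w => sigma * (1 - w) * (1 - beta * w) / w in
  0 < w < 1 -> s = S w -> s < 1 ->
  w * s * (1 - beta * w^2) <= 2 * (1 - s) * (1 - w)^2 ->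
  exists w', 0 < w' <= w /\ S w' < 1 /\ 0 < cubic_sign kappa beta w' (S w').
Proof.
  intros Hk HM HkM beta sigma kappa S Hw Es Hs1 Hf.
  assert (1 <= k) by lra. assert (1 <= M) by lra.
  assert (1 <= k * M) by nra.
  assert (Hb : 1/2 <= beta <= 1).
  { unfold beta. split.
    - apply -> Rle_div_r; nra.
    - apply <- Rle_div_l; nra. }
  assert (Hbw : 0 < 1 - beta * w) by nra.
  assert (Hbw2 : 1 - beta * w <= 1 - beta * w^2).
  { assert (h : 0 <= beta * w * (1 - w)) by (apply Rmult_le_pos; [apply Rmult_le_pos|]; lra). lra. }
  assert (Hsig : 0 < sigma).
  { unfold sigma. apply Rdiv_lt_0_compat; repeat apply Rmult_lt_0_compat; nra. }
  assert (Hs0 : 0 < s).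
  { rewrite Es. unfold S. apply Rdiv_lt_0_compat; [apply Rmult_lt_0_compat; [apply Rmult_lt_0_compat|]|]; lra. }
  assert (Hws : w * s = sigma * (1 - w) * (1 - beta * w)) by (rewrite Es; unfold S; field; lra).
  assert (Hf2 : sigma * ((1 - beta * w) * (1 - beta * w^2)) <= 2 * (1 - s) * (1 - w)).
  { apply Rmult_le_reg_r with (1 - w); [lra|]. rewrite Hws in Hf. nra. }
  (* The arithmetic-geometric mean inequality for 1 - beta and beta (1 - w), whose sum is 1 - beta
     w, eliminates w from the failed crossing condition. *)
  assert (Hsb : sigma * (1 - beta) * beta < 1/2).
  { apply Rmult_lt_reg_r with (4 * (1 - w)); [lra|].
    assert (4 * (1 - beta) * (beta * (1 - w)) <= (1 - beta * w) * (1 - beta * w)) by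
      (assert (h := pow2_ge_0 ((1 - beta) - beta * (1 - w))); nra).
    assert ((1 - beta * w) * (1 - beta * w) <= (1 - beta * w) * (1 - beta * w^2)) by
      (apply Rmult_le_compat_l; lra).
    assert (sigma * (4 * (1 - beta) * (beta * (1 - w))) <= sigma * ((1 - beta * w) * (1 - beta * w^2)))
      by (apply Rmult_le_compat_l; lra).
    nra. }
  assert (Esb : sigma * (1 - beta) = (M - 1) * (M + k) / (k * (M + 2 * k + 1))).
  { unfold sigma, beta. field. split; nra. }
  (* kappa >= 1 amounts to M <= k^2. If M >= k^2 + 1, then sigma (1 - beta) beta >= 1/2, against
     [Hsb]. *)
  assert (Hkappa : 1 <= kappa).
  { unfold kappa. apply -> Rle_div_r; [|nra].
    destruct HkM as [HkM|HkM]; [nra|exfalso].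
    rewrite Esb in Hsb. destruct Hk as [->|Hk].
    - unfold beta in Hsb. destruct HM as [->|HM]; [nra|].
      assert (h := sigma_beta_bound M HM). lra.
    - assert (1 <= (M - 1) * (M + k) / (k * (M + 2 * k + 1))).
      { apply -> Rle_div_r; [nra|].
        assert (k * (M + 2 * k + 1) <= k * (k * (M + k))) by (apply Rmult_le_compat_l; nra).
        assert (k * k * (M + k) <= (M - 1) * (M + k)) by (apply Rmult_le_compat_r; nra). nra. }
      nra. }
  assert (Hdir : beta = 1 \/ w <= 18/25 -> exists w', 0 < w' <= w /\ S w' < 1 /\ 0 < cubic_sign kappa beta w' (S w')).
  { intros Hd. exists w. rewrite <- Es. repeat split; try lra.
    apply cubic_sign_pos_of_no_crossing; assumption. }
  destruct HM as [HM|HM].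
  { apply Hdir. left. unfold beta. rewrite HM. field. lra. }
  destruct (Rle_lt_dec w (18/25)) as [Hw2|Hw2]; [apply Hdir; right; assumption|].
  destruct Hk as [Hk|Hk].
  { exfalso. rewrite Esb in Hsb. unfold beta in Hsb. rewrite Hk in Hsb.
    assert (h := sigma_beta_bound M HM). lra. }
  (* 5/6 is the value of beta at k = M = 2. *)
  assert (Hb2 : 1/2 <= beta <= 5/6).
  { split; [lra|]. unfold beta. apply <- Rle_div_l; nra. }
  destruct (cubic_sign_pos_two_thirds kappa beta sigma w Hkappa Hb2 ltac:(lra) Hsig ltac:(nra)) as [h1 h2].
  exists (2/3). repeat split; try lra; assumption.
Qed.

(** * The critical curve *)

(* [lambda1] times [M + k - k u s]. *)
Definition crit_poly (k M u s : R) : R :=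
  ((k + 2) * M + k) * s * u ^ 2
  + ((M - 1) * (M + k) + (M + 2 * k + 1) * k * s) * u - (M + 2 * k + 1) * (M + k).

Definition crit_poly_du (k M u s : R) : R :=
  2 * ((k + 2) * M + k) * s * u + ((M - 1) * (M + k) + (M + 2 * k + 1) * k * s).

Definition crit_poly_ds (k M u s : R) : R :=
  ((k + 2) * M + k) * u ^ 2 + (M + 2 * k + 1) * k * u.

(* Has the sign of the derivative of [lambda1] in [u] along the equilibrium branch. *)
Definition crossing_speed (k M u s : R) : R :=
  crit_poly_du k M u s * (M + k - k * u * s)
  - 2 * k * (1 - s) * s * crit_poly_ds k M u s.

Definition w_beta (k M : R) : R := ((k + 2) * M + k) / (2 * (k + 1) * M).
Definition w_sigma (k M : R) : R := 2 * (k + 1) * M * (M + k) / (k ^ 2 * (M + 2 * k + 1)).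
Definition w_kappa (k M : R) : R := k * (M + 2 * k + 1) / ((k + 1) * (M + k)).

Definition sech2_of_w (k M w : R) : R :=
  w_sigma k M * (1 - w) * (1 - w_beta k M * w) / w.
Definition u_of_w (k M w : R) : R :=
  k * (M + 2 * k + 1) * w / (2 * (k + 1) * M * (1 - w_beta k M * w)).

Section Parametrization.

Variables (k M : R).
Hypotheses (hk : 1 <= k) (hM : 1 <= M).

Lemma kM_ge_1 : 1 <= k * M.
Proof. nra. Qed.

Lemma w_beta_bounds : 1/2 <= w_beta k M <= 1.
Proof.
  assert (h := kM_ge_1). unfold w_beta. split.
  - apply -> Rle_div_r; nra.
  - apply <- Rle_div_l; nra.
Qed.

Lemma w_factor_pos (w : R) : 0 < w < 1 -> 0 < 1 - w_beta k M * w.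
Proof. intros Hw. assert (h := w_beta_bounds). nra. Qed.

Lemma w_sigma_pos : 0 < w_sigma k M.
Proof.
  unfold w_sigma. apply Rdiv_lt_0_compat; repeat apply Rmult_lt_0_compat; nra.
Qed.

Lemma sech2_of_w_pos (w : R) : 0 < w < 1 -> 0 < sech2_of_w k M w.
Proof.
  intros Hw. assert (h1 := w_factor_pos w Hw). assert (h2 := w_sigma_pos).
  unfold sech2_of_w. apply Rdiv_lt_0_compat; [apply Rmult_lt_0_compat; [apply Rmult_lt_0_compat|]|]; lra.
Qed.

Lemma sech2_of_w_decr (w w' : R) : 0 < w < w' -> w' < 1 -> sech2_of_w k M w' < sech2_of_w k M w.
Proof.
  intros Hw Hw'. assert (hb := w_beta_bounds).
  assert (h1 := w_factor_pos w ltac:(lra)). assert (h1' := w_factor_pos w' ltac:(lra)).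
  assert (h2 := w_sigma_pos).
  unfold sech2_of_w. set (b := w_beta k M) in *. set (sg := w_sigma k M) in *.
  assert (b * w < b * w') by (apply Rmult_lt_compat_l; lra).
  assert (A : (1 - w') * (1 - b * w') < (1 - w) * (1 - b * w)) by (apply Rmult_le_0_lt_compat; lra).
  assert (P : 0 < (1 - w') * (1 - b * w')) by (apply Rmult_lt_0_compat; lra).
  apply Rlt_le_trans with (sg * (1 - w) * (1 - b * w) / w').
  - unfold Rdiv. apply Rmult_lt_compat_r; [apply Rinv_0_lt_compat; lra|]. nra.
  - unfold Rdiv. apply Rmult_le_compat_l; [|apply Rinv_le_contravar; lra].
    apply Rmult_le_pos; [apply Rmult_le_pos|]; lra.
Qed.

Lemma crit_poly_incr (s u v : R) : 0 < s -> 0 < u < v -> crit_poly k M u s < crit_poly k M v s.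
Proof.
  intros Hs Hu. unfold crit_poly.
  assert (0 < ((k + 2) * M + k) * s) by (apply Rmult_lt_0_compat; nra).
  assert (0 <= (M - 1) * (M + k)) by (apply Rmult_le_pos; lra).
  assert (0 < (M + 2 * k + 1) * k * s) by (apply Rmult_lt_0_compat; nra).
  assert (u ^ 2 < v ^ 2) by nra.
  assert (((k + 2) * M + k) * s * u ^ 2 < ((k + 2) * M + k) * s * v ^ 2) by (apply Rmult_lt_compat_l; assumption).
  nra.
Qed.

Lemma crit_poly_root_unique (s u v : R) : 0 < s -> 0 < u -> 0 < v ->
  crit_poly k M u s = 0 -> crit_poly k M v s = 0 -> u = v.
Proof.
  intros Hs Hu Hv Eu Ev.
  destruct (Rtotal_order u v) as [h|[h|h]]; [| assumption |].
  - assert (T := crit_poly_incr s u v Hs ltac:(lra)). lra.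
  - assert (T := crit_poly_incr s v u Hs ltac:(lra)). lra.
Qed.

(** If k u s reached M + k, the last two terms in k u s and M + k would combine to something
    nonnegative while the leading term is positive. In terms of [coef_c], this says c < 0 on the
    critical curve. *)
Lemma crit_poly_root_lt (s u : R) : 0 < s -> 0 < u -> crit_poly k M u s = 0 -> k * u * s < M + k.
Proof.
  intros Hs Hu E. unfold crit_poly in E.
  destruct (Rlt_le_dec (k * u * s) (M + k)) as [h|h]; [assumption|exfalso].
  assert (0 < ((k + 2) * M + k) * s * u ^ 2) by (repeat apply Rmult_lt_0_compat; nra).
  assert (0 <= (M - 1) * (M + k) * u) by (apply Rmult_le_pos; [apply Rmult_le_pos|]; lra).
  assert (0 <= (M + 2 * k + 1) * (k * u * s - (M + k))) by (apply Rmult_le_pos; lra).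
  nra.
Qed.

Lemma crit_poly_of_w (w : R) : 0 < w < 1 ->
  crit_poly k M (u_of_w k M w) (sech2_of_w k M w) = 0.
Proof.
  intros Hw. assert (h := w_factor_pos w Hw).
  unfold crit_poly, u_of_w, sech2_of_w, w_sigma.
  assert (E : (k + 2) * M + k = 2 * (k + 1) * M * w_beta k M) by (unfold w_beta; field; lra).
  assert (E' : M * k - k = 2 * (k + 1) * M * (1 - w_beta k M)) by (unfold w_beta; field; lra).
  assert (E2 : (M - 1) = 2 * (k + 1) * M * (1 - w_beta k M) / k) by (rewrite <- E'; field; lra).
  rewrite E, E2. field. repeat split; nra.
Qed.

Lemma u_of_w_pos (w : R) : 0 < w < 1 -> 0 < u_of_w k M w.
Proof.
  intros Hw. assert (h := w_factor_pos w Hw).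
  unfold u_of_w. apply Rdiv_lt_0_compat; repeat apply Rmult_lt_0_compat; lra.
Qed.

(** Replacing k u s by (M + k)(1 - w) makes the equation linear in u; its solution is [u_of_w], and
    s is then read off from k u s. *)
Lemma crit_poly_root_param (s u : R) : 0 < s -> 0 < u -> crit_poly k M u s = 0 ->
  exists w, 0 < w < 1 /\ u = u_of_w k M w /\ s = sech2_of_w k M w.
Proof.
  intros Hs Hu E. assert (Hlt := crit_poly_root_lt s u Hs Hu E).
  set (w := 1 - k * u * s / (M + k)).
  assert (0 < k * u * s) by (repeat apply Rmult_lt_0_compat; lra).
  assert (Hw : 0 < w < 1).
  { unfold w. assert (0 < k * u * s / (M + k)) by (apply Rdiv_lt_0_compat; lra).
    assert (k * u * s / (M + k) < 1) by (apply Rlt_div_l; lra). lra. }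
  assert (Ew : k * u * s = (M + k) * (1 - w)) by (unfold w; field; lra).
  clearbody w. exists w. split; [assumption|].
  assert (h := w_factor_pos w Hw).
  assert (Eb : (k + 2) * M + k = 2 * (k + 1) * M * w_beta k M) by (unfold w_beta; field; lra).
  assert (Eu : u = u_of_w k M w).
  { unfold u_of_w. unfold crit_poly in E. rewrite Eb in E.
    apply Rmult_eq_reg_r with (2 * (k + 1) * M * (1 - w_beta k M * w));
      [|apply Rgt_not_eq; repeat apply Rmult_lt_0_compat; lra].
    replace (k * (M + 2 * k + 1) * w / (2 * (k + 1) * M * (1 - w_beta k M * w))
      * (2 * (k + 1) * M * (1 - w_beta k M * w))) with (k * (M + 2 * k + 1) * w)
      by (field; repeat split; lra).
    apply Rmult_eq_reg_l with (M + k); [|lra].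
    replace (2 * (k + 1) * M * (1 - w_beta k M * w)) with
      ((M - 1) * k * w + 2 * (k + 1) * M * (1 - w)) by (unfold w_beta; field; lra).
    assert (Es : s = (M + k) * (1 - w) / (k * u)) by (rewrite <- Ew; field; split; lra).
    rewrite <- Eb in E. rewrite Es in E.
    assert (E3 : k * (((k + 2) * M + k) * ((M + k) * (1 - w) / (k * u)) * u ^ 2 +
     ((M - 1) * (M + k) + (M + 2 * k + 1) * k * ((M + k) * (1 - w) / (k * u))) * u -
     (M + 2 * k + 1) * (M + k)) = 0) by (rewrite E; ring).
    replace (k * _) with (((k + 2) * M + k) * ((M + k) * (1 - w)) * u
      + k * (M - 1) * (M + k) * u - k * (M + 2 * k + 1) * (M + k) * w) in E3 by (field; lra).
    nra. }
  split; [assumption|].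
  apply Rmult_eq_reg_l with (k * u); [|apply Rgt_not_eq, Rmult_lt_0_compat; lra].
  rewrite Ew, Eu. unfold u_of_w, sech2_of_w, w_sigma. field. repeat split; nra.
Qed.

Lemma sech2_of_w_eq (w : R) : 0 < w < 1 ->
  sech2_of_w k M w = (M + k) * (1 - w) / (k * u_of_w k M w).
Proof.
  intros Hw. assert (h := w_factor_pos w Hw).
  unfold sech2_of_w, u_of_w, w_sigma. field. repeat split; nra.
Qed.

(** The prefactor is positive, so the sign is that of the last factor; that factor being nonpositive
    is the hypothesis of [cubic_sign_pos_before_no_crossing]. *)
Lemma crossing_speed_of_w (w : R) : 0 < w < 1 ->
  let s := sech2_of_w k M w in
  crossing_speed k M (u_of_w k M w) s
  = (M + 2 * k + 1) * (M + k) * k / ((1 - w_beta k M * w) * (1 - w))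
    * (w * s * (1 - w_beta k M * w ^ 2) - 2 * (1 - s) * (1 - w) ^ 2).
Proof.
  intros Hw s. assert (h := w_factor_pos w Hw).
  assert (Hu := u_of_w_pos w Hw).
  assert (E : (k + 2) * M + k = 2 * (k + 1) * M * w_beta k M) by (unfold w_beta; field; lra).
  assert (E2 : (M - 1) = 2 * (k + 1) * M * (1 - w_beta k M) / k) by (unfold w_beta; field; lra).
  assert (Es : s = (M + k) * (1 - w) / (k * u_of_w k M w)) by (apply sech2_of_w_eq, Hw).
  assert (E3 : M + k - k * u_of_w k M w * s = (M + k) * w) by (rewrite Es; field; lra).
  assert (E4 : s * crit_poly_ds k M (u_of_w k M w) s
    = (M + 2 * k + 1) * (M + k) * (1 - w) / (1 - w_beta k M * w)).
  { unfold crit_poly_ds. rewrite Es, E. unfold u_of_w. field. repeat split; nra. }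
  assert (E5 : crit_poly_du k M (u_of_w k M w) s
    = (M + 2 * k + 1) * k * s * (1 - w_beta k M * w ^ 2) / ((1 - w_beta k M * w) * (1 - w))).
  { unfold crit_poly_du. rewrite Es, E, E2. unfold u_of_w. field. repeat split; nra. }
  unfold crossing_speed. rewrite E3, E5.
  replace (2 * k * (1 - s) * s * crit_poly_ds k M (u_of_w k M w) s) with
    (2 * k * (1 - s) * (s * crit_poly_ds k M (u_of_w k M w) s)) by ring.
  rewrite E4. field. lra.
Qed.

End Parametrization.

(** * lambda1, lambda3 and eps on the critical curve, as functions of the equilibrium *)

Section Bifurcation.

Variables (N n : nat) (k M : R).
Hypotheses (En : INR n = k + 1) (EN : INR N = M + 2 * k + 2).
Hypotheses (hk : 1 <= k) (hM : 1 <= M).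

(** [u_of] depends on y only through s = sech^2 y. Isolating this dependence gives evenness in y and
    reduces differentiability to that of an explicit function of s. *)
Definition root_formula (s : R) : R :=
  let c2 := (k + 2 + k / M) * s in
  let c1 := (M - 1) * (M + k) / M + (M + 2 * k + 1) * k / M * s in
  let c0 := - ((M + k) * (M + 2 * k + 1) / M) in
  (- c1 + sqrt (c1 ^ 2 - 4 * c2 * c0)) / (2 * c2).

Lemma u_of_root_formula (y : R) : u_of N n y = root_formula (1 - tanh y ^ 2).
Proof.
  unfold u_of, coef_c2, coef_c1, coef_c0, root_formula. rewrite Derive_tanh, En, EN.
  replace (M + 2 * k + 2 - 2 * (k + 1)) with M by ring.
  replace (M + 2 * k + 2 - (k + 1) - 1) with (M + k) by ring.
  replace (M + 2 * k + 2 - 1) with (M + 2 * k + 1) by ring.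
  replace (k + 1 - 1) with k by ring. replace (k + 1 + 1) with (k + 2) by ring.
  reflexivity.
Qed.

Lemma root_formula_spec (s : R) : 0 < s ->
  0 < root_formula s /\ crit_poly k M (root_formula s) s = 0 /\ ex_derive root_formula s.
Proof.
  intros Hs. unfold root_formula.
  set (c2 := (k + 2 + k / M) * s).
  set (c1 := (M - 1) * (M + k) / M + (M + 2 * k + 1) * k / M * s).
  set (c0 := - ((M + k) * (M + 2 * k + 1) / M)).
  assert (HkM : 0 < k / M) by (apply Rdiv_lt_0_compat; lra).
  assert (H2 : 0 < c2) by (apply Rmult_lt_0_compat; lra).
  assert (H1 : 0 < c1).
  { apply Rplus_le_lt_0_compat.
    - apply Rle_mult_inv_pos; [apply Rmult_le_pos; lra | lra].
    - apply Rmult_lt_0_compat; [|assumption]. apply Rdiv_lt_0_compat; nra. }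
  assert (H0 : c0 < 0).
  { unfold c0. apply Ropp_lt_gt_0_contravar, Rdiv_lt_0_compat; nra. }
  assert (Hd : c1 ^ 2 < c1 ^ 2 - 4 * c2 * c0) by nra.
  assert (Hsq : c1 < sqrt (c1 ^ 2 - 4 * c2 * c0)).
  { rewrite <- (sqrt_pow2 c1) at 1 by lra. apply sqrt_lt_1; nra. }
  assert (Hss : sqrt (c1 ^ 2 - 4 * c2 * c0) ^ 2 = c1 ^ 2 - 4 * c2 * c0) by (apply pow2_sqrt; nra).
  set (q := sqrt _) in *. repeat split.
  - apply Rdiv_lt_0_compat; lra.
  - set (u := (- c1 + q) / (2 * c2)).
    assert (E : c2 * u ^ 2 + c1 * u + c0 = 0).
    { unfold u. replace (c2 * ((- c1 + q) / (2 * c2)) ^ 2 + c1 * ((- c1 + q) / (2 * c2)) + c0)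
        with ((q ^ 2 - (c1 ^ 2 - 4 * c2 * c0)) / (4 * c2)) by (field; lra).
      rewrite Hss. field. lra. }
    replace (crit_poly k M u s) with (M * (c2 * u ^ 2 + c1 * u + c0)).
    + rewrite E. ring.
    + unfold crit_poly, c2, c1, c0. field. lra.
  - unfold root_formula. fold c0. auto_derive. fold c1 c2.
    replace (c1 * (c1 * 1) + - (4 * c2 * c0)) with (c1 ^ 2 - 4 * c2 * c0) by ring.
    repeat split; [|lra]. assert (h := pow2_ge_0 c1). lra.
Qed.

Lemma u_of_pos (y : R) : 0 < u_of N n y.
Proof. rewrite u_of_root_formula. apply root_formula_spec, sech2_pos. Qed.

Lemma crit_poly_u_of (y : R) : crit_poly k M (u_of N n y) (1 - tanh y ^ 2) = 0.
Proof. rewrite u_of_root_formula. apply root_formula_spec, sech2_pos. Qed.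

Lemma ex_derive_u_of (y : R) : ex_derive (u_of N n) y.
Proof.
  apply ex_derive_ext with (fun y => root_formula (1 - tanh y ^ 2)).
  { intros t. symmetry. apply u_of_root_formula. }
  apply (ex_derive_comp root_formula (fun y => 1 - tanh y ^ 2)).
  - apply root_formula_spec, sech2_pos.
  - eexists. apply (is_derive_tanh_comp (fun t => 1 - t ^ 2) y (fun t => - 2 * t)).
    intros t. auto_derive; [exact I | ring].
Qed.

Lemma u_of_unique (u y : R) : 0 < u -> crit_poly k M u (1 - tanh y ^ 2) = 0 -> u = u_of N n y.
Proof.
  intros Hu E. apply (crit_poly_root_unique k M hk hM (1 - tanh y ^ 2)); try assumption.
  - apply sech2_pos.
  - apply u_of_pos.
  - apply crit_poly_u_of.
Qed.

Lemma u_of_subcritical (y : R) : k * u_of N n y * (1 - tanh y ^ 2) < M + k.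
Proof.
  apply crit_poly_root_lt; try assumption; [apply sech2_pos | apply u_of_pos | apply crit_poly_u_of].
Qed.

Lemma coef_c_formula (y u : R) : u <> 0 ->
  coef_c N n y u = - ((M + k - k * u * (1 - tanh y ^ 2)) / (M * u)).
Proof.
  intros Hu. unfold coef_c. rewrite Derive_tanh, En, EN. field. split; lra.
Qed.

Lemma lambda1_formula (y u : R) : u <> 0 -> k * u * (1 - tanh y ^ 2) <> M + k ->
  lambda1 N n y u = crit_poly k M u (1 - tanh y ^ 2) / (M + k - k * u * (1 - tanh y ^ 2)).
Proof.
  intros Hu Hc. unfold lambda1. rewrite coef_c_formula, En, EN by assumption.
  unfold crit_poly. set (s := 1 - tanh y ^ 2) in *. field. repeat split; lra.
Qed.

(** If k u s >= M + k, then c >= 0: the first two terms of [lambda1] are negative and the third is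
    not positive. So zeros occur only where [lambda1_formula] applies. *)
Lemma lambda1_root (y u : R) : 0 < u -> lambda1 N n y u = 0 -> u = u_of N n y.
Proof.
  intros Hu E. set (s := 1 - tanh y ^ 2).
  assert (Hlt : k * u * s < M + k).
  { destruct (Rlt_le_dec (k * u * s) (M + k)) as [h|h]; [assumption|exfalso].
    unfold lambda1 in E. rewrite coef_c_formula, En, EN in E by lra. fold s in E.
    assert (0 < (1 + (k + 1 + 1) / (k + 1 - 1) * (M + 2 * k + 2 - 2 * (k + 1))) * u).
    { apply Rmult_lt_0_compat; [|assumption].
      assert (0 < (k + 1 + 1) / (k + 1 - 1)) by (apply Rdiv_lt_0_compat; lra). nra. }
    assert (0 <= (k + 1) * (M + 2 * k + 2 - (k + 1) - 1) / (k + 1 - 1) *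
      (2 / - ((M + k - k * u * s) / (M * u)))).
    { apply Rmult_le_pos; [apply Rle_mult_inv_pos; [apply Rmult_le_pos|]; lra|].
      destruct h as [h|h].
      - left. apply Rdiv_lt_0_compat; [lra|].
        replace (- ((M + k - k * u * s) / (M * u))) with ((k * u * s - (M + k)) / (M * u)) by (field; lra).
        apply Rdiv_lt_0_compat; [lra|apply Rmult_lt_0_compat; lra].
      (* Here c = 0, and the convention [/ 0 = 0] makes the third term vanish. *)
      - right. replace (M + k - k * u * s) with 0 by lra. unfold Rdiv.
        rewrite Rmult_0_l, Ropp_0, Rinv_0. ring. }
    lra. }
  apply u_of_unique; [assumption|].
  rewrite lambda1_formula in E by (fold s; lra). fold s in E |- *.
  apply Rmult_eq_reg_r with (/ (M + k - k * u * s)); [|apply Rinv_neq_0_compat; lra].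
  unfold Rdiv in E. rewrite E. ring.
Qed.

Lemma lambda1_u_of (y : R) : lambda1 N n y (u_of N n y) = 0.
Proof.
  assert (h := u_of_pos y). assert (h' := u_of_subcritical y).
  rewrite lambda1_formula, crit_poly_u_of by lra. unfold Rdiv. ring.
Qed.

(** [lambda1] = 0 expresses the term of [lambda3] linear in u through N - 1 and 2 / c; the part in 1
    / c then cancels 2 / (3 c). *)
Lemma lambda3_u_of (y : R) : lambda3 N n y (u_of N n y) = lambda3_of N n y.
Proof.
  assert (h := u_of_pos y). assert (h' := u_of_subcritical y).
  assert (E := lambda1_u_of y). unfold lambda1 in E. unfold lambda3, lambda3_of.
  assert (Hc : coef_c N n y (u_of N n y) <> 0).
  { rewrite coef_c_formula by lra.
    apply Ropp_neq_0_compat, Rgt_not_eq, Rdiv_lt_0_compat; [lra|apply Rmult_lt_0_compat; lra]. }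
  set (c := coef_c N n y (u_of N n y)) in *.
  set (a := coef_a N n y). set (b := coef_b N n y).
  set (A := n * (N - n - 1) / (n - 1)) in *.
  set (B := (1 + (n + 1) / (n - 1) * (N - 2 * n)) * u_of N n y) in *.
  assert (EB : B = - (N - 1) - A * (2 / c)) by lra.
  replace (1 / 3 * (1 + (n + 1) / (n - 1) * (N - 2 * n)) * u_of N n y) with (1 / 3 * B) by (unfold B; ring).
  rewrite EB. field. assumption.
Qed.

Lemma coef_a_formula (y : R) :
  coef_a N n y = k / M / 6 * ((1 - tanh y ^ 2) * (6 * tanh y ^ 2 - 2)).
Proof. unfold coef_a. rewrite Derive_n_tanh_3, En, EN. field. lra. Qed.

Lemma coef_b_formula (y : R) :
  coef_b N n y = k / M / 2 * (- 2 * tanh y * (1 - tanh y ^ 2)).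
Proof. unfold coef_b. rewrite Derive_n_tanh_2, En, EN. field. lra. Qed.

(** Only tanh^2 y enters the formula, through b^2 and a, so everything is rational in w and s; r
    collects the positive denominators. *)
Lemma lambda3_of_sign (y w : R) : 0 < w < 1 -> 1 - tanh y ^ 2 = sech2_of_w k M w ->
  exists r, 0 < r /\
    lambda3_of N n y = r * cubic_sign (w_kappa k M) (w_beta k M) w (sech2_of_w k M w).
Proof.
  intros Hw Es.
  assert (h := w_factor_pos k M hk hM w Hw).
  assert (HU := u_of_w_pos k M hk hM w Hw).
  assert (Eu : u_of N n y = u_of_w k M w).
  { symmetry. apply u_of_unique; [assumption|]. rewrite Es. apply crit_poly_of_w; assumption. }
  exists ((M + 2 * k + 1) / (24 * w ^ 2 * (1 - w_beta k M * w) ^ 3)). split.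
  { apply Rdiv_lt_0_compat; [lra|]. repeat apply Rmult_lt_0_compat; lra. }
  unfold lambda3_of. rewrite coef_c_formula, coef_a_formula, coef_b_formula, Eu, En, EN by (rewrite Eu; lra).
  assert (ET : tanh y ^ 2 = 1 - sech2_of_w k M w) by lra.
  replace (4 * (k / M / 2 * (-2 * tanh y * (1 - tanh y ^ 2))) ^ 2) with
    (4 * (k / M) ^ 2 * (1 - tanh y ^ 2) ^ 2 * tanh y ^ 2) by (field; lra).
  rewrite ET. set (s := sech2_of_w k M w).
  replace (1 - (1 - s)) with s by ring.
  assert (Ess : s = (M + k) * (1 - w) / (k * u_of_w k M w)) by (apply sech2_of_w_eq; assumption).
  replace (M + k - k * u_of_w k M w * s) with ((M + k) * w) by (rewrite Ess; field; lra).
  set (B := 12 * (1 - s) - w * (8 - 6 * s)).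
  (* g is - c; [Eg] below says that it equals 2 (1 - beta w) / kappa. *)
  set (g := (M + k) * w / (M * u_of_w k M w)).
  assert (Eg : g = 2 * (k + 1) * (M + k) * (1 - w_beta k M * w) / (k * (M + 2 * k + 1))).
  { unfold g, u_of_w. field. repeat split; nra. }
  assert (Hg : 0 < g) by (rewrite Eg; apply Rdiv_lt_0_compat; repeat apply Rmult_lt_0_compat; lra).
  assert (Eks : k / M * s = g * (1 - w) / w) by (rewrite Ess; unfold g; field; lra).
  transitivity (- (1 / 3) * (M + 2 * k + 1)
    + (k + 1) * (M + k) / k * ((1 - w) * B / (3 * w ^ 2) / g ^ 3)).
  { replace (2 * (k / M / 6 * (s * (6 * (1 - s) - 2))) * - g - 4 * (k / M) ^ 2 * s ^ 2 * (1 - s))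
      with (- ((k / M * s) * (g * (4 - 6 * s) / 3 + 4 * (k / M * s) * (1 - s)))) by (field; lra).
    rewrite Eks. unfold B. field. repeat split; lra. }
  unfold cubic_sign. fold B. rewrite Eg. unfold w_kappa. field. repeat split; try lra; nra.
Qed.

(** At y = 0 one has s = 1, and [cubic_sign] reduces to - 2 w kappa^2 (1 - w) - 8 w^2 (1 - beta
    w)^3. *)
Lemma lambda3_of_neg_0 : lambda3_of N n 0 < 0.
Proof.
  assert (hs : 1 - tanh 0 ^ 2 = 1) by (rewrite tanh_0; ring).
  destruct (crit_poly_root_param k M hk hM (1 - tanh 0 ^ 2) (u_of N n 0)) as (w & Hw & _ & Es).
  - apply sech2_pos.
  - apply u_of_pos.
  - apply crit_poly_u_of.
  - destruct (lambda3_of_sign 0 w Hw Es) as (r & Hr & ->). rewrite <- Es, hs.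
    assert (h := w_factor_pos k M hk hM w Hw).
    assert (hkap : 0 < w_kappa k M) by (unfold w_kappa; apply Rdiv_lt_0_compat; nra).
    unfold cubic_sign. set (q := w_kappa k M) in *. set (b := w_beta k M) in *. clearbody q b.
    assert (0 < 8 * w ^ 2 * (1 - b * w) ^ 3) by (repeat apply Rmult_lt_0_compat; lra).
    assert (0 < q ^ 2 * (1 - w) * (2 * w)) by (repeat apply Rmult_lt_0_compat; lra).
    apply (Rmult_lt_reg_l (/ r)); [apply Rinv_0_lt_compat; lra|].
    rewrite Rmult_0_r, <- Rmult_assoc, Rinv_l, Rmult_1_l by lra. lra.
Qed.

Lemma param_of_state (y : R) :
  exists w, 0 < w < 1 /\ u_of N n y = u_of_w k M w /\ 1 - tanh y ^ 2 = sech2_of_w k M w.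
Proof.
  apply crit_poly_root_param; try assumption; [apply sech2_pos | apply u_of_pos | apply crit_poly_u_of].
Qed.

Lemma lambda3_of_opp (y : R) : lambda3_of N n (- y) = lambda3_of N n y.
Proof.
  destruct (param_of_state y) as (w & Hw & _ & Es).
  assert (E : 1 - tanh (- y) ^ 2 = 1 - tanh y ^ 2) by (rewrite tanh_opp; ring).
  unfold lambda3_of. rewrite !coef_a_formula, !coef_b_formula, !u_of_root_formula, E.
  assert (h := proj1 (root_formula_spec _ (sech2_pos y))).
  rewrite !coef_c_formula, E by lra. rewrite tanh_opp.
  replace ((- tanh y) ^ 2) with (tanh y ^ 2) by ring.
  replace ((k / M / 2 * (-2 * - tanh y * (1 - tanh y ^ 2))) ^ 2) with
    ((k / M / 2 * (-2 * tanh y * (1 - tanh y ^ 2))) ^ 2) by (field; lra).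
  reflexivity.
Qed.

Lemma is_derive_sech2 (y : R) :
  is_derive (fun y => 1 - tanh y ^ 2) y (- 2 * tanh y * (1 - tanh y ^ 2)).
Proof.
  replace (- 2 * tanh y * (1 - tanh y ^ 2)) with ((1 - tanh y ^ 2) * (- 2 * tanh y)) by ring.
  apply (is_derive_tanh_comp (fun t => 1 - t ^ 2) y (fun t => - 2 * t)).
  intros t. auto_derive; [exact I | ring].
Qed.

Lemma is_derive_crit_poly (U S : R -> R) (x U' S' : R) :
  is_derive U x U' -> is_derive S x S' ->
  is_derive (fun x => crit_poly k M (U x) (S x)) x
    (crit_poly_du k M (U x) (S x) * U' + crit_poly_ds k M (U x) (S x) * S').
Proof.
  intros HU HS. unfold crit_poly, crit_poly_du, crit_poly_ds.
  auto_derive.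
  - repeat split; solve [exact I | exists S'; assumption | exists U'; assumption].
  - replace (Derive (fun x => U x) x) with U' by (symmetry; apply is_derive_unique, HU).
    replace (Derive (fun x => S x) x) with S' by (symmetry; apply is_derive_unique, HS). ring.
Qed.

Lemma crit_poly_du_pos (u s : R) : 0 < u -> 0 < s -> 0 < crit_poly_du k M u s.
Proof.
  intros Hu Hs. unfold crit_poly_du.
  assert (0 < 2 * ((k + 2) * M + k) * s * u) by (repeat apply Rmult_lt_0_compat; nra).
  assert (0 <= (M - 1) * (M + k)) by (apply Rmult_le_pos; lra).
  assert (0 < (M + 2 * k + 1) * k * s) by (repeat apply Rmult_lt_0_compat; nra).
  lra.
Qed.

(** Implicit differentiation of [crit_poly] = 0 gives u' = 2 T s Q / P, where T = tanh y and P, Q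
    are the partial derivatives in u and s. The numerator that results is the speed at which
    [lambda1] crosses zero along the branch, so a pitchfork occurs where [eps_of] increases. *)
Lemma is_derive_eps_of (y : R) :
  is_derive (eps_of N n) y
    (crossing_speed k M (u_of N n y) (1 - tanh y ^ 2)
     / (2 * (M + k) * crit_poly_du k M (u_of N n y) (1 - tanh y ^ 2))).
Proof.
  destruct (ex_derive_u_of y : exists u' : R, is_derive (u_of N n) y u') as [u' Hu'].
  assert (HP := crit_poly_du_pos _ _ (u_of_pos y) (sech2_pos y)).
  assert (D := is_derive_crit_poly (u_of N n) (fun y => 1 - tanh y ^ 2) y _ _ Hu' (is_derive_sech2 y)).
  assert (D0 : is_derive (fun x => crit_poly k M (u_of N n x) (1 - tanh x ^ 2)) y 0).
  { apply is_derive_ext with (fun _ => 0); [intros t; symmetry; apply crit_poly_u_of|].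
    apply (is_derive_const 0). }
  apply is_derive_unique in D0. rewrite (is_derive_unique _ _ _ D) in D0. cbv beta in D0.
  apply is_derive_ext with (fun y => 1 / 2 * y - k / (2 * (M + k)) * (u_of N n y * tanh y)).
  { intros t. change (1 / 2 * t - k / (2 * (M + k)) * (u_of N n t * tanh t) = eps_of N n t).
    unfold eps_of. rewrite En, EN. field. lra. }
  assert (DT := is_derive_tanh y).
  assert (DM := is_derive_mult _ _ _ _ _ Hu' DT Rmult_comm).
  unfold mult, plus in DM; simpl in DM.
  set (f := fun y => u_of N n y * tanh y).
  assert (Df : is_derive f y (u' * tanh y + u_of N n y * (1 - tanh y ^ 2))) by exact DM.
  match goal with |- is_derive _ _ ?l =>
    change (is_derive (fun y => 1 / 2 * y - k / (2 * (M + k)) * f y) y l) end.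
  clearbody f. auto_derive; [eexists; exact Df|].
  replace (Derive (fun y => f y) y) with (u' * tanh y + u_of N n y * (1 - tanh y ^ 2))
    by (symmetry; apply is_derive_unique, Df).
  unfold crossing_speed.
  set (s := 1 - tanh y ^ 2) in *. set (P := crit_poly_du _ _ _ _) in *.
  set (Q := crit_poly_ds _ _ _ _) in *.
  assert (Eu : u' = 2 * tanh y * s * Q / P).
  { apply Rmult_eq_reg_l with P; [|lra]. transitivity (2 * tanh y * s * Q); [lra | field; lra]. }
  rewrite Eu. replace (1 - s) with (tanh y * tanh y) by (unfold s; ring). field. lra.
Qed.

End Bifurcation.

(** * Sign changes of lambda3 *)

Lemma one_sided_sign_of_derive (q : R -> R) (y l : R) : 0 < l -> is_derive q y l -> q y = 0 ->
  at_right y (fun x => 0 < q x) /\ at_left y (fun x => q x < 0).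
Proof.
  intros Hl Hd H0. apply is_derive_Reals in Hd. destruct (Hd l Hl) as [d Hd'].
  split; exists d; intros x Hx Hlt; change (Rabs (x - y) < d) in Hx.
  - specialize (Hd' (x - y) ltac:(apply Rgt_not_eq; lra) Hx).
    rewrite Rplus_minus, H0 in Hd'.
    apply Rabs_def2 in Hd'.
    replace (q x) with ((q x - 0) / (x - y) * (x - y)) by (field; lra).
    apply Rmult_lt_0_compat; lra.
  - specialize (Hd' (x - y) ltac:(apply Rlt_not_eq; lra) Hx).
    rewrite Rplus_minus, H0 in Hd'.
    apply Rabs_def2 in Hd'.
    replace (q x) with (- ((q x - 0) / (x - y) * (y - x))) by (field; lra).
    apply Ropp_lt_gt_0_contravar, Rmult_lt_0_compat; lra.
Qed.

Section Transition.

Variables (N n : nat) (k M : R).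
Hypotheses (En : INR n = k + 1) (EN : INR N = M + 2 * k + 2).
Hypotheses (hk : 1 <= k) (hM : 1 <= M).

Definition w_of (y : R) : R := 1 - k * u_of N n y * (1 - tanh y ^ 2) / (M + k).

Lemma w_of_spec (y : R) : 0 < w_of y < 1 /\
  u_of N n y = u_of_w k M (w_of y) /\ 1 - tanh y ^ 2 = sech2_of_w k M (w_of y).
Proof.
  destruct (param_of_state N n k M En EN hk hM y) as (w & Hw & Eu & Es).
  assert (hu := u_of_w_pos k M hk hM w Hw).
  assert (E : w_of y = w).
  { unfold w_of. rewrite Eu, Es, sech2_of_w_eq by assumption. field. lra. }
  rewrite E. auto.
Qed.

(** sech^2 decreases strictly in y >= 0, and also in w. *)
Lemma w_of_incr (y z : R) : 0 <= y < z -> w_of y < w_of z.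
Proof.
  intros H. destruct (w_of_spec y) as (Hy & _ & Ey). destruct (w_of_spec z) as (Hz & _ & Ez).
  assert (Hs := sech2_decr y z H).
  destruct (Rtotal_order (w_of y) (w_of z)) as [h|[h|h]]; [assumption | |].
  - rewrite Ey, Ez, h in Hs. lra.
  - assert (T := sech2_of_w_decr k M hk hM (w_of z) (w_of y) ltac:(lra) ltac:(lra)). lra.
Qed.

Lemma ex_derive_sech2 (y : R) : ex_derive (fun y => 1 - tanh y ^ 2) y.
Proof. eexists. apply is_derive_sech2. Qed.

Lemma continuous_w_of (y : R) : continuous w_of y.
Proof.
  apply (ex_derive_continuous w_of). unfold w_of.
  assert (h1 := ex_derive_u_of N n k M En EN hk hM y). assert (h2 := ex_derive_sech2 y).
  set (f := fun y => 1 - tanh y ^ 2) in *. set (g := u_of N n) in *.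
  change (ex_derive (fun y => 1 - k * g y * f y / (M + k)) y).
  change (ex_derive f y) in h2. clearbody f g. auto_derive. repeat split; assumption.
Qed.

Lemma lambda3_of_at (y : R) : exists r, 0 < r /\
  lambda3_of N n y = r * cubic_sign (w_kappa k M) (w_beta k M) (w_of y) (sech2_of_w k M (w_of y)).
Proof.
  destruct (w_of_spec y) as (Hw & _ & Es).
  apply (lambda3_of_sign N n k M En EN hk hM y (w_of y) Hw Es).
Qed.

(** Equal to w times [cubic_sign] on the curve; the factor w clears the denominator of [sech2_of_w].
    Differences are mostly spelled as sums with negated coefficients, to match the closure rules for
    [polynomial]. *)
Definition cubic_sign_poly (w : R) : R :=
  w_kappa k M ^ 2 * (1 - w)
    * (12 * w + - 8 * w ^ 2 + - 6 * (2 + - 1 * w) * w_sigma k M * (1 + - 1 * w) * (1 + - w_beta k M * w))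
  + - 8 * w ^ 3 * (1 + - w_beta k M * w) ^ 3.

Lemma polynomial_cubic_sign_poly : polynomial cubic_sign_poly.
Proof.
  unfold cubic_sign_poly, Rminus.
  assert (Hneg : polynomial (fun x => - x)).
  { exists (0 :: -1 :: nil)%list. intros x; simpl; ring. }
  repeat first [ apply polynomial_const | apply polynomial_id | apply Hneg
    | apply polynomial_pow
    | match goal with |- polynomial (fun w => @?a w + @?b w) => apply (polynomial_plus a b) end
    | match goal with |- polynomial (fun w => @?a w * @?b w) => apply (polynomial_mult a b) end ].
Qed.

Lemma cubic_sign_poly_eq (w : R) : w <> 0 ->
  cubic_sign_poly w = w * cubic_sign (w_kappa k M) (w_beta k M) w (sech2_of_w k M w).
Proof. intros Hw. unfold cubic_sign_poly, cubic_sign, sech2_of_w. field. assumption. Qed.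

Lemma lambda3_of_poly (y : R) : exists r, 0 < r /\ lambda3_of N n y = r * cubic_sign_poly (w_of y).
Proof.
  destruct (lambda3_of_at y) as (r & Hr & E). destruct (w_of_spec y) as (Hw & _).
  exists (r / w_of y). split; [apply Rdiv_lt_0_compat; lra|].
  rewrite cubic_sign_poly_eq, E by lra. field. lra.
Qed.

Lemma filterlim_w_of_right (y : R) : 0 <= y -> filterlim w_of (at_right y) (at_right (w_of y)).
Proof.
  intros Hy P HP. destruct (continuous_w_of y _ HP) as [d Hd]. exists d. intros x Hx Hlt.
  apply Hd; [assumption | apply w_of_incr; lra].
Qed.

Lemma filterlim_w_of_left (y : R) : 0 < y -> filterlim w_of (at_left y) (at_left (w_of y)).
Proof.
  intros Hy P HP. destruct (continuous_w_of y _ HP) as [d Hd].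
  (* Capping the radius by y keeps x positive, where [w_of] increases. *)
  assert (hd : 0 < Rmin d y) by (apply Rmin_pos; [apply cond_pos | assumption]).
  exists (mkposreal _ hd). intros x Hx Hlt. change (Rabs (x - y) < Rmin d y) in Hx.
  assert (h1 := Rmin_l d y). assert (h2 := Rmin_r d y).
  apply Hd; [change (Rabs (x - y) < d); lra|].
  apply w_of_incr. rewrite Rabs_left in Hx; lra.
Qed.

(** The polynomial is not identically zero, being negative at [w_of 0]; its one-sided signs are
    carried back through the continuous increasing [w_of]. *)
Lemma lambda3_of_one_sided_sign (y : R) : 0 < y ->
  (at_right y (fun x => 0 < lambda3_of N n x) \/ at_right y (fun x => lambda3_of N n x < 0)) /\
  (at_left y (fun x => 0 < lambda3_of N n x) \/ at_left y (fun x => lambda3_of N n x < 0)).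
Proof.
  intros Hy.
  assert (Hz : cubic_sign_poly (w_of 0) <> 0).
  { destruct (lambda3_of_poly 0) as (r & Hr & E).
    assert (H := lambda3_of_neg_0 N n k M En EN hk hM). rewrite E in H. nra. }
  assert (Hp : forall x, 0 < cubic_sign_poly (w_of x) -> 0 < lambda3_of N n x).
  { intros x Hx. destruct (lambda3_of_poly x) as (r & Hr & ->). apply Rmult_lt_0_compat; assumption. }
  assert (Hn : forall x, cubic_sign_poly (w_of x) < 0 -> lambda3_of N n x < 0).
  { intros x Hx. destruct (lambda3_of_poly x) as (r & Hr & ->). nra. }
  destruct (polynomial_one_sided_sign _ (w_of y) (w_of 0) polynomial_cubic_sign_poly Hz) as [HR HL].
  split.
  - destruct HR as [h|h]; [left|right];
      apply (filterlim_w_of_right y (Rlt_le _ _ Hy)) in h; unfold filtermap in h;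
      revert h; apply filter_imp; intros x; auto.
  - destruct HL as [h|h]; [left|right];
      apply (filterlim_w_of_left y Hy) in h; unfold filtermap in h;
      revert h; apply filter_imp; intros x; auto.
Qed.

Lemma continuous_lambda3_of (y : R) : continuous (lambda3_of N n) y.
Proof.
  set (g := fun u T => - (1 / 3) * (M + 2 * k + 1) + (k + 1) * (M + k) / k *
    ((2 * (k / M / 6 * ((1 - T ^ 2) * (6 * T ^ 2 - 2))) * (- ((M + k - k * u * (1 - T ^ 2)) / (M * u)))
      - 4 * (k / M / 2 * (- 2 * T * (1 - T ^ 2))) ^ 2)
     / (- ((M + k - k * u * (1 - T ^ 2)) / (M * u))) ^ 5)).
  apply continuous_ext with (fun y => g (u_of N n y) (tanh y)).
  { intros x. unfold lambda3_of.
    assert (h := u_of_pos N n k M En EN hk hM x).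
    rewrite (coef_a_formula N n k M En EN hM), (coef_b_formula N n k M En EN hM),
      (coef_c_formula N n k M En EN hM) by lra.
    rewrite En, EN. unfold g.
    replace (M + 2 * k + 2 - (k + 1) - 1) with (M + k) by ring.
    replace (M + 2 * k + 2 - 1) with (M + 2 * k + 1) by ring.
    replace (k + 1 - 1) with k by ring. reflexivity. }
  apply (ex_derive_continuous (fun y => g (u_of N n y) (tanh y))).
  assert (h1 := ex_derive_u_of N n k M En EN hk hM y). assert (h2 := ex_derive_tanh y).
  assert (h3 := u_of_pos N n k M En EN hk hM y).
  assert (h4 := u_of_subcritical N n k M En EN hk hM y).
  unfold g. set (f := u_of N n) in *. clearbody f. generalize dependent tanh. intros th h2 h4.
  auto_derive. repeat split; try assumption; try (apply Rgt_not_eq; nra).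
  assert (0 < (M + k + - (k * f y * (1 - th y ^ 2))) * / (M * f y)).
  { apply Rdiv_lt_0_compat; [lra | apply Rmult_lt_0_compat; lra]. }
  apply Rlt_not_eq. simpl in *. set (z := (M + k + _) * _) in *.
  match goal with |- ?a < 0 => replace a with (- z ^ 5) by ring end.
  assert (h := pow_lt z 5 H). lra.
Qed.

Lemma continuous_crossing_speed (y : R) :
  continuous (fun y => crossing_speed k M (u_of N n y) (1 - tanh y ^ 2)) y.
Proof.
  apply (ex_derive_continuous (fun y => crossing_speed k M (u_of N n y) (1 - tanh y ^ 2))).
  assert (h1 := ex_derive_u_of N n k M En EN hk hM y). assert (h2 := ex_derive_tanh y).
  unfold crossing_speed, crit_poly_du, crit_poly_ds.
  set (f := u_of N n) in *. clearbody f. generalize dependent tanh. intros th h2.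
  auto_derive. repeat split; assumption.
Qed.

Lemma crossing_speed_pos_0 : 0 < crossing_speed k M (u_of N n 0) (1 - tanh 0 ^ 2).
Proof.
  rewrite tanh_0. unfold crossing_speed.
  assert (h := u_of_subcritical N n k M En EN hk hM 0). rewrite tanh_0 in h.
  assert (h2 := crit_poly_du_pos k M hk hM (u_of N n 0) (1 - 0 ^ 2) (u_of_pos N n k M En EN hk hM 0) ltac:(lra)).
  assert (0 < crit_poly_du k M (u_of N n 0) (1 - 0 ^ 2) * (M + k - k * u_of N n 0 * (1 - 0 ^ 2)))
    by (apply Rmult_lt_0_compat; lra).
  nra.
Qed.

(** The choice of y0 only makes positive values accumulate at y0 from the right and gives a weak
    inequality on the left. Isolation of the zeros upgrades these to strict signs on one-sided
    neighbourhoods. *)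
Lemma first_sign_change (yp : R) : 0 < yp -> 0 < lambda3_of N n yp ->
  exists y0, 0 < y0 < yp /\ lambda3_of N n y0 = 0 /\
    (forall z, 0 < z <= y0 -> lambda3_of N n z  <= 0) /\
    at_left y0 (fun y => lambda3_of N n y < 0) /\
    at_right y0 (fun y => 0 < lambda3_of N n y).
Proof.
  intros Hyp Hpos.
  set (E := fun y => 0 <= y <= yp /\ forall z, 0 < z <= y -> lambda3_of N n z <= 0).
  assert (E0 : E 0) by (split; [lra | intros z Hz; lra]).
  destruct (completeness E) as [y0 [Hub Hlub]].
  { exists yp. intros y [h _]. lra. }
  { exists 0. exact E0. }
  assert (Hy0p : y0 <= yp) by (apply Hlub; intros y [h _]; lra).
  assert (Hy0 : 0 < y0).
  { assert (C := continuous_lambda3_of 0 (fun l => l < 0)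
      ltac:(apply open_lt, (lambda3_of_neg_0 N n k M En EN hk hM))).
    destruct C as [d Hd].
    assert (hd := cond_pos d).
    apply Rlt_le_trans with (Rmin (d / 2) yp); [apply Rmin_pos; lra|]. apply Hub.
    assert (h1 := Rmin_l (d / 2) yp). assert (h2 := Rmin_r (d / 2) yp).
    split; [split; [apply Rmin_glb; lra | lra]|].
    intros z Hz. left. apply Hd. change (Rabs (z - 0) < d). rewrite Rabs_pos_eq; lra. }
  assert (Hlt : forall z, 0 < z < y0 -> lambda3_of N n z <= 0).
  { intros z Hz. destruct (Rle_lt_dec (lambda3_of N n z) 0) as [h|h]; [assumption|exfalso].
    assert (y0 <= z); [|lra]. apply Hlub. intros y [h1 h2].
    destruct (Rle_lt_dec y z) as [h3|h3]; [assumption|]. specialize (h2 z ltac:(lra)). lra. }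
  assert (Hle : lambda3_of N n y0 <= 0).
  { destruct (Rle_lt_dec (lambda3_of N n y0) 0) as [h|h]; [assumption|exfalso].
    destruct (continuous_lambda3_of y0 (fun l => 0 < l) ltac:(apply open_gt, h)) as [d Hd].
    assert (hd := cond_pos d). set (z := Rmax (y0 / 2) (y0 - d / 2)).
    assert (h1 := Rmax_l (y0 / 2) (y0 - d / 2)). assert (h2 := Rmax_r (y0 / 2) (y0 - d / 2)).
    fold z in h1, h2. assert (h3 : z < y0) by (apply Rmax_lub_lt; lra).
    specialize (Hlt z ltac:(lra)).
    assert (0 < lambda3_of N n z); [|lra]. apply Hd. change (Rabs (z - y0) < d). rewrite Rabs_left; lra. }
  assert (Hall : forall z, 0 < z <= y0 -> lambda3_of N n z <= 0).
  { intros z [h1 [h2| ->]]; [apply Hlt; lra | assumption]. }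
  assert (Hlt' : y0 < yp).
  { destruct Hy0p as [h|h]; [assumption|]. rewrite h in Hle. lra. }
  assert (Hnext : forall d, 0 < d -> exists z, y0 < z < y0 + d /\ 0 < lambda3_of N n z).
  { intros d Hd. destruct (classic (exists z, y0 < z < y0 + d /\ 0 < lambda3_of N n z)) as [h|h]; [assumption|exfalso].
    set (y := Rmin yp (y0 + d / 2)).
    assert (h1 := Rmin_l yp (y0 + d / 2)). assert (h2 := Rmin_r yp (y0 + d / 2)). fold y in h1, h2.
    assert (h3 : y0 < y) by (apply Rmin_glb_lt; lra).
    assert (y <= y0); [|lra]. apply Hub. split; [lra|]. intros z Hz.
    destruct (Rle_lt_dec z y0) as [h4|h4]; [apply Hall; lra|].
    destruct (Rle_lt_dec (lambda3_of N n z) 0) as [h5|h5]; [assumption|].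
    exfalso. apply h. exists z. split; [lra | assumption]. }
  destruct (lambda3_of_one_sided_sign y0 Hy0) as [HR HL].
  exists y0. repeat split; try assumption.
  - destruct Hle as [h|h]; [exfalso|assumption].
    destruct (continuous_lambda3_of y0 (fun l => l < 0) ltac:(apply open_lt, h)) as [d Hd].
    destruct (Hnext d (cond_pos d)) as (z & Hz & Hz').
    assert (lambda3_of N n z < 0); [|lra]. apply Hd. change (Rabs (z - y0) < d). rewrite Rabs_pos_eq; lra.
  - destruct HL as [[d Hd]|h]; [exfalso|assumption].
    assert (hd := cond_pos d). set (z := Rmax (y0 / 2) (y0 - d / 2)).
    assert (h1 := Rmax_l (y0 / 2) (y0 - d / 2)). assert (h2 := Rmax_r (y0 / 2) (y0 - d / 2)).
    fold z in h1, h2. assert (h3 : z < y0) by (apply Rmax_lub_lt; lra).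
    assert (T := Hlt z ltac:(lra)).
    assert (0 < lambda3_of N n z); [|lra]. apply Hd; [|assumption]. change (Rabs (z - y0) < d). rewrite Rabs_left; lra.
  - destruct HR as [h|[d Hd]]; [assumption|exfalso].
    destruct (Hnext d (cond_pos d)) as (z & Hz & Hz').
    assert (lambda3_of N n z < 0); [|lra]. apply Hd; [|lra]. change (Rabs (z - y0) < d). rewrite Rabs_pos_eq; lra.
Qed.

(** Large y corresponds to w close to 1, where [cubic_sign_poly] tends to - 8 (1 - beta)^3; and beta
    < 1 because M > 1. *)
Lemma lambda3_of_eventually_neg (yp : R) : 0 < yp -> 1 < M ->
  exists y, yp < y /\ lambda3_of N n y < 0.
Proof.
  intros Hyp HM. destruct (w_of_spec yp) as (Hw & _ & Es).
  assert (Hb : w_beta k M < 1).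
  { unfold w_beta. apply Rlt_div_l; nra. }
  assert (H1 : cubic_sign_poly 1 < 0).
  { unfold cubic_sign_poly. set (q := w_kappa k M). set (b := w_beta k M) in *. set (sg := w_sigma k M).
    clearbody q b sg. assert (h := pow_lt (1 - b) 3 ltac:(lra)).
    replace (_ + _) with (- (8 * (1 - b) ^ 3)) by ring. lra. }
  assert (Cp : continuous cubic_sign_poly 1).
  { destruct polynomial_cubic_sign_poly as [p Hp].
    apply continuous_ext with (poly_eval p); [intros x; symmetry; apply Hp | apply continuous_poly_eval]. }
  destruct (Cp (fun l => l < 0) ltac:(apply open_lt, H1)) as [d Hd].
  (* Exceeding [w_of yp] places the state of w beyond yp; being within d of 1 makes the polynomial
     negative. *)
  assert (hd := cond_pos d). set (w := Rmax ((1 + w_of yp) / 2) (1 - d / 2)).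
  assert (h1 := Rmax_l ((1 + w_of yp) / 2) (1 - d / 2)). assert (h2 := Rmax_r ((1 + w_of yp) / 2) (1 - d / 2)).
  fold w in h1, h2. assert (h3 : w < 1) by (apply Rmax_lub_lt; lra).
  assert (Hneg : cubic_sign_poly w < 0).
  { apply Hd. change (Rabs (w - 1) < d). rewrite Rabs_left; lra. }
  assert (Hs0 := sech2_of_w_pos k M hk hM w ltac:(lra)).
  assert (Hs1 := sech2_of_w_decr k M hk hM (w_of yp) w ltac:(lra) h3).
  rewrite <- Es in Hs1. assert (hT := pow2_ge_0 (tanh yp)).
  destruct (tanh_surj (sqrt (1 - sech2_of_w k M w))) as (z & Hz & Ez).
  { split; [apply sqrt_pos|]. rewrite <- sqrt_1 at 2. apply sqrt_lt_1; lra. }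
  assert (Ez2 : 1 - tanh z ^ 2 = sech2_of_w k M w) by (rewrite Ez, pow2_sqrt; lra).
  exists z. split.
  - destruct (Rlt_le_dec yp z) as [h|[h|h]]; [assumption | |].
    + assert (T := sech2_decr z yp ltac:(lra)). lra.
    + rewrite h in Ez2. lra.
  - destruct (lambda3_of_sign N n k M En EN hk hM z w ltac:(lra) Ez2) as (r & Hr & ->).
    rewrite cubic_sign_poly_eq in Hneg by lra. nra.
Qed.

Hypotheses (dk : k = 1 \/ 2 <= k) (dM : M = 1 \/ 2 <= M) (dkM : M <= k ^ 2 \/ k ^ 2 + 1 <= M).

Lemma crossing_speed_pos (y : R) : 0 <= y ->
  (forall z, 0 < z <= y -> lambda3_of N n z <= 0) ->
  0 < crossing_speed k M (u_of N n y) (1 - tanh y ^ 2).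
Proof.
  intros [Hy| <-] Hneg; [|apply crossing_speed_pos_0].
  destruct (w_of_spec y) as (Hw & Eu & Es).
  rewrite Eu, Es, crossing_speed_of_w by assumption.
  assert (hf := w_factor_pos k M hk hM (w_of y) Hw).
  apply Rmult_lt_0_compat.
  { apply Rdiv_lt_0_compat; repeat apply Rmult_lt_0_compat; lra. }
  match goal with |- 0 < ?a - ?b => destruct (Rlt_le_dec b a) as [h|h]; [lra|exfalso] end.
  assert (hT := tanh_pos y Hy).
  assert (Hs1 : sech2_of_w k M (w_of y) < 1) by (rewrite <- Es; nra).
  destruct (cubic_sign_pos_before_no_crossing k M (w_of y) _ dk dM dkM Hw eq_refl Hs1 h)
    as (w' & Hw' & Hs' & Hpos).
  fold (w_sigma k M) in Hs', Hpos. fold (w_beta k M) in Hs', Hpos. fold (w_kappa k M) in Hpos.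
  change (sech2_of_w k M w' < 1) in Hs'.
  change (0 < cubic_sign (w_kappa k M) (w_beta k M) w' (sech2_of_w k M w')) in Hpos.
  assert (Hle : sech2_of_w k M (w_of y) <= sech2_of_w k M w').
  { destruct Hw' as [h1 [h2| ->]]; [left; apply sech2_of_w_decr; try assumption; lra | lra]. }
  assert (Hs0 := sech2_of_w_pos k M hk hM w' ltac:(lra)).
  (* Since [sech2_of_w] at w' is below 1, w' belongs to an actual state z > 0; and z <= y because w'
     <= [w_of y]. *)
  destruct (tanh_surj (sqrt (1 - sech2_of_w k M w'))) as (z & Hz & Ez).
  { split; [apply sqrt_pos|]. rewrite <- sqrt_1 at 2. apply sqrt_lt_1; lra. }
  assert (Ez2 : 1 - tanh z ^ 2 = sech2_of_w k M w') by (rewrite Ez, pow2_sqrt; lra).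
  assert (Hz0 : 0 < z).
  { destruct Hz as [Hz| <-]; [assumption|]. rewrite tanh_0 in Ez2. lra. }
  assert (Hzy : z <= y).
  { destruct (Rle_lt_dec z y) as [h'|h']; [assumption|].
    assert (T := sech2_decr y z ltac:(lra)). lra. }
  destruct (lambda3_of_sign N n k M En EN hk hM z w' ltac:(lra) Ez2) as (r & Hr & E).
  assert (T := Hneg z (conj Hz0 Hzy)). rewrite E in T. nra.
Qed.

Lemma eps_of_pos (y : R) : 0 < y ->
  (forall z, 0 < z <= y -> lambda3_of N n z <= 0) -> 0 < eps_of N n y.
Proof.
  intros Hy Hneg.
  destruct (MVT_gen (eps_of N n) 0 y (fun y => crossing_speed k M (u_of N n y) (1 - tanh y ^ 2)
     / (2 * (M + k) * crit_poly_du k M (u_of N n y) (1 - tanh y ^ 2)))) as (c & Hc & E).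
  - intros x _. apply (is_derive_eps_of N n k M En EN hk hM x).
  - intros x _. apply continuity_pt_filterlim.
    apply (ex_derive_continuous (eps_of N n)). eexists. apply (is_derive_eps_of N n k M En EN hk hM x).
  - rewrite Rmin_left, Rmax_right in Hc by lra.
    assert (E0 : eps_of N n 0 = 0) by (unfold eps_of; rewrite tanh_0; ring).
    rewrite E0 in E. replace (eps_of N n y) with (eps_of N n y - 0) by ring. rewrite E.
    apply Rmult_lt_0_compat; [|lra]. apply Rdiv_lt_0_compat.
    + apply crossing_speed_pos; [lra|]. intros z Hz. apply Hneg. lra.
    + apply Rmult_lt_0_compat; [lra|]. apply crit_poly_du_pos; try assumption.
      * apply (u_of_pos N n k M En EN hk hM).
      * apply sech2_pos.
Qed.

End Transition.

(** * The equilibrium branch *)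

Section Branch.

Variables (N n : nat) (k M : R).
Hypotheses (En : INR n = k + 1) (EN : INR N = M + 2 * k + 2).
Hypotheses (hk : 1 <= k) (hM : 1 <= M).

Lemma equilibrium_iff (eps u y : R) :
  equilibrium N n eps u y <-> - (M + k) * y + k * u * tanh y + 2 * (M + k) * eps = 0.
Proof.
  unfold equilibrium, reduced_field. rewrite tanh_opp, tanh_0, En, EN. split.
  - intros E. injection E as E1 _ _. etransitivity; [|exact E1]. ring.
  - intros E. apply (f_equal2 pair); [apply (f_equal2 pair)|]; [| |ring].
    + etransitivity; [|exact E]. ring.
    + transitivity (- (- (M + k) * y + k * u * tanh y + 2 * (M + k) * eps)); [ring | rewrite E; ring].
Qed.

(** For fixed eps the equilibrium equation is affine in u, so it is solved as u = V x and the branch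
    is a local inverse of V. The slope of V is positive because k u s < M + k on the critical
    curve. *)
Lemma crossing_branch (y : R) : 0 < y ->
  0 < crossing_speed k M (u_of N n y) (1 - tanh y ^ 2) ->
  exists Y, equilibrium_branch N n (eps_of N n y) (u_of N n y) y Y /\
    at_left (u_of N n y) (fun u => lambda1 N n (Y u) u < 0) /\
    at_right (u_of N n y) (fun u => 0 < lambda1 N n (Y u) u).
Proof.
  intros Hy Hsp.
  set (u0 := u_of N n y) in *. set (eps := eps_of N n y).
  assert (Hu0 : 0 < u0) by apply (u_of_pos N n k M En EN hk hM).
  assert (HG := u_of_subcritical N n k M En EN hk hM y). fold u0 in HG.
  assert (HT := tanh_pos y Hy).
  set (V := fun x => (M + k) * (x - 2 * eps) / (k * tanh x)).
  assert (HVy : V y = u0).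
  { unfold V, eps, eps_of. fold u0. rewrite En, EN. field. repeat split; lra. }
  assert (HVd : forall x, 0 < x -> is_derive V x
    ((M + k - k * V x * (1 - tanh x ^ 2)) / (k * tanh x))).
  { intros x Hx. assert (hT := tanh_pos x Hx).
    assert (hd := is_derive_tanh x). unfold V. clear HVy V HT HG Hsp. generalize dependent tanh. intros th hT hd.
    auto_derive.
    - split; [exists (1 - th x ^ 2); exact hd|]. split; [|exact I]. nra.
    - replace (Derive (fun x => th x) x) with (1 - th x ^ 2) by (symmetry; apply is_derive_unique, hd).
      field. lra. }
  assert (HVpos : locally y (fun x => 0 < x)) by (apply open_gt, Hy).
  assert (HVc : forall x, 0 < x -> continuous V x).
  { intros x Hx. apply (ex_derive_continuous V). eexists. apply HVd, Hx. }
  assert (Hv : 0 < (M + k - k * V y * (1 - tanh y ^ 2)) / (k * tanh y)).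
  { rewrite HVy. apply Rdiv_lt_0_compat; [lra|]. apply Rmult_lt_0_compat; lra. }
  destruct (local_inverse V y _ Hv (HVd y Hy)) as (Y & HY0 & HYc & HYl & HYr & HYl').
  { revert HVpos. apply filter_imp. exact HVc. }
  rewrite HVy in *.
  set (q := fun x => crit_poly k M (V x) (1 - tanh x ^ 2)).
  (* The chain rule with V' = (M + k - k u s) / (k T), s' = - 2 T s and T^2 = 1 - s produces
     [crossing_speed] divided by k T. *)
  assert (Hq : is_derive q y (crossing_speed k M u0 (1 - tanh y ^ 2) / (k * tanh y))).
  { assert (D := is_derive_crit_poly k M V (fun x => 1 - tanh x ^ 2) y _ _ (HVd y Hy) (is_derive_sech2 y)).
    cbv beta in D. rewrite HVy in D.
    match type of D with is_derive _ _ ?l => replace (crossing_speed k M u0 (1 - tanh y ^ 2) / (k * tanh y)) with l end.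
    - exact D.
    - unfold crossing_speed. field. lra. }
  assert (Hq0 : q y = 0) by (unfold q; rewrite HVy; apply (crit_poly_u_of N n k M En EN hk hM)).
  assert (Hl : 0 < crossing_speed k M u0 (1 - tanh y ^ 2) / (k * tanh y))
    by (apply Rdiv_lt_0_compat; [exact Hsp | apply Rmult_lt_0_compat; lra]).
  destruct (one_sided_sign_of_derive q y _ Hl Hq Hq0) as [Hqr Hql].
  assert (HGl : locally y (fun x => 0 < V x /\ k * V x * (1 - tanh x ^ 2) < M + k)).
  { apply filter_and.
    - apply (HVc y Hy (fun v => 0 < v)). apply open_gt. rewrite HVy. exact Hu0.
    - assert (C : continuous (fun x => k * V x * (1 - tanh x ^ 2)) y).
      { apply (continuous_mult (fun x => k * V x) (fun x => 1 - tanh x ^ 2)).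
        - apply (continuous_mult (fun _ => k) V); [apply continuous_const | apply HVc, Hy].
        - apply (ex_derive_continuous (fun x => 1 - tanh x ^ 2)), ex_derive_sech2. }
      apply (C (fun v => v < M + k)). apply open_lt. rewrite HVy. exact HG. }
  assert (Hl1 : forall x, 0 < V x /\ k * V x * (1 - tanh x ^ 2) < M + k ->
    lambda1 N n x (V x) = q x / (M + k - k * V x * (1 - tanh x ^ 2))).
  { intros x [h1 h2]. apply (lambda1_formula N n k M En EN hk hM); lra. }
  exists Y. split; [|split].
  - split; [assumption|]. split; [assumption|].
    assert (HYp : locally u0 (fun u => 0 < Y u)).
    { apply (HYc (fun x => 0 < x)). apply open_gt. rewrite HY0. exact Hy. }
    generalize (filter_and _ _ HYl HYp). apply filter_imp. intros u [h1 h2].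
    apply equilibrium_iff. rewrite <- h1 at 2. unfold V.
    assert (hT := tanh_pos _ h2). field. lra.
  - assert (H1 : at_left y (fun x => lambda1 N n x (V x) < 0)).
    { assert (HGl' : at_left y (fun x => 0 < V x /\ k * V x * (1 - tanh x ^ 2) < M + k))
        by (apply filter_le_within, HGl).
      generalize (filter_and _ _ Hql HGl'). apply filter_imp. intros x [h1 h2]. rewrite (Hl1 x h2).
      assert (h := Rdiv_lt_0_compat (- q x) (M + k - k * V x * (1 - tanh x ^ 2)) ltac:(lra) ltac:(lra)).
      unfold Rdiv in *. lra. }
    apply HYl' in H1. unfold filtermap in H1.
    assert (HYl2 : at_left u0 (fun u => V (Y u) = u)) by (apply filter_le_within, HYl).
    generalize (filter_and _ _ H1 HYl2). apply filter_imp. intros u [h1 h2]. rewrite h2 in h1. exact h1.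
  - assert (H1 : at_right y (fun x => 0 < lambda1 N n x (V x))).
    { assert (HGl' : at_right y (fun x => 0 < V x /\ k * V x * (1 - tanh x ^ 2) < M + k))
        by (apply filter_le_within, HGl).
      generalize (filter_and _ _ Hqr HGl'). apply filter_imp. intros x [h1 h2]. rewrite (Hl1 x h2).
      apply Rdiv_lt_0_compat; lra. }
    apply HYr in H1. unfold filtermap in H1.
    assert (HYl2 : at_right u0 (fun u => V (Y u) = u)) by (apply filter_le_within, HYl).
    generalize (filter_and _ _ H1 HYl2). apply filter_imp. intros u [h1 h2]. rewrite h2 in h1. exact h1.
Qed.

End Branch.

(** * Comparison for the cooperative network *)

Lemma filter_forall_lt {T : Type} (F : (T -> Prop) -> Prop) {FF : Filter F}
  (P : nat -> T -> Prop) (N : nat) :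
  (forall i, (i < N)%nat -> F (P i)) -> F (fun x => forall i, (i < N)%nat -> P i x).
Proof.
  induction N as [|N IH]; intros H.
  - apply filter_forall. intros x i Hi. lia.
  - assert (h1 : F (fun x => forall i, (i < N)%nat -> P i x)) by (apply IH; intros i Hi; apply H; lia).
    assert (h2 : F (P N)) by (apply H; lia).
    generalize (filter_and _ _ h1 h2). apply filter_imp. clear h1 h2.
    intros x [h1 h2] i Hi. destruct (Nat.eq_dec i N) as [->|h]; [assumption | apply h1; lia].
Qed.

(* A component cannot be increasing at the first time it vanishes. *)
Lemma positive_until_first_zero (N : nat) (g : nat -> R -> R) (t1 t2 : R) :
  t1 <= t2 ->
  (forall i t, (i < N)%nat -> t1 <= t <= t2 -> continuous (g i) t) ->
  (forall i, (i < N)%nat -> 0 < g i t1) ->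
  (forall t i, t1 < t <= t2 -> (i < N)%nat -> (forall j, (j < N)%nat -> 0 <= g j t) ->
     g i t = 0 -> exists l, 0 < l /\ is_derive (g i) t l) ->
  forall t i, t1 <= t <= t2 -> (i < N)%nat -> 0 < g i t.
Proof.
  intros Ht Hc H1 Hd.
  set (E := fun t => t1 <= t <= t2 /\ forall s i, t1 <= s <= t -> (i < N)%nat -> 0 < g i s).
  assert (E1 : E t1).
  { split; [lra|]. intros s i Hs Hi. replace s with t1 by lra. apply H1, Hi. }
  destruct (completeness E) as [tau [Hub Hlub]].
  { exists t2. intros t [h _]. lra. }
  { exists t1. exact E1. }
  assert (Ht1 : t1 <= tau) by (apply Hub, E1).
  assert (Ht2 : tau <= t2) by (apply Hlub; intros t [h _]; lra).
  assert (Hlt : forall s i, t1 <= s < tau -> (i < N)%nat -> 0 < g i s).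
  { intros s i Hs Hi. destruct (Rlt_dec 0 (g i s)) as [h|h]; [assumption|].
    assert (tau <= s); [|lra]. apply Hlub. intros t [h1 h2].
    destruct (Rle_lt_dec t s) as [h3|h3]; [assumption|]. exfalso. apply h, h2; [lra|assumption]. }
  assert (Hge : forall i, (i < N)%nat -> 0 <= g i tau).
  { intros i Hi. destruct (Rle_lt_dec 0 (g i tau)) as [h|h]; [assumption|exfalso].
    destruct (Hc i tau Hi (conj Ht1 Ht2) (fun y => y < 0)) as [d Hd']; [apply open_lt, h|].
    destruct (Req_dec t1 tau) as [e|e].
    - specialize (H1 i Hi). rewrite e in H1. lra.
    - set (s := Rmax t1 (tau - d / 2)).
      assert (t1 <= s < tau).
      { unfold s. split; [apply Rmax_l|]. apply Rmax_lub_lt; [lra|]. destruct d as [d pd]; simpl; lra. }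
      assert (g i s < 0).
      { apply Hd'. change (Rabs (s - tau) < d). destruct d as [d pd]; simpl in *.
        assert (tau - d/2 <= s) by apply Rmax_r. rewrite Rabs_left; lra. }
      specialize (Hlt s i ltac:(assumption) Hi). lra. }
  assert (Hpos : forall i, (i < N)%nat -> 0 < g i tau).
  { intros i Hi. destruct (Hge i Hi) as [h|h]; [assumption|exfalso].
    destruct (Req_dec t1 tau) as [e|e].
    - specialize (H1 i Hi). rewrite e in H1. lra.
    - destruct (Hd tau i ltac:(lra) Hi Hge (eq_sym h)) as [l [Hl Hder]].
      apply is_derive_Reals in Hder. destruct (Hder l Hl) as [d Hd'].
      set (k := Rmin (d / 2) (tau - t1)).
      assert (0 < k) by (unfold k; apply Rmin_pos; [destruct d; simpl|]; lra).
      assert (k <= d / 2) by apply Rmin_l. assert (k <= tau - t1) by apply Rmin_r.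
      specialize (Hd' (- k) ltac:(apply Rlt_not_eq; lra)).
      rewrite Rabs_Ropp, Rabs_pos_eq in Hd' by lra.
      assert (k < d) by (destruct d; simpl in *; lra).
      specialize (Hd' ltac:(assumption)). apply Rabs_def2 in Hd'. rewrite <- h in Hd'.
      assert (Hs := Hlt (tau + - k) i ltac:(lra) Hi).
      assert ((g i (tau + - k) - 0) / - k <= 0).
      { replace ((g i (tau + - k) - 0) / - k) with (- (g i (tau + - k) / k)) by (field; lra).
        assert (0 < g i (tau + - k) / k) by (apply Rdiv_lt_0_compat; lra). lra. }
      lra. }
  assert (Hall : forall s i, t1 <= s <= tau -> (i < N)%nat -> 0 < g i s).
  { intros s i Hs Hi. destruct (Req_dec s tau) as [->|e]; [apply Hpos, Hi | apply Hlt; [lra|assumption]]. }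
  destruct (Req_dec tau t2) as [<-|e].
  { intros t i h Hi. apply Hall; assumption. }
  exfalso.
  assert (Hloc : locally tau (fun t => forall i, (i < N)%nat -> 0 < g i t)).
  { apply filter_forall_lt; [apply locally_filter|]. intros i Hi.
    apply (Hc i tau Hi (conj Ht1 Ht2) (fun y => 0 < y)). apply open_gt, Hpos, Hi. }
  destruct Hloc as [d Hdl].
  set (s := Rmin t2 (tau + d / 2)).
  assert (tau < s) by (unfold s; apply Rmin_glb_lt; [|destruct d; simpl]; lra).
  assert (s <= t2) by apply Rmin_l. assert (s <= tau + d / 2) by apply Rmin_r.
  assert (E s).
  { split; [lra|]. intros r i Hr Hi. destruct (Rle_lt_dec r tau) as [h|h]; [apply Hall; [lra|assumption]|].
    apply Hdl; [|assumption]. change (Rabs (r - tau) < d).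
    rewrite Rabs_pos_eq by lra. destruct d; simpl in *; lra. }
  specialize (Hub s ltac:(assumption)). lra.
Qed.

(** * Sums over agents, adjacency and degrees *)

Lemma sum_n_m_le_loc (a b : nat -> R) (n m : nat) :
  (forall k, (n <= k <= m)%nat -> a k <= b k) -> sum_n_m a n m <= sum_n_m b n m.
Proof.
  intros H.
  (* [sum_n_m_le] asks for the inequality at every index; the maximum provides it without changing
     the sum over the range. *)
  rewrite (sum_n_m_ext_loc b (fun k => Rmax (a k) (b k))).
  - apply sum_n_m_le. intros k. apply Rmax_l.
  - intros k Hk. symmetry. apply Rmax_right, H, Hk.
Qed.

Lemma sum_n_m_pos_loc (a : nat -> R) (n m j : nat) :
  (forall k, (n <= k <= m)%nat -> 0 <= a k) -> (n <= j <= m)%nat -> 0 < a j ->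
  0 < sum_n_m a n m.
Proof.
  intros H Hj Ha.
  apply Rlt_le_trans with (sum_n_m (fun k => if Nat.eqb k j then a j else 0) n m).
  - rewrite (sum_n_m_Chasles _ n j m) by lia.
    rewrite (sum_n_m_ext_loc _ (fun _ => 0) (S j) m).
    2: { intros k Hk. replace (k =? j)%nat with false; [reflexivity|]. symmetry. apply Nat.eqb_neq. lia. }
    destruct j as [|j].
    + replace n with 0%nat by lia. rewrite sum_n_n, sum_n_m_const, Nat.eqb_refl.
      change (0 < a 0%nat + INR (S m - 1) * 0). lra.
    + rewrite sum_n_Sm by lia.
      rewrite (sum_n_m_ext_loc _ (fun _ => 0) n j).
      2: { intros k Hk. replace (k =? S j)%nat with false; [reflexivity|]. symmetry. apply Nat.eqb_neq. lia. }
      rewrite Nat.eqb_refl, !sum_n_m_const.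
      change (0 < INR (S j - n) * 0 + a (S j) + INR (S m - S (S j)) * 0). lra.
  - apply sum_n_m_le_loc. intros k Hk. destruct (Nat.eqb_spec k j) as [->|e]; [lra | apply H, Hk].
Qed.

Lemma sum_n_m_nonneg_loc (a : nat -> R) (n m : nat) :
  (forall k, (n <= k <= m)%nat -> 0 <= a k) -> 0 <= sum_n_m a n m.
Proof.
  intros H. apply Rle_trans with (sum_n_m (fun _ => 0) n m).
  - rewrite sum_n_m_const. lra.
  - apply sum_n_m_le_loc, H.
Qed.

Lemma sum_n_m_lin (a b : nat -> R) (c : R) (n m : nat) :
  sum_n_m a n m + c * sum_n_m b n m = sum_n_m (fun j => a j + c * b j) n m.
Proof.
  symmetry. etransitivity; [apply (sum_n_m_plus a (fun j => c * b j))|].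
  apply (f_equal (Rplus (sum_n_m a n m))). apply (sum_n_m_mult_l (K := R_Ring) c b).
Qed.

Lemma adjacency_bounds (n i j : nat) : 0 <= adjacency n i j <= 1.
Proof. unfold adjacency. destruct (_ && _); lra. Qed.

Lemma cluster_of_hub (n : nat) : cluster_of n (2 * n) = Neutral.
Proof.
  unfold cluster_of. destruct (Nat.ltb_spec (2 * n) n) as [h|h]; [lia|].
  destruct (Nat.ltb_spec (2 * n) (2 * n)) as [h'|h']; [lia | reflexivity].
Qed.

Lemma adjacency_hub_l (n j : nat) : j <> (2 * n)%nat -> adjacency n (2 * n) j = 1.
Proof.
  intros H. unfold adjacency. rewrite cluster_of_hub.
  destruct (Nat.eqb_spec (2 * n) j) as [h|h]; [lia|]. destruct (cluster_of n j); reflexivity.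
Qed.

Lemma adjacency_hub_r (n j : nat) : j <> (2 * n)%nat -> adjacency n j (2 * n) = 1.
Proof.
  intros H. unfold adjacency. rewrite cluster_of_hub.
  destruct (Nat.eqb_spec j (2 * n)) as [h|h]; [lia|]. destruct (cluster_of n j); reflexivity.
Qed.

Lemma degree_bounds (N n i : nat) : (0 < N)%nat -> 0 <= degree N n i <= INR N.
Proof.
  intros HN. unfold degree. split.
  - apply sum_n_m_nonneg_loc. intros k _. apply adjacency_bounds.
  - apply Rle_trans with (sum_n_m (fun _ => 1) 0 (N - 1)).
    + apply sum_n_m_le. intros k. apply adjacency_bounds.
    + rewrite sum_n_m_const. replace (S (N - 1) - 0)%nat with N by lia. lra.
Qed.

(** A trajectory has only a right limit at time 0. Freezing it at negative times gives two-sided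
    continuity, as the first-zero argument requires on an interval starting at 0. *)
Lemma continuous_clamp (f : R -> R) : filterlim f (at_right 0) (locally (f 0)) ->
  (forall t, 0 < t -> ex_derive f t) -> forall t, continuous (fun t => f (Rmax t 0)) t.
Proof.
  intros H0 Hd t. destruct (Rtotal_order t 0) as [h|[->|h]].
  - apply continuous_ext_loc with (fun _ => f 0); [|apply continuous_const].
    apply filter_imp with (fun s => s < 0); [|apply open_lt, h].
    intros s Hs. rewrite Rmax_right; [reflexivity|lra].
  - intros P HP. rewrite Rmax_left in HP by lra. specialize (H0 P HP).
    destruct H0 as [d Hd0]. exists d. intros s Hs.
    destruct (Rle_lt_dec s 0) as [h|h].
    + rewrite Rmax_right by lra. exact (locally_singleton _ _ HP).
    + rewrite Rmax_left by lra. apply Hd0; assumption.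
  - apply continuous_ext_loc with f; [|apply (ex_derive_continuous f), Hd, h].
    apply filter_imp with (fun s => 0 < s); [|apply open_gt, h].
    intros s Hs. rewrite Rmax_left; [reflexivity|lra].
Qed.

(** * Barriers and spreading of excess in the N-agent network *)

Section Cooperative.

Variables (N n : nat) (eps u : R).
Hypotheses (hN : (2 * n < N)%nat) (hu : 0 < u).

Local Notation field := (network_field N n eps u).

(** The Kamke condition: when coordinate i agrees, only the coupling terms differ, and these are
    increasing in every other coordinate. *)
Lemma network_field_incr (z x : nat -> R) (i : nat) :
  (forall j, (j < N)%nat -> z j <= x j) -> z i = x i -> field z i <= field x i.
Proof.
  intros H E. unfold network_field. rewrite E.
  apply Rplus_le_compat_r, Rplus_le_compat_l, sum_n_m_le_loc.
  intros k Hk. apply Rmult_le_compat_l; [apply adjacency_bounds|].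
  apply Rmult_le_compat_l; [lra|]. apply tanh_le, H. lia.
Qed.

(* Constant extension to negative times makes every component continuous on R. *)
Variable x : nat -> R -> R.
Hypothesis x_cont : forall i t, (i < N)%nat -> continuous (x i) t.
Hypothesis x_der : forall i t, (i < N)%nat -> 0 < t ->
  is_derive (x i) t (field (fun j => x j t) i).

(** At a first contact in coordinate j, x j - b j vanishes while the other gaps are nonnegative; the
    Kamke condition and the strict inequality on b' then give it a positive derivative. *)
Lemma stays_above_strict_barrier (b b' : nat -> R -> R) (t1 t2 : R) :
  0 <= t1 <= t2 ->
  (forall i t, (i < N)%nat -> is_derive (b i) t (b' i t)) ->
  (forall i t, (i < N)%nat -> t1 < t <= t2 -> b' i t < field (fun j => b j t) i) ->
  (forall i, (i < N)%nat -> b i t1 < x i t1) ->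
  forall i t, (i < N)%nat -> t1 <= t <= t2 -> b i t < x i t.
Proof.
  intros Ht Hb Hlt H1 i t Hi Hti.
  assert (0 < x i t - b i t); [|lra].
  apply (positive_until_first_zero N (fun i t => x i t - b i t) t1 t2); try assumption; [lra| | |].
  - intros j s Hj Hs. apply (continuous_minus (x j) (b j)); [apply x_cont, Hj|].
    apply (ex_derive_continuous (b j)). exists (b' j s). apply Hb, Hj.
  - intros j Hj. specialize (H1 j Hj). lra.
  - intros s j Hs Hj Hall E.
    exists (field (fun j => x j s) j - b' j s). split.
    + assert (field (fun j => b j s) j <= field (fun j => x j s) j).
      { apply network_field_incr; [|simpl; lra]. intros l Hl. specialize (Hall l Hl). simpl. lra. }
      specialize (Hlt j s Hj ltac:(lra)). lra.
    + apply (is_derive_minus (x j) (b j)); [apply x_der; [assumption|lra] | apply Hb, Hj].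
Qed.

Variable e : nat -> R.
Hypothesis e_eq : forall i, (i < N)%nat -> field e i = 0.

Lemma stays_above_equilibrium : (forall i, (i < N)%nat -> e i <= x i 0) ->
  forall i t, (i < N)%nat -> 0 <= t -> e i <= x i t.
Proof.
  intros H0 i t Hi Ht. apply le_epsilon. intros eta Heta.
  (* The barrier is e - d exp(K t). Lowering e by an amount costs the field at most N u times that
     amount, as tanh is 1-Lipschitz; the extra 1 in K makes the barrier strict. The choice of d
     makes the final gap equal to eta. *)
  set (K := INR N * u + 1). set (d := eta / exp (K * t)).
  assert (Hd : 0 < d) by (apply Rdiv_lt_0_compat; [assumption | apply exp_pos]).
  assert (H : e i - d * exp (K * t) < x i t).
  { apply (stays_above_strict_barrier (fun i t => e i - d * exp (K * t))
      (fun i t => - (d * (K * exp (K * t)))) 0 t); try assumption; [lra | | | | lra].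
    - intros j s Hj. auto_derive; [exact I | ring].
    - intros j s Hj Hs. set (E := exp (K * s)). assert (HE : 0 < d * E) by (apply Rmult_lt_0_compat; [assumption|apply exp_pos]).
      assert (Hdeg := degree_bounds N n j ltac:(lia)).
      apply Rlt_le_trans with (field e j - u * degree N n j * (d * E)).
      + rewrite e_eq by assumption.
        assert (u * degree N n j <= u * INR N) by (apply Rmult_le_compat_l; lra).
        unfold K. nra.
      + unfold network_field.
        assert (Hs1 : sum_n_m (fun l => adjacency n j l * (u * tanh (e l))) 0 (N - 1) - u * degree N n j * (d * E)
          <= sum_n_m (fun l => adjacency n j l * (u * tanh (e l - d * E))) 0 (N - 1)).
        { unfold degree.
          replace (_ - _) with (sum_n_m (fun l => adjacency n j l * (u * tanh (e l))) 0 (N - 1)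
            + (- (u * (d * E))) * sum_n_m (fun l => adjacency n j l) 0 (N - 1)) by ring.
          rewrite sum_n_m_lin. apply sum_n_m_le. intros l.
          assert (T := tanh_lipschitz (e l - d * E) (e l) ltac:(lra)).
          assert (Ha := adjacency_bounds n j l).
          assert (0 <= adjacency n j l * (u * (tanh (e l - d * E) - tanh (e l) + d * E))); [|lra].
          apply Rmult_le_pos; [lra|]. apply Rmult_le_pos; lra. }
        assert (0 <= degree N n j * (d * E)) by (apply Rmult_le_pos; lra).
        lra.
    - intros j Hj. rewrite Rmult_0_r, exp_0. specialize (H0 j Hj). lra. }
  unfold d in H. replace (eta / exp (K * t) * exp (K * t)) with eta in H.
  - lra.
  - field. apply Rgt_not_eq, exp_pos.
Qed.

Hypothesis x_ge : forall i t, (i < N)%nat -> 0 <= t -> e i <= x i t.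

(** The integrating factor exp(d t), with d the degree, removes the linear decay, so the weighted
    excess is driven by the nonnegative coupling alone. *)
Lemma excess_growth (i : nat) (t1 t2 : R) : (i < N)%nat -> 0 <= t1 < t2 ->
  exists c, t1 <= c <= t2 /\
    (x i t2 - e i) * exp (degree N n i * t2) - (x i t1 - e i) * exp (degree N n i * t1)
    = exp (degree N n i * c)
      * sum_n_m (fun j => adjacency n i j * (u * (tanh (x j c) - tanh (e j)))) 0 (N - 1)
      * (t2 - t1).
Proof.
  intros Hi Ht. set (d := degree N n i).
  destruct (MVT_gen (fun t => (x i t - e i) * exp (d * t)) t1 t2 (fun c => exp (d * c)
      * sum_n_m (fun j => adjacency n i j * (u * (tanh (x j c) - tanh (e j)))) 0 (N - 1)))
    as [c [Hc E]].
  - intros t. rewrite Rmin_left, Rmax_right by lra. intros Hlt.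
    assert (S : field (fun j => x j t) i + d * (x i t - e i)
      = sum_n_m (fun j => adjacency n i j * (u * (tanh (x j t) - tanh (e j)))) 0 (N - 1)).
    { transitivity (field (fun j => x j t) i - field e i + d * (x i t - e i));
        [rewrite e_eq by assumption; ring|].
      unfold network_field. fold d.
      replace (_ - _ + _) with (sum_n_m (fun j => adjacency n i j * (u * tanh (x j t))) 0 (N - 1)
        + (-1) * sum_n_m (fun j => adjacency n i j * (u * tanh (e j))) 0 (N - 1)) by ring.
      rewrite sum_n_m_lin. apply sum_n_m_ext. intros j. apply Rminus_diag_uniq. ring. }
    rewrite <- S.
    assert (Hx := x_der i t Hi ltac:(lra)).
    set (F := field (fun j => x j t) i) in *.
    assert (D1 := is_derive_minus (x i) (fun _ => e i) t F 0 Hx (is_derive_const (e i) t)).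
    assert (D2 : is_derive (fun t => exp (d * t)) t (d * exp (d * t))) by (auto_derive; [exact I | ring]).
    assert (D := is_derive_mult _ _ _ _ _ D1 D2 Rmult_comm).
    replace (exp (d * t) * (F + d * (x i t - e i))) with
      ((F - 0) * exp (d * t) + (x i t - e i) * (d * exp (d * t))) by ring.
    exact D.
  - intros t _. apply continuity_pt_filterlim.
    apply (continuous_mult (fun t => x i t - e i) (fun t => exp (d * t))).
    + apply (continuous_minus (x i) (fun _ => e i)); [apply x_cont, Hi | apply continuous_const].
    + apply (ex_derive_continuous (fun t => exp (d * t))). auto_derive. exact I.
  - rewrite Rmin_left, Rmax_right in Hc by lra. exists c. split; assumption.
Qed.

Lemma coupling_nonneg (i j : nat) (c : R) : (j < N)%nat -> 0 <= c ->
  0 <= adjacency n i j * (u * (tanh (x j c) - tanh (e j))).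
Proof.
  intros Hj Hc. apply Rmult_le_pos; [apply adjacency_bounds|].
  apply Rmult_le_pos; [lra|]. assert (h := tanh_le _ _ (x_ge j c Hj Hc)). lra.
Qed.

Lemma excess_persists (i : nat) (t1 t2 : R) : (i < N)%nat -> 0 <= t1 <= t2 ->
  e i < x i t1 -> e i < x i t2.
Proof.
  intros Hi [Ht [Hlt| <-]] H; [|assumption].
  destruct (excess_growth i t1 t2 Hi (conj Ht Hlt)) as [c [Hc E]].
  assert (0 <= sum_n_m (fun j => adjacency n i j * (u * (tanh (x j c) - tanh (e j)))) 0 (N - 1)).
  { apply sum_n_m_nonneg_loc. intros j Hj. apply coupling_nonneg; [lia | lra]. }
  assert (h1 := exp_pos (degree N n i * c)). assert (h2 := exp_pos (degree N n i * t1)).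
  assert (h3 := exp_pos (degree N n i * t2)).
  set (S := sum_n_m _ _ _) in *.
  assert (0 <= exp (degree N n i * c) * S * (t2 - t1)) by (apply Rmult_le_pos; [apply Rmult_le_pos|]; lra).
  assert (0 < (x i t1 - e i) * exp (degree N n i * t1)) by (apply Rmult_lt_0_compat; lra).
  destruct (Rlt_dec (e i) (x i t2)) as [h|h]; [assumption|exfalso].
  assert ((x i t2 - e i) * exp (degree N n i * t2) <= 0) by nra. lra.
Qed.

Lemma excess_spreads (i j : nat) : (i < N)%nat -> (j < N)%nat -> adjacency n i j = 1 ->
  (forall t, 0 < t -> e j < x j t) -> forall t, 0 < t -> e i < x i t.
Proof.
  intros Hi Hj Ha Hpos t Ht.
  (* Starting from t / 2 keeps the intermediate time c positive, where neighbour j is strictly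
     above. *)
  destruct (excess_growth i (t / 2) t Hi ltac:(lra)) as [c [Hc E]].
  assert (0 < sum_n_m (fun j => adjacency n i j * (u * (tanh (x j c) - tanh (e j)))) 0 (N - 1)).
  { apply sum_n_m_pos_loc with j; [| lia |].
    - intros l Hl. apply coupling_nonneg; [lia | lra].
    - rewrite Ha. assert (h := tanh_incr _ _ (Hpos c ltac:(lra))). nra. }
  assert (h1 := exp_pos (degree N n i * c)). assert (h2 := exp_pos (degree N n i * (t / 2))).
  assert (h3 := exp_pos (degree N n i * t)).
  set (S := sum_n_m _ _ _) in *.
  assert (0 < exp (degree N n i * c) * S * (t - t / 2)) by (apply Rmult_lt_0_compat; [apply Rmult_lt_0_compat|]; lra).
  assert (0 <= (x i (t / 2) - e i) * exp (degree N n i * (t / 2))).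
  { assert (h := x_ge i (t / 2) Hi ltac:(lra)). apply Rmult_le_pos; lra. }
  destruct (Rlt_dec (e i) (x i t)) as [h|h]; [assumption|exfalso].
  assert ((x i t - e i) * exp (degree N n i * t) <= 0) by nra. lra.
Qed.

(* Agent 2n is linked to every other agent, so two steps suffice. *)
Lemma excess_everywhere (i0 : nat) : (i0 < N)%nat -> e i0 < x i0 0 ->
  forall i t, (i < N)%nat -> 0 < t -> e i < x i t.
Proof.
  intros Hi0 H0.
  assert (Hhub : forall t, 0 < t -> e (2 * n)%nat < x (2 * n)%nat t).
  { assert (Hi : forall t, 0 < t -> e i0 < x i0 t)
      by (intros t Ht; apply excess_persists with 0; [assumption | lra | assumption]).
    destruct (Nat.eq_dec i0 (2 * n)) as [<-|h]; [assumption|].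
    apply excess_spreads with i0; try assumption. apply adjacency_hub_l, h. }
  intros i t Hi Ht. destruct (Nat.eq_dec i (2 * n)) as [->|h]; [apply Hhub, Ht|].
  apply excess_spreads with (2 * n)%nat; try assumption. apply adjacency_hub_r, h.
Qed.

(* A barrier climbing slowly along the curve [z] pushes the trajectory up to [z th0]. *)
Lemma climbs_subequilibria (z z' : nat -> R -> R) (th0 L c0 : R) :
  0 < th0 -> 0 < L -> 0 < c0 ->
  (forall i th, (i < N)%nat -> is_derive (z i) th (z' i th)) ->
  (forall i th, (i < N)%nat -> 0 <= th <= th0 -> z' i th <= L) ->
  (forall i, (i < N)%nat -> z i 0 = e i) ->
  (forall i th, (i < N)%nat -> 0 < th <= th0 -> c0 * th ^ 3 <= field (fun j => z j th) i) ->
  (exists i0, (i0 < N)%nat /\ e i0 < x i0 0) ->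
  exists T, forall i t, (i < N)%nat -> T <= t -> z i th0 < x i t.
Proof.
  intros Hth HL Hc0 Hz HzL Hz0 Hf [i0 [Hi0 Hx0]].
  assert (Hstart : at_right 0 (fun th => forall i, (i < N)%nat -> z i th < x i 1)).
  { apply filter_le_within, filter_forall_lt; [apply locally_filter|]. intros i Hi.
    assert (C : continuous (z i) 0) by (apply (ex_derive_continuous (z i)); exists (z' i 0); apply Hz, Hi).
    apply (C (fun y => y < x i 1)), open_lt. rewrite Hz0 by assumption.
    apply (excess_everywhere i0); [assumption .. | lra]. }
  destruct Hstart as [d Hd].
  set (th1 := Rmin (d / 2) (th0 / 2)).
  assert (0 < th1) by (apply Rmin_pos; [destruct d; simpl|]; lra).
  assert (th1 <= d / 2) by apply Rmin_l. assert (th1 <= th0 / 2) by apply Rmin_r.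
  assert (Hth1 : forall i, (i < N)%nat -> z i th1 < x i 1).
  { intros i Hi. apply Hd; try assumption. change (Rabs (th1 - 0) < d).
    rewrite Rminus_0_r, Rabs_pos_eq by lra. destruct d; simpl in *; lra. }
  (* At this rate the barrier moves with velocity at most c0 th1^3 / 2, half of the lower bound of
     the field for th >= th1. *)
  set (r := c0 * th1 ^ 3 / (2 * L)).
  assert (Hc1 : 0 < c0 * th1 ^ 3) by (apply Rmult_lt_0_compat; [|apply pow_lt]; assumption).
  assert (Hr : 0 < r) by (apply Rdiv_lt_0_compat; lra).
  set (T := 1 + (th0 - th1) / r).
  assert (0 < (th0 - th1) / r) by (apply Rdiv_lt_0_compat; lra).
  assert (HT : forall i, (i < N)%nat -> z i th0 < x i T).
  { intros i Hi. replace th0 with (th1 + r * (T - 1)) by (unfold T; field; lra).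
    apply (stays_above_strict_barrier (fun i t => z i (th1 + r * (t - 1)))
      (fun i t => r * z' i (th1 + r * (t - 1))) 1 T); try assumption; [unfold T; lra | | | | unfold T; lra].
    - intros j t Hj. apply (is_derive_comp (z j) (fun t => th1 + r * (t - 1))); [apply Hz, Hj|].
      auto_derive; [exact I | ring].
    - intros j t Hj Ht.
      assert (Hrt : r * (t - 1) <= th0 - th1).
      { apply Rle_trans with (r * (T - 1)); [apply Rmult_le_compat_l; lra|]. unfold T. right. field. lra. }
      assert (0 < r * (t - 1)) by (apply Rmult_lt_0_compat; lra).
      set (th := th1 + r * (t - 1)) in *.
      assert (c0 * th1 ^ 3 <= c0 * th ^ 3).
      { apply Rmult_le_compat_l; [lra|]. apply pow_incr. unfold th; lra. }
      specialize (Hf j th Hj ltac:(unfold th; lra)). specialize (HzL j th Hj ltac:(unfold th; lra)).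
      assert (r * z' j th <= r * L) by (apply Rmult_le_compat_l; lra).
      assert (r * L = c0 * th1 ^ 3 / 2) by (unfold r; field; lra). lra.
    - intros j Hj. replace (th1 + r * (1 - 1)) with th1 by ring. apply Hth1, Hj. }
  (* Afterwards the constant state z th0 is itself a strict barrier, since the field there is at
     least c0 th0^3, so the trajectory never falls back. *)
  exists T. intros i t Hi Ht.
  apply (stays_above_strict_barrier (fun i _ => z i th0) (fun _ _ => 0) T t); try assumption;
    [unfold T in *; lra | | | lra].
  - intros j s Hj. apply (is_derive_const (z j th0)).
  - intros j s Hj Hs. apply Rlt_le_trans with (2 := Hf j th0 Hj ltac:(lra)).
    apply Rmult_lt_0_compat; [|apply pow_lt]; assumption.
Qed.

End Cooperative.

(** * Synchronized states and the reduction to three clusters *)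

Section Synchronized.

Variables (N n : nat).
Hypotheses (hn : (1 <= n)%nat) (hN : (2 * n < N)%nat).

Lemma cluster_of_high (j : nat) : (j < n)%nat -> cluster_of n j = High.
Proof. intros H. unfold cluster_of. apply Nat.ltb_lt in H. rewrite H. reflexivity. Qed.

Lemma cluster_of_low (j : nat) : (n <= j < 2 * n)%nat -> cluster_of n j = Low.
Proof.
  intros [H1 H2]. unfold cluster_of. apply Nat.ltb_ge in H1. apply Nat.ltb_lt in H2.
  rewrite H1, H2. reflexivity.
Qed.

Lemma cluster_of_neutral (j : nat) : (2 * n <= j)%nat -> cluster_of n j = Neutral.
Proof.
  intros H. unfold cluster_of. assert (H1 : (n <= j)%nat) by lia.
  apply Nat.ltb_ge in H. apply Nat.ltb_ge in H1. rewrite H1, H. reflexivity.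
Qed.

Lemma sum_n_m_split3 (a : nat -> R) :
  sum_n_m a 0 (N - 1) = sum_n_m a 0 (n - 1) + sum_n_m a n (2 * n - 1) + sum_n_m a (2 * n) (N - 1).
Proof.
  rewrite (sum_n_m_Chasles a 0 (2 * n - 1) (N - 1)) by lia.
  rewrite (sum_n_m_Chasles a 0 (n - 1) (2 * n - 1)) by lia.
  replace (S (n - 1)) with n by lia. replace (S (2 * n - 1)) with (2 * n)%nat by lia.
  reflexivity.
Qed.

Lemma cluster_sum (psi : cluster -> R) :
  sum_n_m (fun j => psi (cluster_of n j)) 0 (N - 1)
  = n * psi High + n * psi Low + (N - 2 * n) * psi Neutral.
Proof.
  rewrite sum_n_m_split3.
  rewrite (sum_n_m_ext_loc _ (fun _ => psi High) 0 (n - 1))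
    by (intros j Hj; rewrite cluster_of_high by lia; reflexivity).
  rewrite (sum_n_m_ext_loc _ (fun _ => psi Low) n (2 * n - 1))
    by (intros j Hj; rewrite cluster_of_low by lia; reflexivity).
  rewrite (sum_n_m_ext_loc _ (fun _ => psi Neutral) (2 * n) (N - 1))
    by (intros j Hj; rewrite cluster_of_neutral by lia; reflexivity).
  rewrite !sum_n_m_const.
  replace (S (n - 1) - 0)%nat with n by lia.
  replace (S (2 * n - 1) - n)%nat with n by lia.
  replace (S (N - 1) - 2 * n)%nat with (N - 2 * n)%nat by lia.
  rewrite minus_INR, mult_INR by lia. simpl (INR 2). apply Rminus_diag_uniq. ring.
Qed.

Lemma diagonal_sum (a : nat -> R) (i : nat) : (i < N)%nat ->
  sum_n_m (fun j => if (i =? j)%nat then a j else 0) 0 (N - 1) = a i.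
Proof.
  intros Hi. rewrite (sum_n_m_Chasles _ 0 i (N - 1)) by lia.
  rewrite (sum_n_m_ext_loc _ (fun _ => 0) (S i) (N - 1)).
  2: { intros j Hj. replace (i =? j)%nat with false; [reflexivity|]. symmetry. apply Nat.eqb_neq. lia. }
  rewrite sum_n_m_const, Rmult_0_r.
  destruct i as [|i].
  - rewrite sum_n_n. simpl. apply Rplus_0_r.
  - rewrite sum_n_Sm by lia.
    rewrite (sum_n_m_ext_loc _ (fun _ => 0) 0 i).
    2: { intros j Hj. replace (S i =? j)%nat with false; [reflexivity|]. symmetry. apply Nat.eqb_neq. lia. }
    rewrite sum_n_m_const, Rmult_0_r, Nat.eqb_refl.
    change (0 + a (S i) + 0 = a (S i)). ring.
Qed.

Definition link (k l : cluster) : R := if clusters_linked k l then 1 else 0.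

(** The cluster pattern alone would make agent i its own neighbour; the last term removes it. This
    is the source of n - 1 and N - 2n - 1 in the reduced dynamics. *)
Lemma adjacency_cluster_sum (phi : cluster -> R) (i : nat) : (i < N)%nat ->
  sum_n_m (fun j => adjacency n i j * phi (cluster_of n j)) 0 (N - 1)
  = n * (link (cluster_of n i) High * phi High) + n * (link (cluster_of n i) Low * phi Low)
    + (N - 2 * n) * (link (cluster_of n i) Neutral * phi Neutral) - phi (cluster_of n i).
Proof.
  intros Hi.
  rewrite <- (cluster_sum (fun c => link (cluster_of n i) c * phi c)).
  rewrite <- (diagonal_sum (fun j => phi (cluster_of n j)) i Hi).
  transitivity (sum_n_m (fun j => link (cluster_of n i) (cluster_of n j) * phi (cluster_of n j)) 0 (N - 1)
    + (-1) * sum_n_m (fun j => if (i =? j)%nat then phi (cluster_of n j) else 0) 0 (N - 1)); [|apply Rminus_diag_uniq; ring].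
  rewrite sum_n_m_lin. apply sum_n_m_ext. intros j. apply Rminus_diag_uniq.
  unfold adjacency, link. destruct (Nat.eqb_spec i j) as [<-|h]; simpl.
  - destruct (cluster_of n i); simpl; ring.
  - destruct (clusters_linked _ _); ring.
Qed.

Lemma network_field_synchronized (eps u : R) (x : nat -> R) (xi : cluster -> R) (i : nat) :
  (i < N)%nat -> (forall j, x j = xi (cluster_of n j)) ->
  network_field N n eps u x i =
  match cluster_of n i with
  | High => fst (fst (reduced_field N n eps u (xi High, xi Low, xi Neutral)))
  | Low => snd (fst (reduced_field N n eps u (xi High, xi Low, xi Neutral)))
  | Neutral => snd (reduced_field N n eps u (xi High, xi Low, xi Neutral))
  end.
Proof.
  intros Hi Hx. unfold network_field.
  assert (Hd : degree N n i = sum_n_m (fun j => adjacency n i j * (fun _ => 1) (cluster_of n j)) 0 (N - 1)).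
  { apply sum_n_m_ext. intros j. apply Rminus_diag_uniq. ring. }
  rewrite Hd, (adjacency_cluster_sum (fun _ => 1)) by assumption.
  rewrite (sum_n_m_ext _ (fun j => adjacency n i j * (fun c => u * tanh (xi c)) (cluster_of n j)))
    by (intros j; rewrite Hx; reflexivity).
  rewrite (adjacency_cluster_sum (fun c => u * tanh (xi c))) by assumption.
  rewrite Hx. unfold threshold, reduced_field, link.
  destruct (cluster_of n i); simpl; field.
Qed.

Lemma mean_state_eq (x : nat -> R) : mean_state N n x = sum_n_m x 0 (N - 1) / N.
Proof.
  assert (h1 : 0 < INR n) by (apply lt_0_INR; lia).
  assert (h2 : 0 < INR N - 2 * INR n).
  { assert (h := lt_INR _ _ hN). rewrite mult_INR in h. simpl (INR 2) in h. lra. }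
  unfold mean_state, cluster_average. rewrite sum_n_m_split3. field. lra.
Qed.

Lemma mean_state_le (x z : nat -> R) : (forall i, (i < N)%nat -> z i <= x i) ->
  mean_state N n z <= mean_state N n x.
Proof.
  intros H. rewrite !mean_state_eq. unfold Rdiv. apply Rmult_le_compat_r.
  - left. apply Rinv_0_lt_compat, lt_0_INR. lia.
  - apply sum_n_m_le_loc. intros i Hi. apply H. lia.
Qed.

Lemma mean_state_synchronized (xi : cluster -> R) :
  mean_state N n (fun i => xi (cluster_of n i))
  = (n * xi High + n * xi Low + (N - 2 * n) * xi Neutral) / N.
Proof. rewrite mean_state_eq, cluster_sum. reflexivity. Qed.

End Synchronized.

(** * Barriers and jumps *)

(** The Taylor expansion composed with a cubic curve and truncated after th^3. Taking K >= 1 lets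
    every power of the coefficients be absorbed into K^4. *)
Lemma tanh_along_cubic (a al be ga K th : R) :
  1 <= K -> Rabs al <= K -> Rabs be <= K -> Rabs ga <= K -> 0 <= th <= 1 ->
  Rabs (tanh (a + (al * th + be * th ^ 2 + ga * th ^ 3)) - tanh a
    - ((1 - tanh a ^ 2) * al * th
       + ((1 - tanh a ^ 2) * be + Derive_n tanh 2 a * al ^ 2 / 2) * th ^ 2
       + ((1 - tanh a ^ 2) * ga + Derive_n tanh 2 a * al * be + Derive_n tanh 3 a * al ^ 3 / 6) * th ^ 3))
  <= 200 * K ^ 4 * th ^ 4.
Proof.
  intros HK Ha Hb Hg Hth.
  set (p := al * th + be * th ^ 2 + ga * th ^ 3).
  assert (T := tanh_taylor a p).
  rewrite Derive_n_tanh_2, Derive_n_tanh_3 in *.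
  assert (Ht := tanh_lt_1 a). set (t := tanh a) in *.
  set (d2 := -2 * t * (1 - t ^ 2)) in *. set (d3 := (1 - t ^ 2) * (6 * t ^ 2 - 2)) in *.
  assert (Ht2 : 0 <= t ^ 2 <= 1) by (split; nra).
  assert (Hd2 : Rabs d2 <= 2) by (apply Rabs_le; unfold d2; split; nra).
  assert (Hd3 : Rabs d3 <= 4) by (apply Rabs_le; unfold d3; split; nra).
  assert (Hth2 : 0 <= th ^ 2 <= th) by (split; nra).
  assert (Hth4 : 0 <= th ^ 4) by (apply pow_le; lra).
  assert (Hp : Rabs p <= 3 * K * th).
  { apply Rabs_le_between in Ha. apply Rabs_le_between in Hb. apply Rabs_le_between in Hg.
    assert (Hth3 : 0 <= th ^ 3 <= th) by (split; nra).
    apply Rabs_le. unfold p. split; nra. }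
  assert (Hp4 : 2 * p ^ 4 <= 162 * K ^ 4 * th ^ 4).
  { assert (h := pow_incr (Rabs p) (3 * K * th) 4 (conj (Rabs_pos p) Hp)).
    rewrite RPow_abs, Rabs_pos_eq in h by (replace (p ^ 4) with ((p ^ 2) ^ 2) by ring; apply pow2_ge_0).
    replace ((3 * K * th) ^ 4) with (81 * K ^ 4 * th ^ 4) in h by ring. lra. }
  assert (Hp2 : Rabs (p ^ 2 - (al ^ 2 * th ^ 2 + 2 * al * be * th ^ 3)) <= 6 * K ^ 2 * th ^ 4).
  { replace (p ^ 2 - _) with (th ^ 4 * (be * be + 2 * (al * ga) + 2 * (be * ga) * th + (ga * ga) * th ^ 2))
      by (unfold p; ring).
    assert (B : forall x y, Rabs x <= K -> Rabs y <= K -> Rabs (x * y) <= K ^ 2).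
    { intros x y hx hy. rewrite Rabs_mult. replace (K ^ 2) with (K * K) by ring.
      apply Rmult_le_compat; try apply Rabs_pos; assumption. }
    assert (h1 := B be be Hb Hb). assert (h2 := B al ga Ha Hg). assert (h3 := B be ga Hb Hg).
    assert (h4 := B ga ga Hg Hg).
    apply Rabs_le_between in h1. apply Rabs_le_between in h2. apply Rabs_le_between in h3. apply Rabs_le_between in h4.
    rewrite Rabs_mult, (Rabs_pos_eq (th ^ 4)) by assumption.
    assert (Rabs (be * be + 2 * (al * ga) + 2 * (be * ga) * th + (ga * ga) * th ^ 2) <= 6 * K ^ 2).
    { apply Rabs_le. split; nra. }
    nra. }
  assert (Hp3 : Rabs (p ^ 3 - al ^ 3 * th ^ 3) <= 26 * K ^ 3 * th ^ 4).
  { replace (p ^ 3 - al ^ 3 * th ^ 3) with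
      ((th ^ 2 * (be + ga * th)) * (p * p + p * (al * th) + (al * th) * (al * th))) by (unfold p; ring).
    assert (Ha' : Rabs (al * th) <= K * th).
    { rewrite Rabs_mult, (Rabs_pos_eq th) by lra. apply Rmult_le_compat_r; lra. }
    assert (HKt : 0 <= K * th) by (apply Rmult_le_pos; lra).
    assert (h1 : Rabs (th ^ 2 * (be + ga * th)) <= th ^ 2 * (2 * K)).
    { rewrite Rabs_mult, (Rabs_pos_eq (th ^ 2)) by lra. apply Rmult_le_compat_l; [lra|].
      apply Rabs_le_between in Hb. apply Rabs_le_between in Hg. apply Rabs_le. split; nra. }
    assert (h2 : Rabs (p * p + p * (al * th) + (al * th) * (al * th)) <= 13 * (K * th) ^ 2).
    { set (r := al * th) in *. set (m := K * th) in *.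
      assert (Hp' : Rabs p <= 3 * m) by (unfold m; lra).
      apply Rabs_le_between in Ha'. apply Rabs_le_between in Hp'. apply Rabs_le. split; nra. }
    rewrite Rabs_mult. apply Rle_trans with ((th ^ 2 * (2 * K)) * (13 * (K * th) ^ 2)).
    - apply Rmult_le_compat; try apply Rabs_pos; assumption.
    - right. ring. }
  set (X := tanh (a + p) - t - ((1 - t ^ 2) * p + d2 * p ^ 2 / 2 + d3 * p ^ 3 / 6)) in *.
  set (X2 := p ^ 2 - (al ^ 2 * th ^ 2 + 2 * al * be * th ^ 3)) in *.
  set (X3 := p ^ 3 - al ^ 3 * th ^ 3) in *.
  replace (_ - _) with (X + d2 / 2 * X2 + d3 / 6 * X3) by (unfold X, X2, X3, p; field).
  assert (HK2 : K ^ 2 <= K ^ 4) by (apply Rle_pow; [lra | lia]).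
  assert (HK3 : K ^ 3 <= K ^ 4) by (apply Rle_pow; [lra | lia]).
  assert (H2 : Rabs (d2 / 2 * X2) <= 6 * K ^ 4 * th ^ 4).
  { rewrite Rabs_mult. apply Rle_trans with (1 * (6 * K ^ 2 * th ^ 4)).
    - apply Rmult_le_compat; try apply Rabs_pos; [|assumption].
      unfold Rdiv. rewrite Rabs_mult, (Rabs_pos_eq (/ 2)) by lra. lra.
    - rewrite Rmult_1_l. apply Rmult_le_compat_r; lra. }
  assert (H3 : Rabs (d3 / 6 * X3) <= 26 * K ^ 4 * th ^ 4).
  { rewrite Rabs_mult. apply Rle_trans with (1 * (26 * K ^ 3 * th ^ 4)).
    - apply Rmult_le_compat; try apply Rabs_pos; [|assumption].
      unfold Rdiv. rewrite Rabs_mult, (Rabs_pos_eq (/ 6)) by lra. lra.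
    - rewrite Rmult_1_l. apply Rmult_le_compat_r; lra. }
  (* The three contributions are 162, 6 and 26 times K^4 th^4, together below 200. *)
  apply Rle_trans with (Rabs X + Rabs (d2 / 2 * X2) + Rabs (d3 / 6 * X3)).
  { etransitivity; [apply Rabs_triang|]. apply Rplus_le_compat_r, Rabs_triang. }
  assert (0 <= K ^ 4 * th ^ 4) by (apply Rmult_le_pos; [apply pow_le; lra | assumption]).
  lra.
Qed.

Lemma tanh_cubic_at_0 (th : R) : Rabs (tanh th - (th - th ^ 3 / 3)) <= 2 * th ^ 4.
Proof.
  assert (T := tanh_taylor 0 th). rewrite Derive_n_tanh_2, Derive_n_tanh_3, tanh_0, Rplus_0_l in T.
  etransitivity; [|exact T]. right. f_equal. field.
Qed.

Section Barrier.

Variables (k M : R).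
Hypotheses (hk : 1 <= k) (hM : 1 <= M).

(* [T] stands for [tanh] of the outer equilibrium [Y].  The curve
   [Y + al th + be th^2 + ga th^3], [- Y + al th - be th^2 + ga th^3], [th]
   solves the first two equilibrium equations up to third order, except that
   the third-order coefficient is lowered so as to leave a surplus [mu th^3]. *)
Definition gap (u T : R) : R := M + k - k * u * (1 - T ^ 2).
Definition d2_tanh (T : R) : R := - 2 * T * (1 - T ^ 2).
Definition d3_tanh (T : R) : R := (1 - T ^ 2) * (6 * T ^ 2 - 2).
Definition coef_al (u T : R) : R := M * u / gap u T.
Definition coef_be (u T : R) : R := k * u * d2_tanh T * coef_al u T ^ 2 / (2 * gap u T).
Definition cubic_part (u T : R) : R :=
  d2_tanh T * coef_al u T * coef_be u T + d3_tanh T * coef_al u T ^ 3 / 6.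
Definition coef_ga (mu u T : R) : R :=
  (k * u * cubic_part u T - M * u / 3 - mu) / gap u T.
Definition neutral_cubic (mu u T : R) : R :=
  - (M - 1) * u / 3 + 2 * (k + 1) * u * ((1 - T ^ 2) * coef_ga mu u T + cubic_part u T).

(** The equations for al and be cancel the orders th and th^2, and the one for ga leaves mu th^3.
    The error collects the Taylor remainders of the outer cluster, weighted by k u, and of the
    neutral one, weighted by M u. *)
Lemma outer_surplus (a u al be ga mu K th : R) :
  0 < u -> 1 <= K -> Rabs al <= K -> Rabs be <= K -> Rabs ga <= K -> 0 <= th <= 1 ->
  gap u (tanh a) * al = M * u ->
  gap u (tanh a) * be = k * u * d2_tanh (tanh a) * al ^ 2 / 2 ->
  gap u (tanh a) * ga = k * u * (d2_tanh (tanh a) * al * be + d3_tanh (tanh a) * al ^ 3 / 6) - M * u / 3 - mu ->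
  let p := al * th + be * th ^ 2 + ga * th ^ 3 in
  mu * th ^ 3 - (200 * k * K ^ 4 + 2 * M) * u * th ^ 4
  <= - (M + k) * p + k * u * (tanh (a + p) - tanh a) + M * u * tanh th.
Proof.
  intros Hu HK Ha Hb Hg Hth E1 E2 E3 p.
  assert (T1 := tanh_along_cubic a al be ga K th HK Ha Hb Hg Hth). fold p in T1.
  assert (T2 := tanh_cubic_at_0 th).
  rewrite Derive_n_tanh_2, Derive_n_tanh_3 in T1.
  fold (d2_tanh (tanh a)) in T1. fold (d3_tanh (tanh a)) in T1.
  set (t := tanh a) in *. set (s := 1 - t ^ 2) in *.
  assert (Eg : gap u t = M + k - k * u * s) by reflexivity.
  apply Rabs_le_between in T1. apply Rabs_le_between in T2.
  set (D := tanh (a + p) - t) in *.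
  set (L := s * al * th + (s * be + d2_tanh t * al ^ 2 / 2) * th ^ 2
       + (s * ga + d2_tanh t * al * be + d3_tanh t * al ^ 3 / 6) * th ^ 3) in *.
  assert (h1 : k * u * (L - 200 * K ^ 4 * th ^ 4) <= k * u * D).
  { apply Rmult_le_compat_l; [apply Rmult_le_pos|]; lra. }
  assert (h2 : M * u * (th - th ^ 3 / 3 - 2 * th ^ 4) <= M * u * tanh th).
  { apply Rmult_le_compat_l; [apply Rmult_le_pos|]; lra. }
  assert (E : - (M + k) * p + k * u * L + M * u * (th - th ^ 3 / 3) = mu * th ^ 3).
  { transitivity (- (gap u t * al - M * u) * th
      - (gap u t * be - k * u * d2_tanh t * al ^ 2 / 2) * th ^ 2
      - (gap u t * ga - (k * u * (d2_tanh t * al * be + d3_tanh t * al ^ 3 / 6) - M * u / 3 - mu)) * th ^ 3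
      + mu * th ^ 3).
    - rewrite Eg. unfold L, p. field.
    - rewrite E1, E2, E3. ring. }
  lra.
Qed.

(** The second-order terms of the two outer clusters cancel: tanh'' is odd and be enters with
    opposite signs. What remains is a linear part, equal to [lambda1] once al is [coef_al], and a
    cubic part. *)
Lemma neutral_surplus (a u al be ga K th : R) :
  0 < u -> 1 <= K -> Rabs al <= K -> Rabs be <= K -> Rabs ga <= K -> 0 <= th <= 1 ->
  let p := al * th + be * th ^ 2 + ga * th ^ 3 in
  let q := al * th - be * th ^ 2 + ga * th ^ 3 in
  let s := 1 - tanh a ^ 2 in
  (- (M + 2 * k + 1) + (M - 1) * u + 2 * (k + 1) * u * s * al) * th
  + (- (M - 1) * u / 3 + 2 * (k + 1) * u *
      (s * ga + (d2_tanh (tanh a) * al * be + d3_tanh (tanh a) * al ^ 3 / 6))) * th ^ 3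
  - (400 * (k + 1) * K ^ 4 + 2 * (M - 1)) * u * th ^ 4
  <= - (M + 2 * k + 1) * th + (M - 1) * u * tanh th
     + (k + 1) * u * tanh (a + p) + (k + 1) * u * tanh (- a + q).
Proof.
  intros Hu HK Ha Hb Hg Hth p q s.
  assert (Hb' : Rabs (- be) <= K) by (rewrite Rabs_Ropp; assumption).
  assert (T1 := tanh_along_cubic a al be ga K th HK Ha Hb Hg Hth). fold p in T1.
  assert (T3 := tanh_along_cubic (- a) al (- be) ga K th HK Ha Hb' Hg Hth).
  replace (al * th + - be * th ^ 2 + ga * th ^ 3) with q in T3 by (unfold q; ring).
  assert (T2 := tanh_cubic_at_0 th).
  rewrite Derive_n_tanh_2, Derive_n_tanh_3 in T1, T3. rewrite tanh_opp in T3.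
  unfold d2_tanh, d3_tanh. set (t := tanh a) in *.
  replace ((- t) ^ 2) with (t ^ 2) in T3 by ring. fold s in T1, T3 |- *.
  apply Rabs_le_between in T1. apply Rabs_le_between in T2. apply Rabs_le_between in T3.
  set (A := tanh (a + p)) in *. set (B := tanh (- a + q)) in *.
  assert (Hsum : 2 * s * al * th + 2 * (s * ga + (-2 * t * s * al * be + s * (6 * t ^ 2 - 2) * al ^ 3 / 6)) * th ^ 3
    - 400 * K ^ 4 * th ^ 4 <= A + B) by lra.
  assert (h1 := Rmult_le_compat_l ((k + 1) * u) _ _ ltac:(apply Rmult_le_pos; lra) Hsum).
  assert (h2 : (M - 1) * u * (th - th ^ 3 / 3 - 2 * th ^ 4) <= (M - 1) * u * tanh th).
  { apply Rmult_le_compat_l; [apply Rmult_le_pos|]; lra. }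
  lra.
Qed.

End Barrier.

(** * Continuity of the barrier coefficients in u *)

Lemma continuous_div (f g : R -> R) (x : R) :
  continuous f x -> continuous g x -> g x <> 0 -> continuous (fun y => f y / g y) x.
Proof.
  intros Hf Hg H0. apply (continuous_mult f (fun y => / g y)); [assumption|].
  apply continuous_Rinv_comp; assumption.
Qed.

Lemma continuous_pow (f : R -> R) (m : nat) (x : R) :
  continuous f x -> continuous (fun y => f y ^ m) x.
Proof.
  intros Hf. induction m as [|m IH]; [apply continuous_const|].
  apply (continuous_mult f (fun y => f y ^ m)); assumption.
Qed.

Ltac continuity_step :=
  match goal with
  | H : continuous ?f ?x |- continuous ?f ?x => exact H
  | |- continuous (fun _ => ?c) _ => apply continuous_const
  | |- continuous (fun x => x) _ => apply continuous_id
  | |- continuous (fun x => @?a x + @?b x) _ => apply (continuous_plus a b)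
  | |- continuous (fun x => @?a x - @?b x) _ => apply (continuous_minus a b)
  | |- continuous (fun x => - @?a x) _ => apply (continuous_opp a)
  | |- continuous (fun x => @?a x * @?b x) _ => apply (continuous_mult a b)
  | |- continuous (fun x => @?a x / @?b x) _ => apply (continuous_div a b)
  | |- continuous (fun x => @?a x ^ ?m) _ => apply (continuous_pow a m)
  end.

Section BarrierContinuity.

Variables (k M : R) (T : R -> R) (u0 : R).
Hypotheses (HT : continuous T u0) (H0 : gap k M u0 (T u0) <> 0).

Lemma continuous_gap : continuous (fun u => gap k M u (T u)) u0.
Proof. unfold gap. repeat continuity_step. Qed.

Lemma continuous_coef_al : continuous (fun u => coef_al k M u (T u)) u0.
Proof. unfold coef_al. assert (h := continuous_gap). repeat continuity_step. assumption. Qed.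

Lemma continuous_coef_be : continuous (fun u => coef_be k M u (T u)) u0.
Proof.
  unfold coef_be, d2_tanh. assert (h := continuous_gap). assert (h1 := continuous_coef_al).
  repeat continuity_step. lra.
Qed.

Lemma continuous_cubic_part : continuous (fun u => cubic_part k M u (T u)) u0.
Proof.
  unfold cubic_part, d2_tanh, d3_tanh. assert (h1 := continuous_coef_al). assert (h2 := continuous_coef_be).
  repeat continuity_step. lra.
Qed.

Lemma continuous_coef_ga (mu : R) : continuous (fun u => coef_ga k M mu u (T u)) u0.
Proof.
  unfold coef_ga. assert (h := continuous_gap). assert (h1 := continuous_cubic_part).
  repeat continuity_step; lra.
Qed.

Lemma continuous_neutral_cubic (mu : R) : continuous (fun u => neutral_cubic k M mu u (T u)) u0.
Proof.
  unfold neutral_cubic. assert (h := continuous_coef_ga mu). assert (h1 := continuous_cubic_part).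
  repeat continuity_step; lra.
Qed.

End BarrierContinuity.

(** Without surplus the curve solves the outer equations to third order, so what is left in the
    neutral equation is the cubic coefficient of the scalar reduction. *)
Lemma neutral_cubic_lambda3 (N n : nat) (k M u y : R) :
  INR n = k + 1 -> INR N = M + 2 * k + 2 -> 1 <= k -> 1 <= M -> 0 < u ->
  gap k M u (tanh y) <> 0 -> neutral_cubic k M 0 u (tanh y) = lambda3 N n y u.
Proof.
  intros En EN hk hM Hu HG. unfold lambda3.
  rewrite (coef_a_formula N n k M En EN hM), (coef_b_formula N n k M En EN hM),
    (coef_c_formula N n k M En EN hM), En, EN by lra.
  fold (gap k M u (tanh y)).
  unfold neutral_cubic, coef_ga, cubic_part, coef_be, coef_al, d2_tanh, d3_tanh.
  set (t := tanh y) in *. set (G := gap k M u t) in *.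
  assert (EG : k * u * (1 - t ^ 2) = M + k - G) by (unfold G, gap; ring).
  assert (Es : 1 - t ^ 2 = (M + k - G) / (k * u)) by (rewrite <- EG; field; lra).
  rewrite Es. clearbody G. field. repeat split; lra.
Qed.

(** The surplus in the outer clusters is paid for in the neutral one, linearly in mu; a small mu
    therefore keeps the neutral cubic coefficient positive. *)
Lemma neutral_cubic_shift (k M mu u T : R) : gap k M u T <> 0 ->
  neutral_cubic k M mu u T
  = neutral_cubic k M 0 u T - 2 * (k + 1) * u * (1 - T ^ 2) * mu / gap k M u T.
Proof. intros H. unfold neutral_cubic, coef_ga. field. assumption. Qed.

(** * Escape of the network trajectories above the barrier *)

Section Jump.

Variables (N n : nat) (k M : R).
Hypotheses (hn : (1 <= n)%nat) (hN : (2 * n < N)%nat).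
Hypotheses (En : INR n = k + 1) (EN : INR N = M + 2 * k + 2).
Hypotheses (hk : 1 <= k) (hM : 1 <= M).

Definition barrier (Y al be ga th : R) (c : cluster) : R :=
  match c with
  | High => Y + (al * th + be * th ^ 2 + ga * th ^ 3)
  | Low => - Y + (al * th - be * th ^ 2 + ga * th ^ 3)
  | Neutral => th
  end.

Definition barrier' (al be ga th : R) (c : cluster) : R :=
  match c with
  | High => al + 2 * be * th + 3 * ga * th ^ 2
  | Low => al - 2 * be * th + 3 * ga * th ^ 2
  | Neutral => 1
  end.

Lemma is_derive_barrier (Y al be ga th : R) (c : cluster) :
  is_derive (fun th => barrier Y al be ga th c) th (barrier' al be ga th c).
Proof. destruct c; simpl; auto_derive; try exact I; ring. Qed.

(** The smallness conditions on th0 let mu and the neutral cubic coefficient dominate the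
    fourth-order errors, while [lambda1] >= 0 makes the linear term harmless. The field then exceeds
    c0 th^3 all along the curve. *)
Lemma escape_past_barrier (eps u Y mu K th0 c0 : R) (x : nat -> R -> R) :
  0 < u -> 1 <= K ->
  let T := tanh Y in
  let al := coef_al k M u T in
  let be := coef_be k M u T in
  let ga := coef_ga k M mu u T in
  Rabs al <= K -> Rabs be <= K -> Rabs ga <= K ->
  equilibrium N n eps u Y -> 0 < gap k M u T -> 0 <= lambda1 N n Y u ->
  0 < th0 <= 1 -> 0 < c0 ->
  c0 + (200 * k * K ^ 4 + 2 * M) * u * th0 <= mu ->
  c0 + (400 * (k + 1) * K ^ 4 + 2 * (M - 1)) * u * th0 <= neutral_cubic k M mu u T ->
  network_trajectory N n eps u x ->
  (forall i, (i < N)%nat -> cluster_state n Y i <= x i 0) ->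
  (exists i, (i < N)%nat /\ cluster_state n Y i < x i 0) ->
  exists t0, forall i t, (i < N)%nat -> t0 <= t -> barrier Y al be ga th0 (cluster_of n i) < x i t.
Proof.
  intros Hu HK T al be ga Ha Hb Hg Heq HG Hl1 Hth0 Hc0 Hmu Hcub Hx Hx0 Hx1.
  apply (equilibrium_iff N n k M En EN) in Heq.
  set (xc := fun i t => x i (Rmax t 0)).
  assert (Hxc0 : forall i t, 0 <= t -> xc i t = x i t) by (intros i t Ht; unfold xc; rewrite Rmax_left; auto).
  assert (Hcont : forall i t, (i < N)%nat -> continuous (xc i) t).
  { intros i t Hi. destruct (Hx i Hi) as [h1 h2]. apply (continuous_clamp (x i)); [exact h1|].
    intros s Hs. eexists. apply h2, Hs. }
  assert (Hder : forall i t, (i < N)%nat -> 0 < t ->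
    is_derive (xc i) t (network_field N n eps u (fun j => xc j t) i)).
  { intros i t Hi Ht. destruct (Hx i Hi) as [_ h2].
    apply is_derive_ext_loc with (x i).
    - apply filter_imp with (fun s => 0 < s); [|apply open_gt, Ht].
      intros s Hs. symmetry. apply Hxc0. left; exact Hs.
    - unfold xc. rewrite Rmax_left by lra. apply h2, Ht. }
  assert (Hz0 : forall i, barrier Y al be ga 0 (cluster_of n i) = cluster_state n Y i).
  { intros i. unfold cluster_state, barrier. destruct (cluster_of n i); ring. }
  assert (Ee : forall i, (i < N)%nat -> network_field N n eps u (cluster_state n Y) i = 0).
  { intros i Hi.
    rewrite (network_field_synchronized N n hn hN eps u _ (barrier Y al be ga 0)); [|assumption|].
    - assert (E := proj2 (equilibrium_iff N n k M En EN eps u Y) Heq). unfold equilibrium in E.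
      replace (barrier Y al be ga 0 High) with Y by (simpl; ring).
      replace (barrier Y al be ga 0 Low) with (- Y) by (simpl; ring).
      change (barrier Y al be ga 0 Neutral) with 0. rewrite E.
      destruct (cluster_of n i); reflexivity.
    - intros j. symmetry. apply Hz0. }
  assert (Hge := stays_above_equilibrium N n eps u hN Hu xc Hcont Hder (cluster_state n Y) Ee).
  assert (Hge' : forall i t, (i < N)%nat -> 0 <= t -> cluster_state n Y i <= xc i t).
  { apply Hge. intros i Hi. rewrite Hxc0 by lra. apply Hx0, Hi. }
  assert (Efield : forall i th, (i < N)%nat -> 0 < th <= th0 ->
    c0 * th ^ 3 <= network_field N n eps u (fun j => barrier Y al be ga th (cluster_of n j)) i).
  { intros i th Hi Hth.
    rewrite (network_field_synchronized N n hn hN eps u _ (barrier Y al be ga th)); [|assumption|reflexivity].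
    assert (Hth1 : 0 <= th <= 1) by lra.
    assert (Hth3 : 0 < th ^ 3) by (apply pow_lt; lra).
    assert (EG : gap k M u T <> 0) by lra.
    assert (E1 : gap k M u T * al = M * u) by (unfold al, coef_al; field; assumption).
    assert (E2 : gap k M u T * be = k * u * d2_tanh T * al ^ 2 / 2).
    { unfold be, coef_be. fold al. field; assumption. }
    assert (E3 : gap k M u T * ga = k * u * (d2_tanh T * al * be + d3_tanh T * al ^ 3 / 6) - M * u / 3 - mu).
    { unfold ga, coef_ga, cubic_part. fold al be. field; assumption. }
    assert (Hsmall : forall C m, 0 <= C -> c0 + C * u * th0 <= m -> c0 * th ^ 3 <= m * th ^ 3 - C * u * th ^ 4).
    { intros C m HC Hm. assert (C * u * th <= C * u * th0) by (apply Rmult_le_compat_l; [apply Rmult_le_pos|]; lra).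
      replace (m * th ^ 3 - C * u * th ^ 4) with ((m - C * u * th) * th ^ 3) by ring.
      apply Rmult_le_compat_r; lra. }
    assert (HK4 : 0 <= K ^ 4) by (apply pow_le; lra).
    assert (HkK : 0 <= k * K ^ 4) by (apply Rmult_le_pos; lra).
    assert (hC1 : 0 <= 200 * k * K ^ 4 + 2 * M) by lra.
    assert (hC2 : 0 <= 400 * (k + 1) * K ^ 4 + 2 * (M - 1)) by lra.
    fold T in Heq.
    destruct (cluster_of n i).
    - assert (S := outer_surplus k M hk hM Y u al be ga mu K th Hu HK Ha Hb Hg Hth1 E1 E2 E3).
      cbv zeta in S.
      assert (h := Hsmall _ _ hC1 Hmu).
      cbv beta iota delta [reduced_field fst snd barrier]. rewrite En, EN. fold T in S. lra.
    (* The low cluster is the mirror image of the high one: Y and be change sign, and [gap] is even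
       in T. *)
    - assert (Et : tanh (- Y) = - T) by apply tanh_opp.
      assert (Eg : gap k M u (- T) = gap k M u T) by (unfold gap; ring).
      assert (S := outer_surplus k M hk hM (- Y) u al (- be) ga mu K th Hu HK Ha
        ltac:(rewrite Rabs_Ropp; assumption) Hg Hth1).
      rewrite Et, Eg in S.
      specialize (S E1 ltac:(rewrite Ropp_mult_distr_r_reverse, E2; unfold d2_tanh; field)
        ltac:(rewrite E3; unfold d2_tanh, d3_tanh; field)).
      cbv zeta in S.
      assert (h := Hsmall _ _ hC1 Hmu).
      cbv beta iota delta [reduced_field fst snd barrier]. rewrite En, EN.
      replace (al * th + - be * th ^ 2 + ga * th ^ 3) with (al * th - be * th ^ 2 + ga * th ^ 3) in S by ring.
      lra.
    - assert (S := neutral_surplus k M hk hM Y u al be ga K th Hu HK Ha Hb Hg Hth1).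
      cbv zeta in S. fold T in S.
      assert (h := Hsmall _ _ hC2 Hcub).
      assert (EL : - (M + 2 * k + 1) + (M - 1) * u + 2 * (k + 1) * u * (1 - T ^ 2) * al = lambda1 N n Y u).
      { rewrite (lambda1_formula N n k M En EN hk hM) 
          by (first [apply Rgt_not_eq; assumption | intros E; apply EG; unfold gap, T; lra]).
        fold T. fold (gap k M u T). unfold al, coef_al, crit_poly.
        assert (EG' : k * u * (1 - T ^ 2) = M + k - gap k M u T) by (unfold gap; ring).
        apply Rmult_eq_reg_r with (gap k M u T); [|assumption].
        unfold gap in *. field. assumption. }
      rewrite EL in S.
      assert (h' : 0 <= lambda1 N n Y u * th) by (apply Rmult_le_pos; lra).
      assert (EC : neutral_cubic k M mu u T = - (M - 1) * u / 3 + 2 * (k + 1) * u *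
        ((1 - T ^ 2) * ga + (d2_tanh T * al * be + d3_tanh T * al ^ 3 / 6))) by reflexivity.
      rewrite <- EC in S.
      cbv beta iota delta [reduced_field fst snd barrier]. rewrite En, EN. lra. }
  (* 6 K comes from K + 2 K + 3 K, bounding the three terms of the derivative of the curve for th <=
     1. *)
  destruct (climbs_subequilibria N n eps u hN Hu xc Hcont Hder (cluster_state n Y) Ee Hge'
    (fun i th => barrier Y al be ga th (cluster_of n i))
    (fun i th => barrier' al be ga th (cluster_of n i)) th0 (6 * K) c0) as [t0 Ht0]; try lra.
  - intros i th _. apply is_derive_barrier.
  - intros i th _ Hth. apply Rabs_le_between in Ha. apply Rabs_le_between in Hb. apply Rabs_le_between in Hg.
    assert (0 <= th ^ 2 <= 1) by (split; nra).
    destruct (cluster_of n i); simpl barrier'; nra.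
  - intros i _. apply Hz0.
  - exact Efield.
  - destruct Hx1 as [i [Hi Hlt]]. exists i. split; [assumption|]. rewrite Hxc0 by lra. exact Hlt.
  - exists (Rmax t0 0). intros i t Hi Ht.
    rewrite <- Hxc0 by (apply Rle_trans with (2 := Ht), Rmax_r).
    apply Ht0; [assumption|]. apply Rle_trans with (2 := Ht), Rmax_l.
Qed.

(** The bounds hold with room to spare at u0 and extend to nearby u by continuity. Since th0 is
    fixed before u, the height rho does not depend on u. *)
Lemma jumps_up_of_cubic_pos (eps u0 y : R) (Y : R -> R) :
  0 < u0 -> equilibrium_branch N n eps u0 y Y -> 0 < gap k M u0 (tanh y) ->
  at_right u0 (fun u => 0 < lambda1 N n (Y u) u) -> 0 < lambda3 N n y u0 ->
  jumps_up N n eps u0 y.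
Proof.
  intros Hu0 HY HG0 Hl1 Hl3. destruct HY as (HY0 & HYc & HYe).
  set (T := fun u => tanh (Y u)).
  assert (HT : continuous T u0).
  { apply (continuous_comp Y tanh); [assumption|]. apply continuous_tanh. }
  assert (HT0 : T u0 = tanh y) by (unfold T; rewrite HY0; reflexivity).
  assert (HG : gap k M u0 (T u0) <> 0) by (rewrite HT0; lra).
  assert (Hs := sech2_pos y).
  set (l3 := lambda3 N n y u0) in *.
  (* With this mu the surplus costs exactly l3 / 4; of the remaining 3 l3 / 4, at least l3 / 2
     survives for u near u0. *)
  set (mu := l3 * gap k M u0 (tanh y) / (8 * (k + 1) * u0 * (1 - tanh y ^ 2))).
  assert (Hmu : 0 < mu).
  { unfold mu. apply Rdiv_lt_0_compat; repeat apply Rmult_lt_0_compat; lra. }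
  assert (Hc0 : neutral_cubic k M mu u0 (T u0) = 3 / 4 * l3).
  { rewrite HT0, neutral_cubic_shift by lra.
    rewrite (neutral_cubic_lambda3 N n k M u0 y En EN hk hM Hu0) by lra. fold l3.
    unfold mu. field. repeat split; lra. }
  set (K := 1 + Rabs (coef_al k M u0 (T u0)) + Rabs (coef_be k M u0 (T u0)) + Rabs (coef_ga k M mu u0 (T u0))).
  assert (ha := Rabs_pos (coef_al k M u0 (T u0))).
  assert (hb := Rabs_pos (coef_be k M u0 (T u0))).
  assert (hg := Rabs_pos (coef_ga k M mu u0 (T u0))).
  assert (HK : 1 <= K) by (unfold K; lra).
  assert (Habs : forall f, continuous f u0 -> Rabs (f u0) < K -> locally u0 (fun u => Rabs (f u) < K)).
  { intros f Hf HfK.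
    assert (C := continuous_comp f Rabs u0 Hf (continuous_Rabs (f u0))).
    apply (C (fun v => v < K)). apply open_lt, HfK. }
  assert (La : locally u0 (fun u => Rabs (coef_al k M u (T u)) < K)).
  { apply (Habs (fun u => coef_al k M u (T u))); [apply continuous_coef_al; assumption | unfold K; lra]. }
  assert (Lb : locally u0 (fun u => Rabs (coef_be k M u (T u)) < K)).
  { apply (Habs (fun u => coef_be k M u (T u))); [apply continuous_coef_be; assumption | unfold K; lra]. }
  assert (Lg : locally u0 (fun u => Rabs (coef_ga k M mu u (T u)) < K)).
  { apply (Habs (fun u => coef_ga k M mu u (T u))); [apply continuous_coef_ga; assumption | unfold K; lra]. }
  assert (LG : locally u0 (fun u => 0 < gap k M u (T u))).
  { apply (continuous_gap k M T u0 HT (fun v => 0 < v)). apply open_gt. rewrite HT0. exact HG0. }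
  assert (LC : locally u0 (fun u => l3 / 2 < neutral_cubic k M mu u (T u))).
  { apply (continuous_neutral_cubic k M T u0 HT HG mu (fun v => l3 / 2 < v)). apply open_gt. rewrite Hc0. lra. }
  assert (Lu : locally u0 (fun u => u < u0 + 1)) by (apply open_lt; lra).
  set (m := Rmin mu (l3 / 2)).
  assert (Hm : 0 < m) by (apply Rmin_pos; lra).
  assert (Hm1 : m <= mu) by apply Rmin_l. assert (Hm2 : m <= l3 / 2) by apply Rmin_r.
  assert (HK4 : 1 <= K ^ 4) by (apply pow_R1_Rle; assumption).
  assert (HkK : 1 <= k * K ^ 4) by nra.
  (* C bounds both fourth-order error coefficients for all positive u < u0 + 1. *)
  set (C := (400 * (k + 1) * K ^ 4 + 2 * M) * (u0 + 1)).
  assert (HC : 0 < C) by (unfold C; apply Rmult_lt_0_compat; nra).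
  (* The bound by m / (2 C) keeps the errors below m / 2, leaving c0 = m / 2; the last bound lets
     the neutral part M th0 outweigh the cubic terms of the outer clusters in the mean. *)
  set (th0 := Rmin 1 (Rmin (m / 2 / C) (M / (4 * (k + 1) * K)))).
  assert (HkK1 : 0 < 4 * (k + 1) * K) by (apply Rmult_lt_0_compat; lra).
  assert (Hth0 : 0 < th0).
  { apply Rmin_pos; [lra|]. apply Rmin_pos; apply Rdiv_lt_0_compat; lra. }
  assert (Hth1 : th0 <= 1) by apply Rmin_l.
  assert (Hth2 : C * th0 <= m / 2).
  { assert (h : th0 <= m / 2 / C) by (etransitivity; [apply Rmin_r | apply Rmin_l]).
    apply Rle_div_r in h; [|assumption]. lra. }
  assert (Hth3 : 4 * (k + 1) * K * th0 <= M).
  { assert (h : th0 <= M / (4 * (k + 1) * K)) by (etransitivity; [apply Rmin_r | apply Rmin_r]).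
    apply Rle_div_r in h; [|assumption]. lra. }
  assert (HNpos : 0 < INR N) by (rewrite EN; lra).
  exists Y, (M * th0 / (2 * N)). split; [repeat split; assumption|]. split.
  { apply Rdiv_lt_0_compat; [apply Rmult_lt_0_compat; lra | lra]. }
  assert (Lall : at_right u0 (fun u =>
    (Rabs (coef_al k M u (T u)) < K /\ Rabs (coef_be k M u (T u)) < K /\ Rabs (coef_ga k M mu u (T u)) < K)
    /\ (0 < gap k M u (T u) /\ l3 / 2 < neutral_cubic k M mu u (T u)) /\ (u < u0 + 1 /\ equilibrium N n eps u (Y u)))).
  { apply filter_le_within. repeat apply filter_and; assumption. }
  assert (Lpos : at_right u0 (fun u => u0 < u)) by (exists (mkposreal 1 Rlt_0_1); intros u _ h; exact h).
  generalize (filter_and _ _ Lpos (filter_and _ _ Hl1 Lall)). apply filter_imp.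
  intros u (Hu & Hlam & (Ha & Hb & Hg) & (HGu & HCu) & Hu1 & Heq) x Hx Hx0 Hx1.
  destruct (escape_past_barrier eps u (Y u) mu K th0 (m / 2) x) as [t0 Ht0];
    try assumption; try lra; try (left; assumption).
  - fold (T u).
    assert ((200 * k * K ^ 4 + 2 * M) * u * th0 <= C * th0); [|lra].
    apply Rmult_le_compat_r; [lra|]. unfold C. apply Rmult_le_compat; nra.
  - fold (T u).
    assert ((400 * (k + 1) * K ^ 4 + 2 * (M - 1)) * u * th0 <= C * th0); [|lra].
    apply Rmult_le_compat_r; [lra|]. unfold C. apply Rmult_le_compat; nra.
  - fold (T u) in Ht0.
    set (al := coef_al k M u (T u)) in *. set (be := coef_be k M u (T u)) in *.
    set (ga := coef_ga k M mu u (T u)) in *.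
    exists t0. intros t Ht.
    apply Rle_trans with (mean_state N n (fun i => barrier (Y u) al be ga th0 (cluster_of n i))).
    (* In the mean Y and be cancel between the outer clusters, leaving M th0 + 2 (k + 1)(al th0 + ga
       th0^3) over N. *)
    + rewrite (mean_state_synchronized N n hn hN (barrier (Y u) al be ga th0)).
      unfold barrier. rewrite En, EN.
      assert (Hal : 0 < al).
      { unfold al, coef_al. apply Rdiv_lt_0_compat; [apply Rmult_lt_0_compat; lra | exact HGu]. }
      assert (Hga : - K <= ga) by (apply Rabs_lt_between in Hg; lra).
      assert (Hal' : 0 < al * th0) by (apply Rmult_lt_0_compat; lra).
      assert (Hth03 : 0 < th0 ^ 3 <= th0 ^ 2) by (split; [apply pow_lt; assumption | simpl; nra]).
      assert (Hg3 : - (K * th0 ^ 2) <= ga * th0 ^ 3) by nra.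
      assert (H4 : 2 * (k + 1) * (K * th0 ^ 2) <= M * th0 / 2) by nra.
      assert (H5 : - (2 * (k + 1) * (K * th0 ^ 2)) <= 2 * (k + 1) * (ga * th0 ^ 3)) by nra.
      assert (H6 : 0 < (k + 1) * (al * th0)) by (apply Rmult_lt_0_compat; lra).
      apply -> Rle_div_r; [|lra].
      replace (M * th0 / (2 * (M + 2 * k + 2)) * (M + 2 * k + 2)) with (M * th0 / 2) by (field; lra).
      lra.
    + apply (mean_state_le N n hn hN). intros i Hi. left. apply Ht0; [assumption | lra].
Qed.

End Jump.

(** * Transition and cascade *)

Section PitchforkPoints.

Variables (N n : nat) (k M : R).
Hypotheses (hn : (1 <= n)%nat) (hN : (2 * n < N)%nat).
Hypotheses (En : INR n = k + 1) (EN : INR N = M + 2 * k + 2).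
Hypotheses (hk : 1 <= k) (hM : 1 <= M).

(** Sufficient conditions for a pitchfork at y with the parameters of the critical curve. They are
    open in y, so a transition point inherits pitchforks on both sides. *)
Definition regular_state (y : R) : Prop :=
  0 < y /\ 0 < eps_of N n y /\ 0 < crossing_speed k M (u_of N n y) (1 - tanh y ^ 2).

Lemma continuous_eps_of (y : R) : continuous (eps_of N n) y.
Proof.
  apply (ex_derive_continuous (eps_of N n)). eexists. apply (is_derive_eps_of N n k M En EN hk hM).
Qed.

Lemma regular_state_open (y : R) : regular_state y -> locally y regular_state.
Proof.
  intros (H1 & H2 & H3). apply filter_and; [|apply filter_and].
  - apply open_gt, H1.
  - apply (continuous_eps_of y (fun v => 0 < v)). apply open_gt, H2.
  - apply (continuous_crossing_speed N n k M En EN hk hM y (fun v => 0 < v)). apply open_gt, H3.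
Qed.

Lemma regular_state_pitchfork (y : R) : regular_state y -> pitchfork N n (eps_of N n y) (u_of N n y) y.
Proof.
  intros (H1 & H2 & H3). split; [assumption|]. split; [apply (u_of_pos N n k M En EN hk hM)|].
  split; [apply (lambda1_u_of N n k M En EN hk hM)|].
  apply (crossing_branch N n k M En EN hk hM); assumption.
Qed.

Lemma regular_state_cascade (y : R) : regular_state y -> 0 < lambda3_of N n y ->
  cascade N n (eps_of N n y) (u_of N n y).
Proof.
  intros H Hl. exists y. split.
  - split; [apply regular_state_pitchfork, H|]. rewrite (lambda3_u_of N n k M En EN hk hM). exact Hl.
  - destruct H as (H1 & H2 & H3).
    destruct (crossing_branch N n k M En EN hk hM y H1 H3) as (Y & HY & _ & Hr).
    apply (jumps_up_of_cubic_pos N n k M hn hN En EN hk hM _ _ y Y); try assumption.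
    + apply (u_of_pos N n k M En EN hk hM).
    + assert (h := u_of_subcritical N n k M En EN hk hM y). unfold gap. lra.
    + rewrite (lambda3_u_of N n k M En EN hk hM). exact Hl.
Qed.

Lemma regular_state_transition (y : R) : regular_state y -> lambda3_of N n y = 0 ->
  at_left y (fun z => lambda3_of N n z < 0) -> at_right y (fun z => 0 < lambda3_of N n z) ->
  pitchfork_transition N n (eps_of N n y) (u_of N n y) y.
Proof.
  intros H H0 HL HR.
  assert (Hloc := regular_state_open y H).
  split; [apply regular_state_pitchfork, H|].
  split; [rewrite (lambda3_u_of N n k M En EN hk hM); exact H0|].
  exists (eps_of N n), (u_of N n).
  split; [reflexivity|]. split; [reflexivity|].
  split; [apply continuous_eps_of|].
  split; [apply (ex_derive_continuous (u_of N n)), (ex_derive_u_of N n k M En EN hk hM)|].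
  split.
  - assert (Hl : at_left y regular_state) by (apply filter_le_within, Hloc).
    generalize (filter_and _ _ Hl HL). apply filter_imp. intros z [h1 h2].
    split; [apply regular_state_pitchfork, h1|]. rewrite (lambda3_u_of N n k M En EN hk hM). exact h2.
  - assert (Hr : at_right y regular_state) by (apply filter_le_within, Hloc).
    generalize (filter_and _ _ Hr HR). apply filter_imp. intros z [h1 h2].
    split; [apply regular_state_pitchfork, h1|]. rewrite (lambda3_u_of N n k M En EN hk hM). exact h2.
Qed.

(** [lambda1] = 0 forces u = [u_of] y. Nothing in a pitchfork fixes the sign of y: a negative y is
    reflected, [lambda3_of] being even, and y = 0 is excluded by [lambda3_of_neg_0]. *)
Lemma subcritical_witness (eps u y : R) : subcritical_pitchfork N n eps u y ->
  exists yp, 0 < yp /\ 0 < lambda3_of N n yp.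
Proof.
  intros [(_ & Hu & Hl1 & _) Hl3].
  assert (E := lambda1_root N n k M En EN hk hM y u Hu Hl1).
  rewrite E, (lambda3_u_of N n k M En EN hk hM) in Hl3.
  destruct (Rtotal_order y 0) as [h|[h|h]].
  - exists (- y). rewrite (lambda3_of_opp N n k M En EN hk hM). split; lra.
  - assert (T := lambda3_of_neg_0 N n k M En EN hk hM). rewrite h in Hl3. lra.
  - exists y. split; assumption.
Qed.

End PitchforkPoints.

Theorem theorem1 (N n : nat) (hn : (2 <= n)%nat) (hN : (2 * n < N)%nat) :
  (forall yp : R, 0 < yp -> 0 < lambda3_of N n yp ->
     (exists y0 : R,
        0 < y0 < yp /\ lambda3_of N n y0 = 0 /\
        pitchfork_transition N n (eps_of N n y0) (u_of N n y0) y0 /\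
        at_right y0 (fun y => cascade N n (eps_of N n y) (u_of N n y))) /\
     ((2 * n + 1 < N)%nat ->
      exists y1 : R, yp < y1 /\ lambda3_of N n y1 = 0)) /\
  (~ (exists yp : R, 0 < yp /\ 0 < lambda3_of N n yp) ->
     (forall eps u y : R, ~ pitchfork_transition N n eps u y) /\
     (forall eps u : R, ~ cascade N n eps u)).
Proof.
  set (k := INR (n - 1)). set (M := INR (N - 2 * n)).
  assert (En : INR n = k + 1) by (unfold k; rewrite minus_INR by lia; simpl; ring).
  assert (EN : INR N = M + 2 * k + 2).
  { unfold M, k. rewrite !minus_INR, mult_INR by lia. simpl. ring. }
  assert (dk : k = 1 \/ 2 <= k).
  { destruct (Nat.eq_dec n 2) as [->|h]; [left; reflexivity | right].
    apply (le_INR 2). lia. }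
  assert (dM : M = 1 \/ 2 <= M).
  { unfold M. destruct (Nat.eq_dec (N - 2 * n) 1) as [->|h]; [left; reflexivity | right].
    apply (le_INR 2). lia. }
  assert (dkM : M <= k ^ 2 \/ k ^ 2 + 1 <= M).
  { unfold M, k. rewrite <- pow_INR.
    destruct (Nat.le_gt_cases (N - 2 * n) ((n - 1) ^ 2)) as [h|h]; [left; apply le_INR, h | right].
    rewrite <- S_INR. apply le_INR, h. }
  assert (hk : 1 <= k) by lra. assert (hM : 1 <= M) by lra.
  split.
  - intros yp Hyp Hpos. split.
    + destruct (first_sign_change N n k M En EN hk hM yp Hyp Hpos) as (y0 & Hy0 & H0 & Hneg & HL & HR).
      assert (Hreg : regular_state N n k M y0).
      { split; [lra|]. split.
        - apply (eps_of_pos N n k M En EN hk hM dk dM dkM); [lra | assumption].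
        - apply (crossing_speed_pos N n k M En EN hk hM dk dM dkM); [lra | assumption]. }
      exists y0. split; [assumption|]. split; [assumption|]. split.
      * apply (regular_state_transition N n k M En EN hk hM); assumption.
      * assert (Hr : at_right y0 (regular_state N n k M))
          by (apply filter_le_within, (regular_state_open N n k M En EN hk hM), Hreg).
        generalize (filter_and _ _ Hr HR). apply filter_imp. intros y [h1 h2].
        apply (regular_state_cascade N n k M ltac:(lia) hN En EN hk hM); assumption.
    + intros HM1.
      assert (hM1 : 1 < M) by (apply (lt_INR 1); lia).
      destruct (lambda3_of_eventually_neg N n k M En EN hk hM yp Hyp hM1) as (y & Hy & Hneg).
      destruct (Ranalysis5.IVT_interv (fun y => - lambda3_of N n y) yp y) as [y1 [Hy1 E1]].
      * intros a _. apply continuity_pt_opp, continuity_pt_filterlim.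
        apply (continuous_lambda3_of N n k M En EN hk hM).
      * exact Hy.
      * lra.
      * lra.
      * exists y1. split; [|lra]. destruct Hy1 as [[h|h] _]; [assumption|].
        rewrite <- h in E1. lra.
  - intros Hno. split.
    + intros eps u y (_ & _ & E & U & _ & _ & _ & _ & _ & [d Hd]). apply Hno.
      assert (hd := cond_pos d).
      (* A transition yields subcritical pitchforks immediately to the right of y, whatever the
         curves E and U are; one of them is enough. *)
      apply (subcritical_witness N n k M En EN hk hM (E (y + d / 2)) (U (y + d / 2)) (y + d / 2)).
      apply Hd; [|lra]. change (Rabs (y + d / 2 - y) < d). rewrite Rabs_pos_eq; lra.
    + intros eps u (y & Hs & _). apply Hno. exact (subcritical_witness N n k M En EN hk hM eps u y Hs).
Qed.
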